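(* Let $k\in\{2,3\}$, let $\Theta=\mathtt{S}_k$ be the symmetric group on $\{0,\dots,k-1\}$, let $G$ be a completion of $\Theta$, and let $U$ be a countably infinite set. Then: (i) the Polish space $\widetilde{\mathsf{S}}_k(U,G)$ has cardinality $2^{\aleph_0}$, and $\widetilde{\mathsf{ST}}_k(U,G)$ is a comeagre subset of $\widetilde{\mathsf{S}}_k(U,G)$; (ii) $G$ is non-split and finitely presented.
   Context: All actions are right actions. Completions of $\mathtt{S}_k$ for $k=2,3$: a subgroup $\Omega\leq\mathtt{S}_k$ is docile if its permutation action on $\{0,\dots,k-1\}$ has at least one free orbit. Fix a set $\mathcal{D}(\mathtt{S}_k)$ of representatives of the $\mathtt{S}_k$-conjugacy classes of docile subgroups (so $\mathcal{D}(\mathtt{S}_2)=\{1,\mathtt{S}_2\}$ and $\mathcal{D}(\mathtt{S}_3)=\{1,\langle\sigma\rangle,\langle\tau\rangle\}$ with $\sigma$ an involution and $\tau$ of order $3$). For each $\Omega\in\mathcal{D}(\mathtt{S}_k)$ let $T_\Omega$ be a finite set with at least two elements, and let $F$ be the free group on the disjoint union of the sets $T_\Omega$. The completion $G$ is the quotient of $\mathtt{S}_k\ast F$ by the normal closure of $\{[\omega,t]:\Omega\in\mathcal{D}(\mathtt{S}_k),\ \omega\in\Omega,\ t\in T_\Omega\}$. An action is $k$-sharp if no non-identity group element fixes $k$ distinct points, and sharply $k$-transitive if for any two $k$-tuples of distinct points there is a unique group element mapping the first to the second. The set of actions of $G$ on $U$ is topologised as a subspace of $\mathrm{Sym}(U)^G$,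 with $\mathrm{Sym}(U)$ carrying the pointwise convergence topology. $\widetilde{\mathsf{S}}_2(U,G)$ is the space of $2$-sharp actions $U\curvearrowleft G$ in which every involution acts without fixed points. $\widetilde{\mathsf{S}}_3(U,G)$ is the space of $3$-sharp actions $U\curvearrowleft G$ in which each involution has exactly one fixed point and each element of order $3$ acts without fixed points. $\widetilde{\mathsf{ST}}_k(U,G)$ is the subspace of $\widetilde{\mathsf{S}}_k(U,G)$ consisting of the sharply $k$-transitive actions. Non-split: for $k=2$, $G$ is non-split if it has no non-trivial abelian normal subgroup; for $k=3$, $G$ is non-split if, for a sharply $3$-transitive action of $G$ on an infinite set, each point-stabiliser has no non-trivial abelian normal subgroup. *)

(* Defs.v *)
From HB Require Import structures.
From mathcomp Require Import all_boot all_order all_algebra all_fingroup.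
From mathcomp Require Import generic_quotient.
From mathcomp Require Import all_classical all_reals topology.

Set Implicit Arguments.
Unset Strict Implicit.
Unset Printing Implicit Defensive.

Local Open Scope classical_set_scope.
Local Open Scope group_scope.
Local Open Scope quotient_scope.

(** [L] is an alphabet, [iota a] the letter that becomes the inverse of [a],
    and [rel] a set of pairs of words that are identified. *)

Section WordGroup.
Variables (L : choiceType) (iota : L -> L) (rel : seq L -> seq L -> Prop).

Inductive word_cong : seq L -> seq L -> Prop :=
| wc_refl u : word_cong u u
| wc_sym u v : word_cong u v -> word_cong v u
| wc_trans u v w : word_cong u v -> word_cong v w -> word_cong u w
| wc_cat u u' v v' :
    word_cong u u' -> word_cong v v' -> word_cong (u ++ v) (u' ++ v')
| wc_cancel_r a : word_cong [:: a; iota a] [::]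
| wc_cancel_l a : word_cong [:: iota a; a] [::]
| wc_rel u v : rel u v -> word_cong u v.

Definition word_congb (u v : seq L) : bool := `[< word_cong u v >].

Lemma word_congb_refl : reflexive word_congb.
Proof. by move=> u; apply/asboolP; exact: wc_refl. Qed.

Lemma word_congb_sym : symmetric word_congb.
Proof. by move=> u v; apply/asboolP/asboolP; exact: wc_sym. Qed.

Lemma word_congb_trans : transitive word_congb.
Proof.
by move=> v u w /asboolP uv /asboolP vw; apply/asboolP; exact: wc_trans vw.
Qed.

Canonical word_equiv :=
  EquivRel word_congb word_congb_refl word_congb_sym word_congb_trans.

Definition word_group : Type := {eq_quot word_equiv}.

HB.instance Definition _ := Choice.on word_group.

Definition word_class (u : seq L) : word_group := \pi_({eq_quot word_equiv}) u.

Definition word_repr (x : word_group) : seq L :=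
  repr (x : {eq_quot word_equiv}).

Lemma word_reprK x : word_class (word_repr x) = x.
Proof. exact: reprK. Qed.

Lemma word_classP u v : word_class u = word_class v <-> word_cong u v.
Proof.
split=> [/eqmodP/asboolP//|uv]; apply/eqmodP; exact/asboolP.
Qed.

Lemma word_repr_class u : word_cong (word_repr (word_class u)) u.
Proof. by apply/word_classP; rewrite word_reprK. Qed.

Definition word_one : word_group := word_class [::].
Definition word_mul (x y : word_group) : word_group :=
  word_class (word_repr x ++ word_repr y).
Definition word_inv (x : word_group) : word_group :=
  word_class (rev (map iota (word_repr x))).

Lemma word_mulE u v :
  word_mul (word_class u) (word_class v) = word_class (u ++ v).
Proof. by apply/word_classP/wc_cat; exact: word_repr_class. Qed.

Lemma word_mulA : associative word_mul.
Proof.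
move=> x y z; rewrite -(word_reprK x) -(word_reprK y) -(word_reprK z).
by rewrite !word_mulE catA.
Qed.

Lemma word_mul1 : left_id word_one word_mul.
Proof. by move=> x; rewrite -(word_reprK x) word_mulE. Qed.

Lemma word_mulr1 : right_id word_one word_mul.
Proof. by move=> x; rewrite -(word_reprK x) word_mulE cats0. Qed.

Lemma word_mulV : left_inverse word_one word_inv word_mul.
Proof.
move=> x; rewrite -{2}(word_reprK x) word_mulE; apply/word_classP.
elim: (word_repr x) => [|a u IH]; first exact: wc_refl.
rewrite map_cons rev_cons cat_rcons.
apply: wc_trans IH; apply: wc_cat; first exact: wc_refl.
by apply: (@wc_cat [:: iota a; a] [::] u u); [exact: wc_cancel_l|exact: wc_refl].
Qed.

Lemma word_mulrV : right_inverse word_one word_inv word_mul.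
Proof.
move=> x; rewrite -{1}(word_reprK x) word_mulE; apply/word_classP.
elim: (word_repr x) => [|a u IH]; first exact: wc_refl.
rewrite map_cons rev_cons -cats1 cat_cons.
apply: wc_trans (wc_cancel_r a).
apply: (@wc_cat [:: a] [:: a]); first exact: wc_refl.
rewrite catA; apply: (@wc_cat _ [::] [:: iota a] [:: iota a]) => //.
exact: wc_refl.
Qed.

HB.instance Definition _ := isGroup.Build word_group
  word_mulA word_mul1 word_mulr1 word_mulV word_mulrV.

End WordGroup.

(** The letter [(x, false)] is the generator [x], [(x, true)] its inverse. *)
Definition free_group (X : choiceType) : groupType :=
  @word_group (X * bool)%type (fun a => (a.1, ~~ a.2)) (fun _ _ => False).

Definition free_gen (X : choiceType) (x : X) : free_group X :=
  word_class _ _ [:: (x, false)].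

Section FreeProduct.
Variables A B : groupType.

Inductive free_product_rel : seq (A + B) -> seq (A + B) -> Prop :=
| fp_one_l : free_product_rel [:: inl 1] [::]
| fp_one_r : free_product_rel [:: inr 1] [::]
| fp_mul_l a a' : free_product_rel [:: inl a; inl a'] [:: inl (a * a')]
| fp_mul_r b b' : free_product_rel [:: inr b; inr b'] [:: inr (b * b')].

Definition free_product_inv (c : A + B) : A + B :=
  match c with inl a => inl a^-1 | inr b => inr b^-1 end.

Definition free_product : groupType :=
  @word_group (A + B)%type free_product_inv free_product_rel.

Definition fp_inl (a : A) : free_product := word_class _ _ [:: inl a].
Definition fp_inr (b : B) : free_product := word_class _ _ [:: inr b].

End FreeProduct.

Section Subgroups.
Variable G : groupType.
Implicit Types (H N S : set G) (g : G).

Definition subgroup H : Prop :=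
  [/\ H 1, forall x y, H x -> H y -> H (x * y) & forall x, H x -> H x^-1].

(** [N] is a normal subgroup of the subgroup [H]. *)
Definition normal_in N H : Prop :=
  [/\ subgroup N, N `<=` H & forall n h, N n -> H h -> N (n ^ h)].

Definition normal_closure S : set G :=
  [set g | forall N, normal_in N [set: G] -> S `<=` N -> N g].

Definition abelian_set N : Prop := forall x y, N x -> N y -> x * y = y * x.

Definition no_nontrivial_abelian_normal H : Prop :=
  forall N, normal_in N H -> abelian_set N -> N = [set 1].

Definition has_order (n : nat) g : Prop :=
  [/\ (0 < n)%N, g ^+ n = 1 & forall m, (0 < m < n)%N -> g ^+ m <> 1].

Lemma normal_closure_normal S : normal_in (normal_closure S) [set: G].
Proof.
split=> //.
- split=> [N [[N1 _ _] _ _] _ //|x y Sx Sy N nN SN|x Sx N nN SN];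
    have [[_ NM NV] _ _] := nN.
  + by apply: NM; [exact: Sx|exact: Sy].
  + by apply: NV; exact: Sx.
- by move=> n h Sn _ N nN SN; case: (nN) => _ _; apply=> //; exact: Sn.
Qed.

End Subgroups.

Section QuotientGroup.
Variables (G : groupType) (S : set G).

Definition ncl_congb (x y : G) : bool := `[< normal_closure S (x * y^-1) >].

Let nclM x y :
  normal_closure S x -> normal_closure S y -> normal_closure S (x * y).
Proof. by case: (normal_closure_normal S) => -[_ M _] _ _; exact: M. Qed.

Let nclV x : normal_closure S x -> normal_closure S x^-1.
Proof. by case: (normal_closure_normal S) => -[_ _ V] _ _; exact: V. Qed.

Let nclJ x y : normal_closure S x -> normal_closure S (x ^ y).
Proof. by case: (normal_closure_normal S) => _ _ J Sx; exact: J. Qed.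

Lemma ncl_congb_refl : reflexive ncl_congb.
Proof.
move=> x; apply/asboolP; rewrite mulgV.
by case: (normal_closure_normal S) => -[].
Qed.

Lemma ncl_congb_sym : symmetric ncl_congb.
Proof.
by move=> x y; apply/asboolP/asboolP => /nclV; rewrite invgM invgK.
Qed.

Lemma ncl_congb_trans : transitive ncl_congb.
Proof.
move=> y x z /asboolP xy /asboolP yz; apply/asboolP.
by have := nclM xy yz; rewrite mulgA mulgVK.
Qed.

Canonical ncl_equiv :=
  EquivRel ncl_congb ncl_congb_refl ncl_congb_sym ncl_congb_trans.

Definition ncl_quotient : Type := {eq_quot ncl_equiv}.

HB.instance Definition _ := Choice.on ncl_quotient.

Definition ncl_class (x : G) : ncl_quotient := \pi_({eq_quot ncl_equiv}) x.

Definition ncl_repr (q : ncl_quotient) : G := repr (q : {eq_quot ncl_equiv}).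

Lemma ncl_reprK q : ncl_class (ncl_repr q) = q.
Proof. exact: reprK. Qed.

Lemma ncl_classP x y :
  ncl_class x = ncl_class y <-> normal_closure S (x * y^-1).
Proof. by split=> [/eqmodP/asboolP//|xy]; apply/eqmodP; exact/asboolP. Qed.

Lemma ncl_repr_class x : normal_closure S (ncl_repr (ncl_class x) * x^-1).
Proof. by apply/ncl_classP; rewrite ncl_reprK. Qed.

Definition nclq_one : ncl_quotient := ncl_class 1.
Definition nclq_mul (p q : ncl_quotient) : ncl_quotient :=
  ncl_class (ncl_repr p * ncl_repr q).
Definition nclq_inv (q : ncl_quotient) : ncl_quotient :=
  ncl_class (ncl_repr q)^-1.

Lemma nclq_mulE x y :
  nclq_mul (ncl_class x) (ncl_class y) = ncl_class (x * y).
Proof.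
apply/ncl_classP; set x' := ncl_repr _; set y' := ncl_repr _.
have -> : x' * y' * (x * y)^-1 = (y' * y^-1) ^ x'^-1 * (x' * x^-1).
  by rewrite conjgE invgK invgM !mulgA mulgVK.
by apply: nclM; [apply: nclJ|]; exact: ncl_repr_class.
Qed.

Lemma nclq_mulA : associative nclq_mul.
Proof.
move=> x y z; rewrite -(ncl_reprK x) -(ncl_reprK y) -(ncl_reprK z).
by rewrite !nclq_mulE mulgA.
Qed.

Lemma nclq_mul1 : left_id nclq_one nclq_mul.
Proof. by move=> x; rewrite -(ncl_reprK x) nclq_mulE mul1g. Qed.

Lemma nclq_mulr1 : right_id nclq_one nclq_mul.
Proof. by move=> x; rewrite -(ncl_reprK x) nclq_mulE mulg1. Qed.

Lemma nclq_mulV : left_inverse nclq_one nclq_inv nclq_mul.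
Proof. by move=> x; rewrite -{2}(ncl_reprK x) nclq_mulE mulVg. Qed.

Lemma nclq_mulrV : right_inverse nclq_one nclq_inv nclq_mul.
Proof. by move=> x; rewrite -{1}(ncl_reprK x) nclq_mulE mulgV. Qed.

HB.instance Definition _ := isGroup.Build ncl_quotient
  nclq_mulA nclq_mul1 nclq_mulr1 nclq_mulV nclq_mulrV.

End QuotientGroup.

Definition finitely_presented (G : groupType) : Prop :=
  exists (X : finType) (R : seq (free_group X))
         (f : {multiplicative ncl_quotient [set r | r \in R] -> G}),
    bijective f.

Section Completion.
Variable k : nat.

(** Permutations of ['I_k] compose from left to right, so ['P] is a right
    action. *)
Definition docile (W : {group 'S_k}) : bool :=
  [exists O in orbit 'P W @: [set: 'I_k]%SET,
    [forall i in O, forall w in W, ((w : 'S_k) i == i) ==> (w == 1)]].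

Definition docile_groups : {set {group 'S_k}} := [set W | docile W]%SET.

(** Exactly one element of [D] in each conjugacy class of docile subgroups. *)
Definition docile_representatives (D : {set {group 'S_k}}) : Prop :=
  is_transversal D (orbit 'JG [set: 'S_k]%SET @: docile_groups) docile_groups.

Variables (D : {set {group 'S_k}}) (T : {W : {group 'S_k} | W \in D} -> finType).

Definition stable_letter : finType := {W : {W : {group 'S_k} | W \in D} & T W}.

Definition completion_relators :
    set (free_product 'S_k (free_group stable_letter)) :=
  [set r | exists (W : {W : {group 'S_k} | W \in D}) (w : 'S_k) (t : T W),
     w \in val W /\
     r = [~ fp_inl _ w, fp_inr _ (free_gen (Tagged T t : stable_letter))]].

Definition completion : groupType := ncl_quotient completion_relators.

End Completion.

Section Actions.
Variables (G : groupType) (V : Type).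
Implicit Type a : V -> G -> V.

Definition right_action a : Prop :=
  (forall v, a v 1 = v) /\ (forall v g h, a v (g * h) = a (a v g) h).

Definition point_stabiliser a (v : V) : set G := [set g | a v g = v].

Definition sharp (k : nat) a : Prop :=
  forall (g : G) (x : 'I_k -> V), injective x ->
    (forall i, a (x i) g = x i) -> g = 1.

Definition sharply_transitive (k : nat) a : Prop :=
  forall x y : 'I_k -> V, injective x -> injective y ->
    exists! g : G, forall i, a (x i) g = y i.

End Actions.

(** For [k = 3], "for a sharply 3-transitive action" is read as: there is such
    an action, and the condition holds for each of them. *)
Definition non_split (k : nat) (G : groupType) : Prop :=
  (k = 2 -> no_nontrivial_abelian_normal [set: G]) /\
  (k = 3 ->
    (exists (V : Type) (a : V -> G -> V),
       [/\ infinite_set [set: V], right_action a & sharply_transitive 3 a]) /\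
    (forall (V : Type) (a : V -> G -> V),
       infinite_set [set: V] -> right_action a -> sharply_transitive 3 a ->
       forall v : V, no_nontrivial_abelian_normal (point_stabiliser a v))).

Section Spaces.
Variables (U : choiceType) (G : groupType).

(** [set_type A] carries the subspace topology, so this is the set of
    bijections of [U] with the topology of pointwise convergence. *)
Definition perm_space : Type :=
  set_type [set f : {ptws U -> discrete_topology U} | bijective f].

HB.instance Definition _ := Topological.on perm_space.

Definition act_of (s : {ptws G -> perm_space}) : U -> G -> U :=
  fun u g => set_val (s g) u.

Definition sharp_actions (k : nat) : set {ptws G -> perm_space} :=
  [set s | let a := act_of s in
    [/\ right_action a,
        sharp k a,
        k = 2 -> forall g, has_order 2 g -> forall u, a u g <> u
      & k = 3 ->
        (forall g, has_order 2 g -> exists! u, a u g = u) /\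
        (forall g, has_order 3 g -> forall u, a u g <> u)]].

Definition sharply_transitive_actions (k : nat) :
    set (set_type (sharp_actions k)) :=
  [set s | sharply_transitive k (act_of (set_val s))].

End Spaces.

Arguments perm_space U : clear implicits.
Arguments sharp_actions U G k : clear implicits.
Arguments sharply_transitive_actions U G k : clear implicits.

Section Polish.
Local Open Scope ring_scope.

Definition complete_metric (R : realType) (X : topologicalType)
    (d : X -> X -> R) : Prop :=
  [/\ forall x y, d x y = 0 <-> x = y,
      forall x y, d x y = d y x,
      forall x y z, d x z <= d x y + d y z,
      forall (x : X) (A : set X),
        nbhs x A <-> exists2 e : R, 0 < e & [set y | d x y < e] `<=` A
    & forall u : nat -> X,
        (forall e : R, 0 < e -> exists N : nat, forall m n : nat,
           (N <= m)%N -> (N <= n)%N -> d (u m) (u n) < e) ->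
        exists l : X, u @ \oo --> l].

Definition polish (R : realType) (X : topologicalType) : Prop :=
  (exists2 S : set X, countable S & dense S) /\
  (exists d : X -> X -> R, complete_metric d).

End Polish.

Definition nowhere_dense (X : topologicalType) (A : set X) : Prop :=
  (closure A)° = set0.

Definition meagre (X : topologicalType) (A : set X) : Prop :=
  exists2 F : nat -> set X, (forall n, nowhere_dense (F n)) & A `<=` \bigcup_n F n.

Definition comeagre (X : topologicalType) (A : set X) : Prop := meagre (~` A).

(* Main.v *)
(** On top of an action of [S_k] on [U] made of one natural orbit and infinitely
    many regular ones, a finite partial action of the stable letters is called
    good when the reduced words that can be read simultaneously from [k]
    distinct points have bounded length. Good partial actions extend, by edges
    leading to fresh points, to actions of [G]; these are [k]-sharp, since the
    powers of a cyclically reduced word fixing [k] points could all be read from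
    them. Read along fresh points, a nonempty reduced word acts non-trivially:
    this is Britton's lemma, and the torsion of [G] is conjugate into [S_k].
    Conversely every action in the space restricts to a good partial action on
    any finite set of points, by sharpness.

    Sharply transitive actions are dense because any tuple can be moved onto the
    natural orbit by extending a good partial action. Otherwise take an extension
    in which the setwise stabiliser of the tuple is largest. Up to conjugacy it
    is a docile [W] among the representatives. Two distinct letters of [T_W] are
    used to move the tuple and the natural orbit along paths of fresh points,
    and the tuple is joined to the natural orbit by a final edge after a tail
    spelling a word that is readable nowhere else. A new edge cannot be crossed
    more than twice in the middle of a reduced word, as that would produce a
    larger stabiliser or a connection, so the result is good.

    The space is complete once the fixed points of the involutions are recorded
    together with the action. It has the cardinality of the continuum because
    the conjugates of a transitive action by distinct permutations of [U] fixing
    a common point are distinct. *)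

Require Import Defs.
From HB Require Import structures.
From mathcomp Require Import all_boot all_order all_algebra all_fingroup all_solvable.
From mathcomp Require Import all_classical all_reals topology.
From mathcomp Require Import zify.

Set Implicit Arguments.
Unset Strict Implicit.
Unset Printing Implicit Defensive.

Local Open Scope classical_set_scope.
Local Open Scope group_scope.

(** * Universal properties *)

(** Two points are left open by the overview. First, why the stabiliser matters: an edge joining two
    tuples creates unboundedly long readable words as soon as a path can leave the tuple, return to
    it and cross the edge again. The returns have to be spelled by permutations in the group of the
    letter, which then cancel. Hence the setwise stabiliser must equal that group, and it must not
    grow in later extensions; maximality guarantees this. Second, why [G] is non-split. In a sharply
    2-transitive group a non-trivial abelian normal subgroup acts regularly, and this forces every
    element commuting with a fixed-point-free involution to have square 1. In [G], however, an
    involution commutes with a conjugate of a stable letter, whose square is non-trivial by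
    Britton's lemma. For [k = 3] this applies to a point stabiliser acting on the other points,
    unless the involution has a second fixed point; then two distinct commuting involutions appear.
    Their product would be an involution of even image under the retraction of [G] onto S_k, while
    involutions have odd image. *)

Section WordLift.
Variables (L : choiceType) (iota : L -> L) (rel : seq L -> seq L -> Prop).
Variables (H : groupType) (f : L -> H).
Hypothesis fV : forall a, f (iota a) = (f a)^-1.
Let F (u : seq L) := \prod_(a <- u) f a.
Hypothesis F_rel : forall u v, rel u v -> F u = F v.

Definition word_lift (x : word_group iota rel) : H := F (word_repr x).

Lemma word_cong_lift u v : word_cong iota rel u v -> F u = F v.
Proof.
elim=> {u v} //.
- by move=> u v w _ -> _ ->.
- by move=> u u' v v' _ uu' _ vv'; rewrite /F !big_cat /= -/(F u) -/(F v) uu' vv'.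
- by move=> a; rewrite /F !big_cons big_nil mulg1 fV mulgV.
- by move=> a; rewrite /F !big_cons big_nil mulg1 fV mulVg.
Qed.

Lemma word_liftE u : word_lift (word_class iota rel u) = F u.
Proof. by apply: word_cong_lift; exact: word_repr_class. Qed.

Lemma word_liftM : {morph word_lift : x y / x * y}.
Proof.
move=> x y; rewrite -(word_reprK x) -(word_reprK y).
have -> : word_class iota rel (word_repr x) * word_class iota rel (word_repr y)
   = word_class iota rel (word_repr x ++ word_repr y) by exact: word_mulE.
by rewrite !word_liftE /F big_cat.
Qed.

End WordLift.

Lemma word_ind (L : choiceType) (iota : L -> L) (rel : seq L -> seq L -> Prop)
    (P : word_group iota rel -> Prop) :
  P 1 -> (forall x a, P x -> P (x * word_class iota rel [:: a])) ->
  forall x, P x.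
Proof.
move=> P1 PM x; rewrite -(word_reprK x).
elim/last_ind: (word_repr x) => [//|u a IH]; rewrite -cats1.
have -> : word_class iota rel (u ++ [:: a]) =
   word_class iota rel u * word_class iota rel [:: a].
  by symmetry; exact: word_mulE.
exact: PM.
Qed.

Lemma morph_one (G H : groupType) (f : G -> H) :
  {morph f : x y / x * y} -> f 1 = 1.
Proof. by move=> fM; apply: (mulgI (f 1)); rewrite -fM !mulg1. Qed.

Lemma morph_inv (G H : groupType) (f : G -> H) :
  {morph f : x y / x * y} -> forall x, f x^-1 = (f x)^-1.
Proof.
move=> fM x; apply: (mulgI (f x)).
by rewrite -fM !mulgV (morph_one fM).
Qed.

Lemma free_lift (X : choiceType) (H : groupType) (h : X -> H) :
  exists2 f : free_group X -> H,
    {morph f : x y / x * y} & forall x, f (free_gen x) = h x.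
Proof.
pose l (a : X * bool) := if a.2 then (h a.1)^-1 else h a.1.
have lV (a : X * bool) : l (a.1, ~~ a.2) = (l a)^-1.
  by case: a => x [] //=; rewrite /l /= invgK.
have lrel (u v : seq (X * bool)) : False ->
  \prod_(a <- u) l a = \prod_(a <- v) l a by [].
exists (word_lift l); first exact: word_liftM.
by move=> x; rewrite word_liftE // big_seq1.
Qed.

Lemma free_product_lift (A B H : groupType) (f : A -> H) (g : B -> H) :
  {morph f : x y / x * y} -> {morph g : x y / x * y} ->
  exists2 F : free_product A B -> H, {morph F : x y / x * y} &
    (forall a, F (fp_inl B a) = f a) /\ (forall b, F (fp_inr A b) = g b).
Proof.
move=> fM gM.
pose l (c : A + B) := match c with inl a => f a | inr b => g b end.
have lV c : l (free_product_inv c) = (l c)^-1.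
  by case: c => c /=; exact: morph_inv.
have lrel (u v : seq (A + B)) : free_product_rel u v ->
    \prod_(a <- u) l a = \prod_(a <- v) l a.
  case=> [||a a'|b b']; rewrite !big_cons ?big_nil /= ?mulg1 ?fM ?gM //.
    exact: morph_one.
  exact: morph_one.
exists (word_lift l); first exact: word_liftM.
by split=> c; rewrite word_liftE // big_seq1.
Qed.

Lemma ncl_classM (G : groupType) (S : set G) :
  {morph @ncl_class G S : x y / x * y}.
Proof. by move=> x y; symmetry; exact: nclq_mulE. Qed.

Lemma ncl_lift (G H : groupType) (S : set G) (f : G -> H) :
  {morph f : x y / x * y} -> (forall x, S x -> f x = 1) ->
  exists2 F : ncl_quotient S -> H, {morph F : x y / x * y} &
    forall x, F (ncl_class S x) = f x.
Proof.
move=> fM fS.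
have fcl x y : normal_closure S (x * y^-1) -> f x = f y.
  move=> /(_ [set g | f g = 1]) /= h.
  apply/eqP; rewrite -divg_eq1; apply/eqP.
  rewrite -(morph_inv fM) -fM; apply: h => //.
  split=> //; first split=> /=.
  - exact: morph_one.
  - by move=> a b; rewrite fM => -> ->; rewrite mulg1.
  - by move=> a fa; rewrite (morph_inv fM) fa invg1.
  - by move=> n h /= fn _; rewrite conjgE !fM fn mul1g -fM mulVg (morph_one fM).
pose F (q : ncl_quotient S) : H := f (ncl_repr q).
have FE x : F (ncl_class S x) = f x by apply: fcl; exact: ncl_repr_class.
exists F => //.
move=> p q; rewrite -(ncl_reprK p) -(ncl_reprK q) -ncl_classM !FE; exact: fM.
Qed.

Section CompletionInterface.
Variables (k : nat) (D : {set {group 'S_k}}).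
Variable T : {W : {group 'S_k} | W \in D} -> finType.

Definition letter : Type := (stable_letter T * bool)%type.
HB.instance Definition _ := Finite.on letter.

Definition linv (a : letter) : letter := (a.1, ~~ a.2).
Definition lgrp (a : letter) : {group 'S_k} := val (tag a.1).

Lemma linvK : involutive linv.
Proof. by case=> x b; rewrite /linv /= negbK. Qed.

Lemma linv_neq a : linv a <> a.
Proof. by case: a => x [] []. Qed.

Definition cperm (w : 'S_k) : completion T := ncl_class _ (fp_inl _ w).
Definition cgen (t : stable_letter T) : completion T :=
  ncl_class _ (fp_inr _ (free_gen t)).
Definition clet (a : letter) : completion T :=
  if a.2 then (cgen a.1)^-1 else cgen a.1.

Lemma cpermM : {morph cperm : x y / x * y}.
Proof.
move=> x y; rewrite /cperm -ncl_classM; congr ncl_class.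
rewrite /fp_inl; symmetry.
transitivity (word_class (@free_product_inv 'S_k (free_group (stable_letter T)))
   (@free_product_rel _ _) [:: inl x; inl y]); first exact: word_mulE.
by apply/word_classP; apply: wc_rel; exact: fp_mul_l.
Qed.

Lemma clet_inv a : clet (linv a) = (clet a)^-1.
Proof. by case: a => x [] /=; rewrite /clet //= invgK. Qed.

Lemma cgen_comm t w : w \in lgrp (t, false) -> commute (cperm w) (cgen t).
Proof.
case: t => W t /= Ww; apply/commgP; apply/eqP; rewrite commgEl conjgE.
rewrite /cperm /cgen.
set a := fp_inl _ _; set b := fp_inr _ _.
set S := @completion_relators _ _ T; transitivity (ncl_class S [~ a, b]).
  by rewrite commgEl conjgE !ncl_classM !(morph_inv (@ncl_classM _ S)).
rewrite -[RHS](morph_one (@ncl_classM _ S)).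
apply/ncl_classP; rewrite invg1 mulg1 => N _; apply.
by exists W, w, t.
Qed.

Lemma clet_comm a w : w \in lgrp a -> cperm w * clet a = clet a * cperm w.
Proof.
case: a => t [] Ww; rewrite /clet /=; last exact: cgen_comm.
by apply/commuteV; exact: cgen_comm.
Qed.

Lemma free_gen_inv (X : choiceType) (x : X) :
  (free_gen x)^-1 = word_class _ _ [:: (x, true)] :> free_group X.
Proof.
apply: mulg1_eq.
transitivity (@word_class (X * bool)%type (fun a => (a.1, ~~ a.2)) (fun _ _ => False)
   [:: (x, false); (x, true)]); first exact: word_mulE.
apply/word_classP; exact: (@wc_cancel_r _ _ _ (x, false)).
Qed.

Lemma fp_inr_morph (A B : groupType) : {morph @fp_inr A B : x y / x * y}.
Proof.
move=> x y; symmetry.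
transitivity (word_class (@free_product_inv A B)
   (@free_product_rel _ _) [:: inr x; inr y]); first exact: word_mulE.
by apply/word_classP; apply: wc_rel; exact: fp_mul_r.
Qed.

Lemma completion_ind (P : completion T -> Prop) :
  P 1 -> (forall x w, P x -> P (x * cperm w)) ->
  (forall x a, P x -> P (x * clet a)) -> forall x, P x.
Proof.
move=> P1 PS PA q; rewrite -(ncl_reprK q).
elim/word_ind: (ncl_repr q) => [|x c IH]; first exact: P1.
rewrite ncl_classM; case: c => [w|b]; first exact: PS.
move: x IH; elim/word_ind: b => [|b [t s] IHb] x IH.
  have -> : word_class (@free_product_inv 'S_k (free_group (stable_letter T)))
     (@free_product_rel _ _) [:: inr 1] = 1.
    by apply/word_classP; apply: wc_rel; exact: fp_one_r.
  by rewrite (morph_one (@ncl_classM _ _)) mulg1.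
rewrite -/(fp_inr _ _) fp_inr_morph ncl_classM mulgA.
have := IHb x IH; set y := _ * _ : completion T => Py.
set g := word_class _ _ _.
have -> : ncl_class (@completion_relators _ _ T) (fp_inr _ g) = clet (t, s).
  rewrite /clet /=; case: s @g => //=.
  by rewrite -free_gen_inv (morph_inv (@fp_inr_morph _ _)) (morph_inv (@ncl_classM _ _)).
exact: PA.
Qed.

Lemma completion_lift (H : groupType) (f : 'S_k -> H) (h : stable_letter T -> H) :
  {morph f : x y / x * y} ->
  (forall t w, w \in lgrp (t, false) -> f w * h t = h t * f w) ->
  exists2 F : completion T -> H, {morph F : x y / x * y} &
    (forall w, F (cperm w) = f w) /\ (forall t, F (cgen t) = h t).
Proof.
move=> fM fh.
have [g gM gE] := free_lift h.
have [F FM [Ff Fg]] := free_product_lift fM gM.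
have Frel x : @completion_relators _ _ T x -> F x = 1.
  case=> W [w [t [Ww ->]]].
  rewrite commgEl conjgE !FM !(morph_inv FM) Ff Fg gE.
  rewrite fh ?mulKg ?mulVg //.
have [F' FM' FE'] := ncl_lift FM Frel.
exists F' => //; split=> x; first by rewrite FE' Ff.
by rewrite FE' Fg gE.
Qed.

End CompletionInterface.

(** * Permutations of two or three points *)

Section SmallPerm.
Variables (k : nat) (hk : k = 2 \/ k = 3).

(** There are at most three indices; for [k = 2] the three disequalities are already
    contradictory. *)
Lemma ord3_cases (a b c d : 'I_k) :
  a <> b -> a <> c -> b <> c -> [\/ d = a, d = b | d = c].
Proof.
move=> ab ac bc.
have ne (x y : 'I_k) : x <> y -> nat_of_ord x <> y by move=> xy /val_inj.
have := ne _ _ ab; have := ne _ _ ac; have := ne _ _ bc.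
have := ltn_ord a; have := ltn_ord b; have := ltn_ord c; have := ltn_ord d.
move=> ? ? ? ? ? ? ?.
have : [\/ nat_of_ord d = a, nat_of_ord d = b | nat_of_ord d = c].
  have : nat_of_ord d = a \/ nat_of_ord d = b \/ nat_of_ord d = c by lia.
  by case=> [?|[?|?]]; [constructor 1|constructor 2|constructor 3].
by case=> /val_inj ->; [constructor 1|constructor 2|constructor 3].
Qed.

(** Two fixed indices leave at most one other, which then has nowhere to go. *)
Lemma perm_fix2 (w : 'S_k) i j : w <> 1 -> w i = i -> w j = j -> i = j.
Proof.
move=> w1 wi wj; apply: contrapT => ij; apply: w1; apply/permP => l; rewrite perm1.
have [->//|li] := pselect (l = i); have [->//|lj] := pselect (l = j).
have nwi : w l <> i by rewrite -wi => /perm_inj.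
have nwj : w l <> j by rewrite -wj => /perm_inj.
by case: (ord3_cases (w l) ij (nesym li) (nesym lj)).
Qed.

Definition free_index (W : {group 'S_k}) (i : 'I_k) : Prop :=
  forall w, w \in W -> w i = i -> w = 1.

(** Stabilisers along an orbit are conjugate, so freeness can be tested at a single point. *)
Lemma docileP (W : {group 'S_k}) : docile W <-> exists i, free_index W i.
Proof.
split.
- case/existsP=> O /andP[/imsetP[i _ ->] /forallP h].
  exists i => w Ww wi; apply/eqP; move/(_ i): h; rewrite orbit_refl /=.
  by move/forallP/(_ w); rewrite Ww wi eqxx.
- case=> i fi; apply/existsP; exists (orbit 'P W i); rewrite imset_f ?inE //=.
  apply/forallP => j; apply/implyP => /orbitP[v Wv <-].
  apply/forallP => w; apply/implyP => Ww; apply/implyP => /eqP.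
  rewrite /= /aperm => e.
  have : v * w * v^-1 = 1.
    apply: fi; first by rewrite groupM ?groupM ?groupV.
    by rewrite !permM e permK.
  move=> /(congr1 (fun x => v^-1 * x * v)).
  by rewrite !mulgA mulVg mul1g mulg1 mulVg -mulgA mulVg mulg1 => ->.
Qed.

(** A non-trivial [w] moves [i], so [i] and [w i] are two points of the free orbit and [j] is the
    only index left. Outside its free orbit a docile group therefore acts trivially. *)
Lemma free_index_fix (W : {group 'S_k}) i j w : free_index W i ->
  (forall v, v \in W -> v i <> j) -> w \in W -> w j = j.
Proof.
move=> fi ij Ww; have [->|w1] := pselect (w = 1); first by rewrite perm1.
have wi : w i <> i by move=> /(fi _ Ww).
have nij : i <> j by move=> e; apply: (ij 1); rewrite // perm1.
case: (ord3_cases (w j) (nesym wi) nij (ij w Ww)) => // e.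
- by case: (ij w^-1); rewrite ?groupV // -e permK.
- by move: e => /perm_inj ji; case: nij.
Qed.

End SmallPerm.

(** * Partial actions *)

Section PartialAction.
Variables (k : nat) (D : {set {group 'S_k}}).
Variable T : {W : {group 'S_k} | W \in D} -> finType.
Variable U : choiceType.
Notation A := (letter T).
Notation G := (completion T).

(** [P a u v]: the letter [a] is prescribed to map [u] to [v]. A word [W] is cut
    into steps: [W l = (w, a)] means [w] followed by the letter [a]. *)
Definition partial := A -> U -> U -> Prop.
Definition word := nat -> 'S_k * A.

Implicit Types (P : partial) (W : word) (a c : A) (u v : U) (w : 'S_k).

(** The normal form of Britton's lemma: a letter may be followed by its inverse only across a
    permutation outside the group of the letter. *)
Definition reduced W L := forall l, l.+1 < L ->
  (W l.+1).2 = linv (W l).2 -> (W l.+1).1 \in lgrp (W l).2 -> False.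

(** [x0] is an action of [S_k] with one natural orbit, the points [e i], and
    otherwise infinitely many regular orbits. *)
Record base (x0 : U -> 'S_k -> U) (e : 'I_k -> U) : Prop := Base {
  base1 : forall u, x0 u 1 = u;
  baseM : forall u (v w : 'S_k), x0 u (v * w) = x0 (x0 u v) w;
  base_inj : injective e;
  base_eq : forall w i, e (w i) = x0 (e i) w;
  base_reg : forall u w, (forall i, u <> e i) -> x0 u w = u -> w = 1;
  base_inf : forall F : seq U, exists u,
    (forall i, u <> e i) /\ forall w, x0 u w \notin F }.

Variables (x0 : U -> 'S_k -> U) (e : 'I_k -> U).

Definition nonfree a u := exists w, [/\ w \in lgrp a, w <> 1 & x0 u w = u].

(** A point fixed by a non-trivial element of [lgrp a] has to be fixed by [a] in
    every action in the space, whence [validN]. *)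
Record valid P : Prop := Valid {
  validV : forall a u v, P a u v -> P (linv a) v u;
  validF : forall a u v v', P a u v -> P a u v' -> v = v';
  validE : forall a u v w, w \in lgrp a -> P a u v -> P a (x0 u w) (x0 v w);
  validN : forall a u, nonfree a u -> P a u u;
  validS : exists F : seq U, forall a u v, P a u v -> u \in F }.

Definition reads P W L (p : nat -> U) :=
  forall l, l < L -> P (W l).2 (x0 (p l) (W l).1) (p l.+1).

Definition bounded P M := forall W L (p : 'I_k -> nat -> U),
  injective (fun i => p i 0) -> reduced W L ->
  (forall i, reads P W L (p i)) -> L <= M.

Definition good P := exists M, bounded P M.

Definition sub_partial P P' := forall a u v, P a u v -> P' a u v.

Definition add_edges P c (E : U -> U -> Prop) : partial := fun a u v =>
  P a u v \/ (a = c /\ E u v) \/ (a = linv c /\ E v u).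

Hypothesis hb : base x0 e.
Hypothesis hk : k = 2 \/ k = 3.

Lemma x0K u w : x0 (x0 u w) w^-1 = u.
Proof. by rewrite -(baseM hb) mulgV (base1 hb). Qed.

Lemma x0KV u w : x0 (x0 u w^-1) w = u.
Proof. by rewrite -(baseM hb) mulVg (base1 hb). Qed.

Lemma x0_inj w : injective (x0^~ w).
Proof. by move=> u v /(congr1 (x0^~ w^-1)); rewrite !x0K. Qed.

(** Regular orbits contain no fixed point of [w], and the natural orbit at most one. Whatever
    commutes with [w] must therefore preserve that point. *)
Lemma fix_unique u v w : w <> 1 -> x0 u w = u -> x0 v w = v -> u = v.
Proof.
move=> w1 uw vw.
have [[i ei]|nu] := pselect (exists i, u = e i); last first.
  by case: w1; apply: (base_reg hb _ uw) => i ui; apply: nu; exists i.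
have [[j ej]|nv] := pselect (exists i, v = e i); last first.
  by case: w1; apply: (base_reg hb _ vw) => j vj; apply: nv; exists j.
rewrite ei ej; congr e; apply: (perm_fix2 hk w1); apply: (base_inj hb).
  by rewrite (base_eq hb) -ei.
by rewrite (base_eq hb) -ej.
Qed.

Lemma reads_inj P W L (p : 'I_k -> nat -> U) l : valid P -> l <= L ->
  injective (fun i => p i 0) -> (forall i, reads P W L (p i)) ->
  injective (fun i => p i l).
Proof.
move=> vP lL pinj rp; elim: l lL => [_|l IH lL i j /= pij]; first exact: pinj.
apply: (IH (ltnW lL)); apply: (@x0_inj (W l).1).
have hi := validV vP (rp i l lL); have hj := validV vP (rp j l lL).
by rewrite pij in hi; exact: validF vP _ _ _ _ hi hj.
Qed.

Lemma valid_add P c (E : U -> U -> Prop) : valid P ->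
  (forall u v v', E u v -> E u v' -> v = v') ->
  (forall u u' v, E u v -> E u' v -> u = u') ->
  (forall u v w, w \in lgrp c -> E u v -> E (x0 u w) (x0 v w)) ->
  (exists F : seq U, forall u v, E u v -> u \in F /\ v \in F) ->
  (forall u v v', E u v -> ~ P c u v') ->
  (forall u v u', E u v -> ~ P (linv c) v u') ->
  valid (add_edges P c E).
Proof.
move=> vP Ef Ei Ee [F EF] Es Et; have cc := @linv_neq _ _ _ c; split.
- move=> a u v [/(validV vP)|[[-> uv]|[-> vu]]]; first by left.
    by right; right.
  by right; left; rewrite linvK.
- move=> a u v v' [uv|[[ac uv]|[ac uv]]] [uv'|[[ac' uv']|[ac' uv']]];
    try congruence.
  + exact: validF vP _ _ _ _ uv uv'.
  + by subst a; case: (Es _ _ _ uv' uv).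
  + by subst a; case: (Et _ _ _ uv' uv).
  + by subst a; case: (Es _ _ _ uv uv').
  + exact: Ef uv uv'.
  + by subst a; case: (Et _ _ _ uv uv').
  + exact: Ei uv uv'.
- move=> a u v w aw [uv|[[ac uv]|[ac uv]]].
  + by left; exact: (validE vP).
  + by right; left; subst a; split => //; exact: Ee.
  + by right; right; subst a; split => //; apply: Ee.
- by move=> a u nu; left; exact: (validN vP).
- have [F' PF'] := validS vP; exists (F ++ F') => a u v; rewrite mem_cat.
  by case=> [/PF' ->|[[_ /EF[-> _]]|[_ /EF[_ ->]]]]; rewrite ?orbT.
Qed.

Section Fresh.
Variables (P : partial) (c : A) (E : U -> U -> Prop).
Hypothesis vP : valid P.
Hypothesis Ef : forall u v v', E u v -> E u v' -> v = v'.
Hypothesis Ei : forall u u' v, E u v -> E u' v -> u = u'.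
Hypothesis Ee : forall u v w, w \in lgrp c -> E u v -> E (x0 u w) (x0 v w).
Hypothesis EF : exists F : seq U, forall u v, E u v -> u \in F /\ v \in F.
Hypothesis Es : forall u v v', E u v -> ~ P c u v'.
Hypothesis Et : forall u v w a v', E u v -> ~ P a (x0 v w) v'.
Hypothesis Est : forall u v u' v' w, E u v -> E u' v' -> u' <> x0 v w.
Hypothesis Ett : forall u v u' w, E u v -> E u' (x0 v w) -> w \in lgrp c.

Lemma valid_fresh : valid (add_edges P c E).
Proof.
apply: valid_add => //; move=> u v u' uv Pv.
by apply: (Et (w := 1) uv); rewrite (base1 hb); exact: Pv.
Qed.

(** [Et], [Est] and [Ett] make every new target a leaf: the only way out of its orbit is back along
    the new edges. *)
Lemma add_fresh_at u v w a v' : E u v -> add_edges P c E a (x0 v w) v' ->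
  a = linv c /\ w \in lgrp c.
Proof.
move=> uv [/(Et uv)//|[[_ vv']|[-> vv']]]; first by case: (Est (w := w) uv vv').
by split=> //; exact: Ett uv vv'.
Qed.

(* A reduced word enters the new vertices only with its last letter and
   leaves them only with its first one. *)
Lemma good_fresh : good P -> good (add_edges P c E).
Proof.
case=> M bM; exists M.+2 => W L p pinj rW rp.
have old i l : l.+2 < L -> P (W l.+1).2 (x0 (p i l.+1) (W l.+1).1) (p i l.+2).
  move=> lL; case: (rp i l.+1 (ltnW lL)) => [//|[[ac uv]|[ac uv]]].
  - have := rp i l.+2 lL; case/(add_fresh_at uv) => a2 w2.
    by case: (rW l.+1 lL); rewrite ?ac.
  - have := validV valid_fresh (rp i l (ltnW (ltnW lL))).
    set u := x0 (p i l.+1) _ in uv.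
    have -> : p i l.+1 = x0 u (W l.+1).1^-1 by rewrite x0K.
    case/(add_fresh_at uv) => a2 w2.
    have al : (W l).2 = c by apply: (can_inj (@linvK _ _ _)).
    by case: (rW l (ltnW lL)); rewrite al // -groupV.
case: L rW rp old => [//|[//|L]] rW rp old.
rewrite !ltnS.
apply: (bM (fun l => W l.+1) L (fun i l => p i l.+1)).
- by apply: (reads_inj (L := L.+2) valid_fresh) => //.
- by move=> l lL; apply: (rW l.+1); apply: (ltnW lL).
- by move=> i l lL; apply: old.
Qed.

End Fresh.

Lemma fresh_point (F : seq U) : exists v,
  (forall i, v <> e i) /\ forall w, x0 v w \notin F.
Proof. exact: (base_inf hb). Qed.

Definition orbit_edges c u v : U -> U -> Prop := fun u' v' =>
  exists2 w, w \in lgrp c & u' = x0 u w /\ v' = x0 v w.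

(** The target [v] lies in a regular orbit disjoint from everything in use, so the lemmas on fresh
    edges apply. [F] lists further points to avoid. *)
Lemma single_step P c u (F : seq U) : valid P -> good P ->
  (forall v, ~ P c u v) ->
  exists v, let P' := add_edges P c (orbit_edges c u v) in
  [/\ valid P', good P', P' c u v, forall w, x0 v w \notin F &
   (forall i, v <> e i) /\ (forall w a v', ~ P a (x0 v w) v') /\
   (forall w, x0 u w <> v) /\
   forall w a v', P' a (x0 v w) v' -> a = linv c /\ w \in lgrp c].
Proof.
move=> vP gP nPu; have [F' PF'] := validS vP.
have [v [ve vF]] := fresh_point (F ++ F' ++ [seq x0 u w | w <- enum 'S_k]).
have regv w w' : x0 v w = x0 v w' -> w = w'.
  move=> /(congr1 (x0^~ w'^-1)); rewrite x0K -(baseM hb) => /(base_reg hb ve)/eqP.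
  by rewrite divg_eq1 => /eqP.
(* By [validN] a point with a non-trivial stabiliser in [lgrp c] carries a loop [c]; since [c] is
   undefined at [u], this stabiliser is trivial. *)
have freeu w : w \in lgrp c -> x0 u w = u -> w = 1.
  move=> cw uw; apply: contrapT => w1; apply: (nPu u); apply: (validN vP).
  by exists w.
have vP' w a v' : ~ P a (x0 v w) v'.
  by move=> /PF'; move: (vF w); rewrite !mem_cat !negb_or => /and3P[_ /negbTE->].
have vu w w' : x0 u w <> x0 v w'.
  move=> uv; move: (vF 1); rewrite (base1 hb) !mem_cat !negb_or => /and3P[_ _ /negP]; apply.
  have -> : v = x0 u (w * w'^-1) by rewrite (baseM hb) uv x0K.
  by apply: map_f; rewrite mem_enum inE.
pose E := orbit_edges c u v.
have Ef u1 v1 v1' : E u1 v1 -> E u1 v1' -> v1 = v1'.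
  move=> [w cw [-> ->]] [w' cw' [ww' ->]]; congr (x0 v _).
  apply/eqP; rewrite -divg_eq1; apply/eqP; apply: freeu.
    by rewrite groupM ?groupV.
  by rewrite (baseM hb) ww' x0K.
have Ei u1 u1' v1 : E u1 v1 -> E u1' v1 -> u1 = u1'.
  by move=> [w cw [-> ->]] [w' cw' [-> /regv ->]].
have Ee u1 v1 w : w \in lgrp c -> E u1 v1 -> E (x0 u1 w) (x0 v1 w).
  move=> cw [w' cw' [-> ->]]; exists (w' * w); first exact: groupM.
  by rewrite !(baseM hb).
have EF : exists F : seq U, forall u v, E u v -> u \in F /\ v \in F.
  exists ([seq x0 u w | w <- enum 'S_k] ++ [seq x0 v w | w <- enum 'S_k]).
  move=> u1 v1 [w _ [-> ->]]; rewrite !mem_cat.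
  by rewrite !map_f ?mem_enum ?inE // orbT.
have Es u1 v1 v1' : E u1 v1 -> ~ P c u1 v1'.
  move=> [w cw [-> _]] /(validE vP (w := w^-1)); rewrite groupV x0K => /(_ cw).
  exact: nPu.
have Et u1 v1 w a v1' : E u1 v1 -> ~ P a (x0 v1 w) v1'.
  by move=> [w' _ [_ ->]]; rewrite -(baseM hb); exact: vP'.
have Est u1 v1 u2 v2 w : E u1 v1 -> E u2 v2 -> u2 <> x0 v1 w.
  by move=> [w1 _ [_ ->]] [w2 _ [-> _]]; rewrite -(baseM hb); exact: vu.
have Ett u1 v1 u2 w : E u1 v1 -> E u2 (x0 v1 w) -> w \in lgrp c.
  move=> [w1 c1 [_ ->]] [w2 c2 [_]]; rewrite -(baseM hb) => /regv w12.
  by rewrite -(groupMl _ c1) w12.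
have Euv : E u v by exists 1; rewrite ?group1 ?(base1 hb).
exists v; split.
- exact: valid_fresh.
- exact: good_fresh.
- by right; left.
- by move=> w; move: (vF w); rewrite mem_cat negb_or => /andP[].
- split=> //; split; first exact: vP'; split.
    by move=> w; rewrite -(base1 hb v); exact: vu.
  by move=> w a v'; exact: (add_fresh_at Et Est Ett Euv).
Qed.

End PartialAction.

(** * Permutations of an arbitrary set *)

(** The inverse is stored as data, so that inversion in the group swaps the two fields. This group
    is the target of [completion_lift] when an action is built from its letters. *)
Record sym_of (U : Type) := MkSym {
  sym_fun : U -> U; sym_inv : U -> U;
  sym_funK : cancel sym_fun sym_inv; sym_invK : cancel sym_inv sym_fun }.

Section SymGroup.
Variable U : Type.

HB.instance Definition _ := gen_eqMixin (sym_of U).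
HB.instance Definition _ := gen_choiceMixin (sym_of U).

Lemma sym_eq (f g : sym_of U) : sym_fun f =1 sym_fun g -> f = g.
Proof.
case: f g => [f f' fK f'K] [g g' gK g'K] /= /funext fg; subst g.
have fg' : f' = g' by apply/funext => u; rewrite -{1}(g'K u) fK.
by subst g'; congr MkSym; exact: Prop_irrelevance.
Qed.

Definition sym_one : sym_of U := @MkSym U id id (fun _ => erefl) (fun _ => erefl).
Definition sym_mul (f g : sym_of U) : sym_of U :=
  MkSym (can_comp (sym_funK g) (sym_funK f)) (can_comp (sym_invK f) (sym_invK g)).
Definition sym_opp (f : sym_of U) : sym_of U := MkSym (sym_invK f) (sym_funK f).

Lemma sym_mulA : associative sym_mul. Proof. by move=> f g h; exact: sym_eq. Qed.
Lemma sym_mul1 : left_id sym_one sym_mul. Proof. by move=> f; exact: sym_eq. Qed.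
Lemma sym_mulr1 : right_id sym_one sym_mul. Proof. by move=> f; exact: sym_eq. Qed.
Lemma sym_mulV : left_inverse sym_one sym_opp sym_mul.
Proof. by move=> f; apply: sym_eq => u /=; rewrite sym_invK. Qed.
Lemma sym_mulrV : right_inverse sym_one sym_opp sym_mul.
Proof. by move=> f; apply: sym_eq => u /=; rewrite sym_funK. Qed.

HB.instance Definition _ := isGroup.Build (sym_of U)
  sym_mulA sym_mul1 sym_mulr1 sym_mulV sym_mulrV.

Lemma sym_mulE (f g : sym_of U) u : sym_fun (f * g) u = sym_fun g (sym_fun f u).
Proof. by []. Qed.

End SymGroup.

Lemma exists_bound (I : finType) (R : I -> nat -> Prop) :
  (forall i m n, m <= n -> R i m -> R i n) -> (forall i, exists n, R i n) ->
  exists n, forall i, R i n.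
Proof.
move=> Rm /choice[f Rf]; exists (\max_i f i) => i.
by apply: Rm (Rf i); exact: leq_bigmax.
Qed.

Lemma ord_pair k : (k = 2 \/ k = 3) -> exists i j : 'I_k, i <> j.
Proof. by case=> ->; exists ord0, ord_max. Qed.

Section ActLemmas.
Variables (G : groupType) (U : Type) (s : U -> G -> U).
Hypothesis ra : right_action s.

Lemma ract1 u : s u 1 = u. Proof. by case: ra. Qed.
Lemma ractM u g h : s u (g * h) = s (s u g) h. Proof. by case: ra. Qed.
Lemma ractK u g : s (s u g) g^-1 = u. Proof. by rewrite -ractM mulgV ract1. Qed.
Lemma ractKV u g : s (s u g^-1) g = u. Proof. by rewrite -ractM mulVg ract1. Qed.
Lemma ract_inj g : injective (s^~ g).
Proof. by move=> u v /(congr1 (s^~ g^-1)); rewrite !ractK. Qed.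
Lemma ractJ u g h : s u g = u -> s (s u h) (g ^ h) = s u h.
Proof. by move=> ug; rewrite conjgE !ractM ractK ug. Qed.
End ActLemmas.

Section Words.
Variables (k : nat) (D : {set {group 'S_k}}).
Variable T : {W : {group 'S_k} | W \in D} -> finType.
Variable U : choiceType.
Notation A := (letter T).
Notation G := (completion T).
Notation word := (word T).
Notation partial := (partial T U).
Implicit Types (P Q : partial) (W : word) (a c : A) (u v : U) (w : 'S_k).

(** * Evaluation of words *)

Definition lval (x : 'S_k * A) : G := cperm T x.1 * clet x.2.

Fixpoint weval W L : G := if L is l.+1 then weval W l * lval (W l) else 1.

Definition shift n W : word := fun l => W (n + l).

Lemma cperm1 : cperm T 1 = 1. Proof. exact: morph_one (@cpermM _ _ T). Qed.
Lemma cpermV w : cperm T w^-1 = (cperm T w)^-1.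
Proof. exact: morph_inv (@cpermM _ _ T) w. Qed.

Lemma weval_add W m n : weval W (m + n) = weval W m * weval (shift m W) n.
Proof.
elim: n => [|n IH]; first by rewrite addn0 /= mulg1.
by rewrite addnS /= IH -mulgA.
Qed.

Lemma weval_ext W W' L : (forall l, l < L -> W l = W' l) -> weval W L = weval W' L.
Proof.
elim: L => [//|L IH] WW' /=; rewrite IH ?WW' // => l lL; apply: WW'.
exact: ltnW.
Qed.


Variable a0 : A.

(** A new letter either cancels against the last one, across a permutation commuting with it, or
    extends the word. The trailing [w] keeps the permutation that no letter follows. *)
Lemma reduced_form (g : G) : exists W L w, reduced W L /\ g = weval W L * cperm T w.
Proof.
elim/completion_ind: g => [|_ w' [W [L [w [rW ->]]]]|_ a [W [L [w [rW ->]]]]].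
- by exists (fun _ => (1, a0)), 0, 1; rewrite cperm1 mulg1.
- by exists W, L, (w * w'); rewrite -mulgA -cpermM.
have [[L' [eL aW wW]]|nred] := pselect (exists L',
    [/\ L = L'.+1, a = linv (W L').2 & w \in lgrp (W L').2]).
  subst L a; exists W, L', ((W L').1 * w); split; first by move=> l lL; apply: rW; lia.
  rewrite /= /lval cpermM -!mulgA; congr (_ * (_ * _)).
  by rewrite (clet_comm (a := linv _)) // clet_inv mulVKg.
pose W' l := if l < L then W l else (w, a).
have WW' l : l < L -> W l = W' l by rewrite /W' => ->.
exists W', L.+1, 1; split.
  move=> l; rewrite ltnS leq_eqVlt => /orP[/eqP lL|lL].
    rewrite /W' lL ltnn -lL ltnSn /= => al wl; apply: nred; exists l; split=> //.
  rewrite -!WW' //; last exact: ltnW.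
  exact: rW.
rewrite /= -(weval_ext WW') cperm1 mulg1 /W' ltnn /lval /=.
by rewrite mulgA.
Qed.

(** Words are infinite sequences; for a periodic one the condition also covers the seam between two
    periods. *)
Definition cyc_reduced W := forall l, (W l.+1).2 = linv (W l).2 ->
  (W l.+1).1 \in lgrp (W l).2 -> False.

Definition periodic W L := forall l, W (L + l) = W l.

Lemma periodic_weval W L n : periodic W L -> weval W (L * n) = weval W L ^+ n.
Proof.
move=> pW; elim: n => [|n IH]; first by rewrite muln0.
rewrite mulnS weval_add expgS; congr (_ * _); rewrite -IH; apply: weval_ext => l _.
exact: pW.
Qed.

Lemma periodic_shift W L n : periodic W L -> periodic (shift n W) L.
Proof. by move=> pW l; rewrite /shift addnCA pW. Qed.

Lemma weval_shift W L n : periodic W L -> weval (shift n W) L = weval W L ^ weval W n.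
Proof.
move=> pW; apply: (mulgI (weval W n)); rewrite -weval_add -conjgC addnC weval_add.
by congr (_ * _); apply: weval_ext => l _; exact: pW.
Qed.

Lemma lval_in (N : set G) W l : subgroup N -> (forall w, N (cperm T w)) ->
  (forall l, N (clet (W l).2)) -> N (lval (W l)).
Proof. by move=> [_ NM _] Nw NW; apply: NM. Qed.

Lemma weval_in (N : set G) W L : subgroup N -> (forall w, N (cperm T w)) ->
  (forall l, N (clet (W l).2)) -> N (weval W L).
Proof.
move=> sN Nw NW; elim: L => [|L IH]; first by case: sN.
by case: (sN) => _ NM _; apply: NM => //; exact: (@lval_in N W L).
Qed.

(** The final permutation is conjugated to the front. If the cyclic word so obtained has a
    cancellation, a rotation brings it to the seam, where two letters disappear. The conjugators are
    products of permutations and letters of [W], hence stay in [N]; this is used for the normaliser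
    of the alternating group. *)
Lemma cyclic_reduction (N : set G) W L w : subgroup N ->
  (forall w, N (cperm T w)) -> (forall l, N (clet (W l).2)) ->
  exists2 h, N h & (exists w', (weval W L * cperm T w) ^ h = cperm T w') \/
    exists W' L', [/\ 0 < L', periodic W' L', cyc_reduced W' &
                      (weval W L * cperm T w) ^ h = weval W' L'].
Proof.
move=> sN Nw; have [N1 NM NV] := sN.
elim/ltn_ind: L W w => L IH W w NW.
case: L IH => [|L] IH.
  by exists 1 => //; left; exists w; rewrite mul1g conjg1.
(* One period of [W1] is [W] with [w] absorbed into its first permutation. *)
pose W1 : word := fun l => let x := W (l %% L.+1) in
  if l %% L.+1 == 0 then (w * x.1, x.2) else x.
have W1p : periodic W1 L.+1 by move=> l; rewrite /W1 modnDl.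
have NW1 l : N (clet (W1 l).2) by rewrite /W1 /=; case: ifP => _ /=; exact: NW.
have E1 : (weval W L.+1 * cperm T w) ^ (cperm T w)^-1 = weval W1 L.+1.
  rewrite conjgE invgK mulgK.
  have E (V : word) : weval V L.+1 = lval (V 0) * weval (shift 1 V) L.
    by rewrite -(add1n L) weval_add /= mul1g.
  rewrite !E mulgA; congr (_ * _).
    by rewrite /W1 mod0n eqxx /lval /= cpermM mulgA.
  apply: weval_ext => l lL; rewrite /W1 /shift modn_small ?add1n //.
have [cW1|ncW1] := pselect (cyc_reduced W1).
  by exists (cperm T w)^-1; [exact: NV|right; exists W1, L.+1].
have [l [al wl]] : exists l, (W1 l.+1).2 = linv (W1 l).2 /\ (W1 l.+1).1 \in lgrp (W1 l).2.
  apply: contrapT => nl; apply: ncW1 => l al wl; apply: nl; exists l; split=> //.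
(* After this rotation the cancelling letters are the last and the first of the period. *)
pose W2 := shift l.+1 W1.
have W2p : periodic W2 L.+1 by exact: periodic_shift.
have E2 : weval W2 L.+1 = weval W1 L.+1 ^ weval W1 l.+1 by exact: weval_shift.
have W20 : W2 0 = W1 l.+1 by rewrite /W2 /shift addn0.
have W2L : W2 L = W1 l by rewrite /W2 /shift addSnnS addnC W1p.

(* A period with a single letter cannot cancel, because no letter is its own inverse. *)
have [L1 eL] : exists L1, L = L1.+1.
  exists L.-1; rewrite prednK // lt0n; apply/eqP => L0.
  have E : W2 L = W2 0 by congr W2.
  by move: al; rewrite -W20 -E W2L => /esym/linv_neq.
have E3 : weval W2 L.+1 ^ lval (W2 0) =
    weval (shift 1 W2) L1 * cperm T ((W1 l).1 * (W1 l.+1).1).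
  have -> : weval W2 L.+1 = lval (W2 0) * weval (shift 1 W2) L1 * lval (W2 L).
    by rewrite eL -[L1.+2]addn1 weval_add -(add1n L1) weval_add /= !mul1g /shift addn0.
  have -> (x y z : G) : (x * y * z) ^ x = y * (z * x) by rewrite conjgE -!mulgA mulKg.
  congr (_ * _).
  rewrite W2L W20 /lval cpermM -mulgA; congr (_ * _).
  rewrite al clet_inv mulgA -(clet_comm wl) -mulgA mulgV mulg1 //.
have NW2 l' : N (clet (shift 1 W2 l').2) by exact: NW1.
have [|h Nh hP] := IH L1 _ (shift 1 W2) ((W1 l).1 * (W1 l.+1).1) NW2.
  by rewrite eL; lia.
exists ((cperm T w)^-1 * weval W1 l.+1 * lval (W2 0) * h).
  apply: (NM) => //; apply: (NM); last first.
    by apply: (@lval_in N W2 0) => // l'; exact: NW1.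
  by apply: NM; [exact: NV|exact: weval_in].
have -> (x a b c d : G) : x ^ (a * b * c * d) = (((x ^ a) ^ b) ^ c) ^ d by rewrite !conjgM.
by rewrite E1 -E2 E3.
Qed.

End Words.

(** * From partial actions to actions *)

Section TotalAction.
Variables (k : nat) (D : {set {group 'S_k}}).
Variable T : {W : {group 'S_k} | W \in D} -> finType.
Variable U : choiceType.
Notation A := (letter T).
Notation G := (completion T).
Notation word := (word T).
Notation partial := (partial T U).
Implicit Types (P Q : partial) (W : word) (a c : A) (u v : U) (w : 'S_k).
Variable a0 : A.
Hypothesis hk : k = 2 \/ k = 3.
Variable en : nat -> U.
Hypothesis enP : forall u, exists n, en n = u.
Variables (x0 : U -> 'S_k -> U) (e : 'I_k -> U).
Hypothesis hb : base x0 e.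

Notation valid := (valid x0).
Notation good := (good x0).

Record total_action (s : U -> G -> U) : Prop := TotalAction {
  total_act : right_action s;
  total_perm : forall u w, s u (cperm T w) = x0 u w;
  total_sharp : sharp k s }.

Definition extends P (s : U -> G -> U) := forall a u v, P a u v -> s u (clet a) = v.

Lemma base_faithful w (x : 'I_k -> U) : injective x ->
  (forall i, x0 (x i) w = x i) -> w = 1.
Proof.
move=> xi xw; apply: contrapT => w1; have [i [j]] := ord_pair hk; apply.
by apply: xi; exact: (fix_unique hb hk w1).
Qed.

Lemma act_eval (s : U -> G -> U) W L (p : nat -> U) : right_action s ->
  (forall u w, s u (cperm T w) = x0 u w) ->
  (forall l, l < L -> s (x0 (p l) (W l).1) (clet (W l).2) = p l.+1) ->
  s (p 0) (weval W L) = p L.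
Proof.
move=> ra sw; elim: L => [|L IH] h /=; first by rewrite (ract1 ra).
rewrite (ractM ra) IH; last by move=> l lL; apply: h; exact: ltnW.
by rewrite /lval (ractM ra) sw h.
Qed.

Lemma act_eval_step (s : U -> G -> U) W l u : right_action s ->
  (forall u w, s u (cperm T w) = x0 u w) ->
  s (x0 (s u (weval W l)) (W l).1) (clet (W l).2) = s u (weval W l.+1).
Proof. by move=> ra sw; rewrite -sw -!(ractM ra). Qed.

Lemma action_of_letters (f : A -> U -> U) :
  (forall a u, f (linv a) (f a u) = u) ->
  (forall a u w, w \in lgrp a -> f a (x0 u w) = x0 (f a u) w) ->
  exists s : U -> G -> U, [/\ right_action s,
    (forall u w, s u (cperm T w) = x0 u w) & forall u a, s u (clet a) = f a u].
Proof.
move=> fK fx.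
have fKV a u : f a (f (linv a) u) = u by rewrite -{1}(linvK a) fK.
pose h (t : stable_letter T) := MkSym (fK (t, false)) (fKV (t, false)).
have xK w : cancel (x0^~ w) (x0^~ w^-1) by move=> u; rewrite (x0K hb).
have xKV w : cancel (x0^~ w^-1) (x0^~ w) by move=> u; rewrite (x0KV hb).
pose g w := MkSym (xK w) (xKV w).
have gM : {morph g : x y / x * y}.
  by move=> x y; apply: sym_eq => u /=; rewrite (baseM hb).
have gh t w : w \in lgrp (t, false) -> g w * h t = h t * g w.
  by move=> tw; apply: sym_eq => u; rewrite !sym_mulE /= fx.
have [F FM [Fg Fh]] := completion_lift gM gh.
exists (fun u x => sym_fun (F x) u); split.
- split=> [v|v x y]; last by rewrite FM.
  by rewrite (morph_one FM).
- by move=> u w; rewrite Fg.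
- move=> u [t []]; rewrite /clet /=; last by rewrite Fh.
  by rewrite (morph_inv FM) Fh.
Qed.

Section Chain.
Variable task : nat -> partial -> Prop.
Hypothesis task_step : forall n P, valid P -> good P ->
  exists Q, [/\ valid Q, good Q, sub_partial P Q & task n Q].

Lemma totalise P a u : valid P -> good P ->
  exists Q, [/\ valid Q, good Q, sub_partial P Q & exists v, Q a u v].
Proof.
move=> vP gP; have [[v uv]|nuv] := pselect (exists v, P a u v).
  by exists P; split=> //; exists v.
have nuv' v : ~ P a u v by move=> uv; apply: nuv; exists v.
have [v [vQ gQ uv _ _]] := single_step hb [::] vP gP nuv'.
exists (add_edges P a (orbit_edges x0 a u v)); split=> //; last by exists v.
by move=> b y z; left.
Qed.

(** Every pair of a letter and a point is decoded from some [n]; treating that pair at stage [n]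
    makes the union of the stages total. *)
Definition decode n : option (A * U) :=
  omap (fun x => (x.1, en x.2)) (unpickle n : option (A * nat)%type).

Lemma chain_seq P : valid P -> good P -> exists Q : nat -> partial,
  [/\ Q 0 = P, forall n, valid (Q n) /\ good (Q n),
      forall n, sub_partial (Q n) (Q n.+1) &
      forall n, task n (Q n.+1) /\
        forall a u, decode n = Some (a, u) -> exists v, Q n.+1 a u v].
Proof.
move=> vP gP.
pose S := {P : partial | valid P /\ good P}.
have step (nX : nat * S) : exists Y : S,
   [/\ sub_partial (sval nX.2) (sval Y) , task nX.1 (sval Y) &
    forall a u, decode nX.1 = Some (a, u) -> exists v, sval Y a u v].
  case: nX => n [X [vX gX]] /=.
  have [Y [vY gY XY]] : exists Y, [/\ valid Y, good Y, sub_partial X Y &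
    forall a u, decode n = Some (a, u) -> exists v, Y a u v].
    case: (decode n) => [[a u]|]; last by exists X; split.
    have [Y [vY gY XY uv]] := totalise a u vX gX.
    by exists Y; split=> // _ _ [<- <-].
  move=> Yn; have [Z [vZ gZ YZ Zn]] := task_step n vY gY.
  exists (exist _ Z (conj vZ gZ)); split=> //=.
    by move=> a u v /XY/YZ.
  by move=> a u /Yn[v /YZ uv]; exists v.
have [f fP] := choice step.
pose R := fix R n : S := if n is m.+1 then f (m, R m) else exist _ P (conj vP gP).
exists (fun n => sval (R n)); split=> //.
- by move=> n; exact: (svalP (R n)).
- by move=> n; have [] := fP (n, R n).
- by move=> n; have [] := fP (n, R n).
Qed.

Lemma chain P : valid P -> good P -> exists s, [/\ total_action s, extends P s &
  forall n, exists Q, [/\ valid Q, good Q, extends Q s & task n Q]].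
Proof.
move=> vP gP; have [Q [Q0 Qv Qs Qt]] := chain_seq vP gP.
have Qmono m n : m <= n -> sub_partial (Q m) (Q n).
  elim: n => [|n IH]; first by rewrite leqn0 => /eqP->.
  rewrite leq_eqVlt => /orP[/eqP->//|mn] a u v uv; apply: Qs.
  by apply: IH uv.
pose S a u v := exists n, Q n a u v.
have Sfun a u v v' : S a u v -> S a u v' -> v = v'.
  move=> [n uv] [m uv']; have [vQ _] := Qv (maxn n m).
  apply: (validF vQ (a := a) (u := u)).
    exact: Qmono (leq_maxl n m) _ _ _ uv.
  exact: Qmono (leq_maxr n m) _ _ _ uv'.
have Stot (x : A * U) : exists v, S x.1 x.2 v.
  case: x => a u; have [m um] := enP u.
  have [_ /(_ a u)] := Qt (pickle (a, m)).
  by rewrite /decode pickleK /= um => /(_ erefl)[v uv]; exists v, (pickle (a, m)).+1.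
have [f fS] := choice Stot.
pose F a u := f (a, u).
have FS a u : S a u (F a u) by exact: (fS (a, u)).
have FK a u : F (linv a) (F a u) = u.
  apply: Sfun (FS _ _) _; have [n h] := FS a u.
  by exists n; exact: (validV (Qv n).1 h).
have Fx a u w : w \in lgrp a -> F a (x0 u w) = x0 (F a u) w.
  move=> aw; apply: Sfun (FS _ _) _; have [n h] := FS a u.
  by exists n; exact: (validE (Qv n).1 aw h).
have [s [ra sw sa]] := action_of_letters FK Fx.
have Qext n : extends (Q n) s.
  by move=> a u v uv; rewrite sa; apply: Sfun (FS a u) _; exists n.
exists s; split; first split=> //; last 2 first.
- by rewrite -Q0.
- by move=> n; exists (Q n.+1); have [] := Qv n.+1; have [] := Qt n.
move=> g x xi xg.
have [W [L [w [_ eg]]]] := reduced_form a0 g.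
have [h _] : exists2 h, setT h & (exists w', g ^ h = cperm T w') \/
    exists V M, [/\ 0 < M, periodic V M, cyc_reduced V & g ^ h = weval V M].
  by rewrite eg; exact: cyclic_reduction.
case=> [[w' hw]|].
- have w1 : w' = 1.
    apply: (@base_faithful w' (fun i => s (x i) h)).
      by move=> i j /(ract_inj ra)/xi.
    by move=> i; rewrite -sw -hw (ractJ ra).
  by apply/eqP; rewrite -(conjg_eq1 _ h) hw w1 cperm1.
- move=> [V [M [M0 pV cV gV]]]; exfalso.
  pose p i l := s (s (x i) h) (weval V l).
  have pM i : p i M = p i 0 by rewrite /p -gV (ractJ ra) ?(ract1 ra).
  have ps i l : s (x0 (p i l) (V l).1) (clet (V l).2) = p i l.+1 by exact: act_eval_step.
  have pper i l : p i (M + l) = p i l.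
    rewrite /p weval_add (ractM ra) -/(p i M) pM /p /= (ract1 ra).
    by congr (s _ _); apply: weval_ext => r _; exact: pV.
  (* One period read from [k] points uses finitely many edges, so a single stage contains them all,
     and that stage is good. *)
  have [N QN] : exists N, forall x : 'I_k * 'I_M, Q N (V x.2).2
      (x0 (p x.1 x.2) (V x.2).1) (p x.1 x.2.+1).
    apply: exists_bound => [y m n mn|[i l] /=]; first exact: Qmono.
    have [n hn] := FS (V l).2 (x0 (p i l) (V l).1).
    by exists n; rewrite -ps sa.
  have [_ [B bB]] := Qv N.
  (* The paths close up after one period, so [B.+1] periods can be read; this exceeds the bound
     [B]. *)
  suff : M * B.+1 <= B by rewrite leqNgt => /negP; apply; rewrite leq_pmull.
  apply: (bB V _ p) => [i j /=|l _|i l _].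
  - by rewrite /p /= !(ract1 ra) => /(ract_inj ra)/xi.
  - exact: cV.
  - have perq q r : V (M * q + r) = V r /\ p i (M * q + r) = p i r.
      elim: q => [|q [IH1 IH2]]; first by rewrite muln0.
      by rewrite mulnS -addnA pV pper.
    rewrite (divn_eq l M) mulnC -addnS.
    have [-> ->] := perq (l %/ M) (l %% M); have [_ ->] := perq (l %/ M) (l %% M).+1.
    exact: (QN (i, Ordinal (ltn_pmod l M0))).
Qed.

End Chain.

Lemma extend_total P : valid P -> good P ->
  exists s, total_action s /\ extends P s.
Proof.
move=> vP gP; have [|s [ts es _]] := chain (task := fun _ _ => True) _ vP gP.
  by move=> n Q vQ gQ; exists Q; split.
by exists s.
Qed.

Hypothesis hD : forall W : {group 'S_k}, W \in D -> docile W.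

Lemma lgrp_docile a : exists i, free_index (lgrp a) i.
Proof. by apply/docileP; apply: hD; exact: valP (tag a.1). Qed.

Lemma nonfreeP a u : nonfree x0 a u ->
  exists i, u = e i /\ exists w, [/\ w \in lgrp a, w <> 1 & w i = i].
Proof.
move=> [w [aw w1 uw]].
have [[i ui]|nu] := pselect (exists i, u = e i); last first.
  by case: w1; apply: (base_reg hb _ uw) => i ui; apply: nu; exists i.
exists i; split=> //; exists w; split=> //; apply: (base_inj hb).
by rewrite (base_eq hb) -ui.
Qed.

(** Otherwise the [x i] would be [k] distinct natural points, hence all of them, and every index
    would have a non-trivial stabiliser in [lgrp a], against docility. *)
Lemma some_free a (x : 'I_k -> U) : injective x -> exists i, ~ nonfree x0 a (x i).
Proof.
move=> xi; apply: contrapT => nx.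
have /choice[f fP] i : exists j, x i = e j /\
    exists w, [/\ w \in lgrp a, w <> 1 & w j = j].
  by apply: nonfreeP; apply: contrapT => ni; apply: nx; exists i.
have fi : injective f.
  by move=> i j fij; apply: xi; rewrite (fP i).1 (fP j).1 fij.
have [i0 i0f] := lgrp_docile a.
have /codomP[j i0j] : i0 \in codom f by exact: (injF_onto fi).
have [_ [w [aw w1 wj]]] := fP j.
by apply/w1/i0f; rewrite // i0j.
Qed.

(** The least partial action that [validN] permits. *)
Definition trivial_partial : partial := fun a u v => u = v /\ nonfree x0 a u.

Lemma nonfreeE a u w : w \in lgrp a -> nonfree x0 a u -> nonfree x0 a (x0 u w).
Proof.
move=> aw [v [av v1 uv]]; exists (v ^ w); split.
- by rewrite groupJ.
- by move=> /eqP; rewrite conjg_eq1 => /eqP.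
- by rewrite conjgE !(baseM hb) (x0K hb) uv.
Qed.

Lemma valid_trivial : valid trivial_partial.
Proof.
split.
- by move=> a u v [<-].
- by move=> a u v v' [<- _] [<- _].
- by move=> a u v w aw [<- nu]; split=> //; exact: nonfreeE.
- by [].
- exists [seq e i | i <- enum 'I_k] => a u v [_ /nonfreeP[i [-> _]]].
  by apply: map_f; rewrite mem_enum.
Qed.

(** Not even one letter can be read from [k] distinct points, since one of them is free for it. *)
Lemma good_trivial : good trivial_partial.
Proof.
exists 0 => W [//|L] p pi _ rp; exfalso.
have [|i] := @some_free (W 0).2 (fun i => x0 (p i 0) (W 0).1).
  by move=> i j /(x0_inj hb)/pi.
by apply; have [] := rp i 0 isT.
Qed.

Lemma reduced_path W L : reduced W L -> exists P p,
  [/\ valid P, good P, reads x0 P W L p &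
   (0 < L -> (forall w, p L <> x0 (p 0) w)) /\
   forall w a v, P a (x0 (p L) w) v ->
     [/\ 0 < L, a = linv (W L.-1).2 & w \in lgrp (W L.-1).2]].
Proof.
elim: L => [_|L IH rW].
  have [u [ue _]] := fresh_point hb [::].
  exists trivial_partial, (fun _ => u); split=> //.
  - exact: valid_trivial.
  - exact: good_trivial.
  - split=> // w a v [_ [w' [_ w1 uw]]]; exfalso; apply: w1.
    apply: (base_reg hb _ uw) => i /(congr1 (x0^~ w^-1)).
    by rewrite (x0K hb) -(base_eq hb); exact: ue.
have [|P [p [vP gP rp [p0 pL]]]] := IH; first by move=> l lL; apply: rW; exact: ltnW.
have nP v : ~ P (W L).2 (x0 (p L) (W L).1) v.
  by move=> /pL[]; case: L rW {IH rp p0 pL} => // L rW _; exact: rW.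
have [v [vQ gQ uv vF [_ [_ [_ leaf]]]]] :=
  single_step hb [seq x0 (p 0) w | w <- enum 'S_k] vP gP nP.
set Q := add_edges _ _ _ in vQ gQ uv leaf.
exists Q, (fun l => if l <= L then p l else v); split=> //.
- move=> l lL1; have [->|lL] : l = L \/ l < L by lia.
    by rewrite leqnn ltnn.
  by rewrite lL (ltnW lL); left; exact: rp.
- rewrite ltnn /=; split=> [_ w vw|w a v' /leaf[]//].
  by move: (vF 1); rewrite (base1 hb) vw map_f // mem_enum.
Qed.

Lemma britton W L w : reduced W L -> 0 < L -> weval W L <> cperm T w.
Proof.
move=> rW L0 E; have [P [p [vP gP rp [/(_ L0) pL _]]]] := reduced_path rW.
have [s [[ra sw _] es]] := extend_total vP gP.
apply: (pL w); rewrite -sw -E (act_eval ra sw) // => l lL.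
by apply: es; exact: rp.
Qed.

End TotalAction.

(** * Finite subgroups of the completion *)

Section Parity.
Variables (k : nat) (hk : k = 2 \/ k = 3).

(** On at most three points the odd permutations are the transpositions: an orbit of length 3 would
    make [w] a product of two of them. *)
Lemma odd_perm_small (w : 'S_k) : odd_perm w -> w * w = 1 /\
  forall i0, w i0 <> i0 -> forall i, i <> i0 -> i <> w i0 -> w i = i.
Proof.
move=> ow; have w1 : w <> 1 by move=> w1; rewrite w1 odd_perm1 in ow.
have key i0 : w i0 <> i0 -> w (w i0) = i0.
  move=> wi0; apply: contrapT => wwi0.
  have wwi0' : w (w i0) <> w i0 by move=> /perm_inj.
  have w3 : w (w (w i0)) = i0.
    case: (ord3_cases hk (w (w (w i0))) (nesym wi0) (nesym wwi0) (nesym wwi0')) => //.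
      by move=> /perm_inj.
    by move=> /perm_inj/perm_inj.
  suff we : w = tperm (w i0) (w (w i0)) * tperm i0 (w i0).
    move: ow; rewrite we odd_permM !odd_tperm.
    have -> : (w i0 != w (w i0)) by apply/eqP; exact: nesym.
    have -> // : (i0 != w i0) by apply/eqP; exact: nesym.
  apply/permP => i; rewrite permM.
  case: (ord3_cases hk i (nesym wi0) (nesym wwi0) (nesym wwi0')) => ->.
  - by rewrite (tpermD (z := i0)) ?tpermL //; apply/eqP.
  - by rewrite tpermL tpermD //; apply/eqP; exact: nesym.
  - by rewrite tpermR tpermR.
split=> [|i0 wi0 i ii0 iwi0].
  apply/permP => i; rewrite permM perm1.
  by have [wi|/key//] := pselect (w i = i); rewrite !wi.
case: (ord3_cases hk (w i) (nesym wi0) (nesym ii0) (nesym iwi0)) => //.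
  by move=> e; case: iwi0; rewrite -e key // e; exact: nesym.
by move=> /perm_inj.
Qed.

Lemma odd_perm_fix (w : 'S_k) : k = 3 -> odd_perm w -> exists i, w i = i.
Proof.
move=> k3 ow; apply: contrapT => nf.
have nf' i : w i <> i by move=> wi; apply: nf; exists i.
have z : 'I_k by rewrite k3; exact: ord0.
have [_ h] := odd_perm_small ow.
have [i iz iw] : exists2 i, i <> z & i <> w z.
  apply: contrapT => ni.
  have : #|'I_k| <= #|[set z; w z]%SET|.
    rewrite -cardsT; apply: subset_leq_card; apply/fintype.subsetP => i _; rewrite !inE.
    by apply/negPn/negP; rewrite negb_or => /andP[/eqP ? /eqP ?]; apply: ni; exists i.
by rewrite card_ord cards2; case: (_ != _) => /=; lia.
by apply: (nf' i); apply: h iz iw.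
Qed.

(** The alternating group is trivial for [k = 2] and of prime order 3 for [k = 3]. *)
Lemma alt_gen (w : 'S_k) : w <> 1 -> ~~ odd_perm w ->
  [/\ <[w]> = 'Alt_('I_k), #[w] = 3 & k = 3].
Proof.
move=> w1 ew.
have wA : w \in 'Alt_('I_k) by rewrite Alt_even.
have cA : (2 * #|'Alt_('I_k)| = k`!)%N.
  by rewrite card_Alt ?card_ord //; case: hk => ->.
have k3 : k = 3.
  case: hk => // k2; case: w1; move: cA; rewrite [in k`!]k2 (_ : 2`! = 2) // => cA.
  have /card_le1_trivg A1 : #|'Alt_('I_k)| <= 1 by lia.
  by move: wA; rewrite A1 => /set1gP.
have cA3 : #|'Alt_('I_k)| = 3 by move: cA; rewrite [in k`!]k3 (_ : 3`! = 6) //; lia.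
have dv : #[w] %| 3 by rewrite -cA3; apply: order_dvdG.
have w3 : #[w] = 3.
  have /primeP[_ /(_ _ dv)/orP[/eqP o1|/eqP -> //]] : prime 3 by [].
  by case: w1; apply/eqP; rewrite -order_eq1 o1.
split=> //; apply/eqP; rewrite eqEcard cycle_subG wA /=.
by rewrite cA3 -/(order w) w3.
Qed.

End Parity.

Section Group.
Variables (k : nat) (D : {set {group 'S_k}}).
Variable T : {W : {group 'S_k} | W \in D} -> finType.
Notation A := (letter T).
Notation G := (completion T).
Notation word := (word T).
Implicit Types (W : word) (a c : A) (w : 'S_k) (g h : G).
Variable a0 : A.
Hypothesis hk : k = 2 \/ k = 3.
Hypothesis brit : forall W L w, reduced W L -> 0 < L -> weval W L <> cperm T w.

(** Sending all stable letters to 1 defines a retraction of the completion onto S_k. *)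
Lemma cperm_inj : injective (cperm T).
Proof.
have idM : {morph (id : 'S_k -> 'S_k) : x y / x * y} by [].
have c (t : stable_letter T) w : w \in lgrp (t, false) -> id w * 1 = 1 * id w.
  by rewrite mulg1 mul1g.
have [F _ [Fw _]] := completion_lift idM c.
by move=> v w /(congr1 F); rewrite !Fw.
Qed.

(** Powers of a cyclically reduced word are reduced, hence non-trivial by Britton's lemma; only the
    other outcome of [cyclic_reduction] is left. *)
Lemma torsion_in (N : set G) W L w n : subgroup N ->
  (forall w, N (cperm T w)) -> (forall l, N (clet (W l).2)) ->
  0 < n -> (weval W L * cperm T w) ^+ n = 1 ->
  exists2 h, N h & exists w', (weval W L * cperm T w) ^ h = cperm T w'.
Proof.
move=> sN Nw NW n0 gn.
have [h Nh [hw|[V [M [M0 pV cV hV]]]]] := cyclic_reduction L w sN Nw NW.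
  by exists h.
exfalso; apply: (@brit V (M * n) 1); last 2 first.
- by rewrite muln_gt0 M0.
- by rewrite (periodic_weval _ pV) -hV -conjXg gn conj1g cperm1.
- by move=> l _; exact: cV.
Qed.

Lemma torsion g n : 0 < n -> g ^+ n = 1 -> exists h w, g ^ h = cperm T w.
Proof.
move=> n0; have [W [L [w [_ ->]]]] := reduced_form a0 g => gn.
by have [|||h _ [w' hw]] := @torsion_in setT W L w n _ _ _ n0 gn => //; exists h, w'.
Qed.

(** A syllable is a permutation followed by a letter, so inversion shifts the permutations by one
    place: the free slot at the front is filled by [w], and the first permutation of [W] is left
    over at the end, as [rev_word_eval] shows. *)
Definition rev_word W L w : word := fun i =>
  ((if i == 0 then w else (W (L - i)).1^-1), linv (W (L - i.+1)).2).

Lemma rev_word_eval W L w n : 0 < n <= L -> weval (rev_word W L w) n =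
  cperm T w * (weval (shift (L - n) W) n)^-1 * cperm T (W (L - n)).1.
Proof.
elim: n => [//|n IH] /andP[_ nL].
have E : weval (shift (L - n.+1) W) n.+1 =
    cperm T (W (L - n.+1)).1 * clet (W (L - n.+1)).2 * weval (shift (L - n) W) n.
  rewrite -(add1n n) weval_add /= mul1g add1n /lval /shift addn0; congr (_ * _).
  by apply: weval_ext => l _; congr W; lia.
rewrite E [LHS]/= /lval /rev_word /=; case: n IH nL E => [|n] IH nL E.
  by rewrite /= mul1g mulg1 invgM clet_inv -!mulgA mulVg mulg1.
rewrite IH ?(ltnW nL) //= cpermV clet_inv !invgM !mulgA.
by rewrite mulgVK mulgK.
Qed.

Notation C3 := 'Alt_('I_k).

(** If [w] is outside the group of the last letter, then [W], [w] and [W] reversed form a reduced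
    word of twice the length that equals a permutation, against Britton's lemma. Otherwise [w],
    which generates [C3], is pulled through that letter, and induction applies to a conjugate of
    [w]. *)
Lemma alt_conj_letters W L w v : reduced W L -> w \in C3 -> w <> 1 ->
  weval W L * cperm T w * (weval W L)^-1 = cperm T v ->
  forall l, l < L -> C3 \subset lgrp (W l).2.
Proof.
elim: L w v => [//|L IH] w v rW wA w1 E l; rewrite ltnS leq_eqVlt.
have ew : ~~ odd_perm w by rewrite -Alt_even.
have [gw _ _] := alt_gen hk w1 ew.
have aw : w \in lgrp (W L).2.
  apply/negPn/negP => naw.
  pose R := rev_word W L.+1 w.
  pose V : word := fun l => if l <= L then W l else R (l - L.+1).
  apply: (@brit V (L.+1 + L.+1) (v * (W 0).1)) => //; last first.
    rewrite weval_add (@weval_ext _ _ _ V W); last first.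
      by move=> i; rewrite ltnS /V => ->.
    rewrite (@weval_ext _ _ _ (shift L.+1 V) R); last first.
      by move=> i _; rewrite /V /shift leqNgt leq_addr /= addKn.
    rewrite /R rev_word_eval ?leqnn // subnn cpermM -E.
    have -> (x y z t : G) : x * (y * z * t) = x * y * z * t by rewrite !mulgA.
    by rewrite (@weval_ext _ _ _ (shift 0 W) W).
  have VR i : V (L.+1 + i) = R i by rewrite /V leqNgt leq_addr /= addKn.
  move=> i iL; have [lt_iL|ge_iL] := ltnP i L.
    rewrite /V lt_iL (ltnW lt_iL); exact: rW.
  have [->|gt_iL] : i = L \/ L < i by lia.
    rewrite -[L.+1]addn0 VR /V leqnn /R /rev_word /= => _ wa; exact: negP naw wa.
  have [j ji] : exists j, i = L.+1 + j by exists (i - L.+1); lia.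
  have ji' : i.+1 = L.+1 + j.+1 by rewrite ji addnS.
  rewrite ji' ji !VR /R /rev_word /= !linvK => al.
  rewrite groupV => wl.
  have jL : j < L by lia.
  have e1 : L.+1 - j.+1 = (L - j.+1).+1 by lia.
  apply: (rW (L - j.+1)); first by lia.
    by rewrite -e1 -al.
  by rewrite -e1; move: wl; rewrite /lgrp /= -al.
case/orP=> [/eqP->|lL]; first by rewrite -gw cycle_subG.
set d := (W L).2 in aw; set t := (W L).1.
apply: (IH (t * w * t^-1) v) => //.
- by move=> i iL; apply: rW; exact: ltnW.
- by rewrite Alt_even !odd_permM odd_permV; case: (odd_perm t); case: (odd_perm w) ew.
- move=> tw; apply: w1; apply: (mulgI t); apply: (mulIg t^-1); rewrite tw.
  by rewrite mulg1 mulgV.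
rewrite -E /= /lval -/d -/t !cpermM cpermV !invgM -!mulgA; congr (_ * (_ * _)).
by rewrite !mulgA -(clet_comm aw) mulgK.
Qed.

Definition alt_norm h := forall w, w \in C3 ->
  exists2 w', w' \in C3 & cperm T w ^ h = cperm T w'.

Definition alt_normaliser : set G := [set h | alt_norm h /\ alt_norm h^-1].

Lemma alt_normaliser_subgroup : subgroup alt_normaliser.
Proof.
have nM g h : alt_norm g -> alt_norm h -> alt_norm (g * h).
  move=> ng nh w /ng[w' w'A e]; have [w'' w''A e'] := nh w' w'A.
  by exists w'' => //; rewrite conjgM e e'.
split.
- by rewrite /alt_normaliser /= invg1; split=> w wA; exists w; rewrite ?conjg1.
- by move=> g h [g1 g2] [h1 h2]; split; [exact: nM|rewrite invgM; exact: nM].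
- by move=> g [g1 g2]; split=> //; rewrite invgK.
Qed.

Lemma alt_normaliser_perm w : alt_normaliser (cperm T w).
Proof.
suff nw v : alt_norm (cperm T v) by split; rewrite -?cpermV; exact: nw.
move=> x xA; exists (x ^ v); last by rewrite /conjg !cpermM cpermV.
by rewrite memJ_norm // (fintype.subsetP (normal_norm (Alt_normal _))) // inE.
Qed.

Lemma alt_normaliser_let a : C3 \subset lgrp a -> alt_normaliser (clet a).
Proof.
move=> aC; suff na b : C3 \subset lgrp b -> alt_norm (clet b).
  by split; rewrite -?clet_inv; exact: na.
move=> bC w wA; exists w => //.
by rewrite conjgE clet_comm ?mulKg // (fintype.subsetP bC).
Qed.

(** By [alt_conj_letters] all letters in a reduced form of [j] commute with [C3]. The cyclic
    reduction can thus be carried out inside the normaliser, so the conjugator [h] does not spoil an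
    earlier conjugation into [C3]. *)
Lemma alt_normaliser_torsion w j n : w \in C3 -> w <> 1 -> alt_normaliser j ->
  0 < n -> j ^+ n = 1 ->
  exists2 h, alt_normaliser h & exists w', j ^ h = cperm T w'.
Proof.
move=> wA w1 [_ nj] n0 jn; have [W [L [v [rW ej]]]] := reduced_form a0 j.
have [v' v'A e] := nj w wA.
have letW : forall l, l < L -> C3 \subset lgrp (W l).2.
  apply: (@alt_conj_letters W L (v * w * v^-1) v') => //.
  - have ew : ~~ odd_perm w by rewrite -Alt_even.
    by rewrite Alt_even !odd_permM odd_permV; case: (odd_perm v); case: (odd_perm w) ew.
  - move=> tw; apply: w1; apply: (mulgI v); apply: (mulIg v^-1); rewrite tw.
    by rewrite mulg1 mulgV.
  - by rewrite -e ej conjgE invgK invgM !cpermM cpermV !mulgA.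
case: (posnP L) => [L0|L0].
  exists 1; first by case: alt_normaliser_subgroup.
  by exists v; rewrite conjg1 ej L0 /= mul1g.
(* The entries beyond [L] are replaced by the first one, so that every letter of the infinite word
   lies in the normaliser. *)
pose W' : word := fun l => W (if l < L then l else 0).
have eW : weval W L = weval W' L by apply: weval_ext => l lL; rewrite /W' lL.
rewrite ej eW in jn *.
apply: (torsion_in alt_normaliser_subgroup alt_normaliser_perm _ n0 jn).
by move=> l; apply: alt_normaliser_let; rewrite /W'; case: ifP => lL; exact: letW.
Qed.

Section Stabiliser.
Variables (U : Type) (s : U -> G -> U).
Hypothesis ra : right_action s.
Hypothesis ss : sharp k s.

Definition set_stab (x : 'I_k -> U) : set G :=
  [set g | forall i, exists j, s (x i) g = x j].

Definition induces (x : 'I_k -> U) g (p : 'S_k) := forall i, s (x i) g = x (p i).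

Lemma set_stabP x g : injective x -> set_stab x g -> exists p, induces x g p.
Proof.
move=> xi /choice[f fP].
have fi : injective f.
  by move=> i j fij; apply/xi/(ract_inj ra (g := g)); rewrite /= !fP fij.
by exists (perm fi) => i; rewrite permE.
Qed.

Lemma inducesM x g h p q : induces x g p -> induces x h q -> induces x (g * h) (p * q).
Proof. by move=> gp hq i; rewrite (ractM ra) gp hq permM. Qed.

Lemma induces1 x g : injective x -> induces x g 1 -> g = 1.
Proof. by move=> xi g1; apply: ss xi _ => i; rewrite g1 perm1. Qed.

Lemma inducesV x g p : induces x g p -> induces x g^-1 p^-1.
Proof.
by move=> gp i; apply: (ract_inj ra (g := g)); rewrite /= (ractKV ra) gp permKV.
Qed.

Lemma inducesX x g p n : induces x g p -> induces x (g ^+ n) (p ^+ n).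
Proof.
move=> gp; elim: n => [|n IH]; last by rewrite !expgS; exact: inducesM.
by move=> i; rewrite (ract1 ra) perm1.
Qed.

Lemma induces_eq x g h p : injective x -> induces x g p -> induces x h p -> g = h.
Proof.
move=> xi gp hp; apply/eqP; rewrite -divg_eq1; apply/eqP; apply: (induces1 xi).
by rewrite -(mulgV p); apply: inducesM => //; exact: inducesV.
Qed.

Lemma induces_stab x g p : induces x g p -> set_stab x g.
Proof. by move=> gp i; exists (p i). Qed.

Lemma set_stabJ x h g : set_stab (fun i => s (x i) h) g <-> set_stab x (g ^ h^-1).
Proof.
rewrite conjgE invgK; split=> gx i; have [j e] := gx i; exists j.
  by rewrite !(ractM ra) e (ractK ra).
by move: e; rewrite !(ractM ra) => <-; rewrite (ractKV ra).
Qed.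

(** By sharpness the stabiliser embeds into S_k. If it contains no element of order 3, it is
    generated by at most one involution and [torsion] suffices. Otherwise an element [g] of order 3
    is conjugated into S_k first; an odd [j] inverts [g], so its conjugate normalises [C3] and is
    moved into S_k by a second conjugation that respects [C3]. *)
Lemma finite_conj (x : 'I_k -> U) : injective x ->
  exists h, forall g, set_stab (fun i => s (x i) h) g -> exists w, g = cperm T w.
Proof.
move=> xi.
suff [h hP] : exists h, forall g, set_stab x g -> exists w, g ^ h = cperm T w.
  exists h => g /set_stabJ/hP[w]; rewrite -conjgM mulVg conjg1 => ->; by exists w.
have tors g p : induces x g p -> exists2 n, 0 < n & g ^+ n = 1.
  move=> gp; exists #[p]; first exact: order_gt0.
  by apply: (induces1 xi); rewrite -(expg_order p); exact: inducesX.
have [[g [p [gp p1 ep]]]|noeven] := pselect (exists g p,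
    [/\ induces x g p, p <> 1 & ~~ odd_perm p]); last first.
  have even1 g p : induces x g p -> ~~ odd_perm p -> g = 1.
    move=> gp ep; apply: (induces1 xi).
    by have [<-//|p1] := pselect (p = 1); case: noeven; exists g, p.
  have [[g [p [gp op]]]|noodd] := pselect (exists g p, induces x g p /\ odd_perm p);
    last first.
    exists 1 => g /(set_stabP xi)[p gp]; exists 1; rewrite cperm1 conjg1.
    by apply: (even1 _ _ gp); apply/negP => op; apply: noodd; exists g, p.
  have [n n0 gn] := tors _ _ gp; have [h [w hw]] := torsion n0 gn.
  exists h => g' /(set_stabP xi)[p' gp'].
  have [op'|ep'] := boolP (odd_perm p'); last first.
    by exists 1; rewrite (even1 _ _ gp' ep') conj1g cperm1.
  exists w; rewrite -hw; congr (_ ^ _); apply/eqP; rewrite -divg_eq1; apply/eqP.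
  apply: (even1 _ (p' * p^-1)); first by apply: inducesM => //; exact: inducesV.
  by rewrite odd_permM odd_permV op op'.
have [Ap p3 _] := alt_gen hk p1 ep.
have even g' p' : induces x g' p' -> ~~ odd_perm p' -> exists n, g' = g ^+ n.
  move=> gp' ep'; have : p' \in <[p]> by rewrite Ap Alt_even.
  case/cycleP=> n e; exists n; apply: (induces_eq xi gp'); rewrite e.
  exact: inducesX.
have [n n0 gn] := tors _ _ gp; have [h [w hw]] := torsion n0 gn.
have w1 : w <> 1.
  move=> w1; case: p1; apply/permP => i; rewrite perm1; apply: xi; rewrite -gp.
  have -> : g = 1 by apply/eqP; rewrite -(conjg_eq1 _ h) hw w1 cperm1.
  by rewrite (ract1 ra).
have cX v m : cperm T (v ^+ m) = cperm T v ^+ m.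
  by elim: m => [|m IH]; rewrite ?cperm1 // !expgS cpermM IH.
have [[j [q [jq oq]]]|noodd] := pselect (exists j q, induces x j q /\ odd_perm q);
    last first.
  exists h => g' /(set_stabP xi)[p' gp'].
  have [|m ->] := even _ _ gp'.
    by apply/negP => op; apply: noodd; exists g', p'.
  by exists (w ^+ m); rewrite conjXg hw cX.
(* An odd [w] would have square 1, and so would [p], which has order 3. *)
have ew : ~~ odd_perm w.
  apply/negP => /(odd_perm_small hk)[ww _].
  have gg : g * g = 1.
    by apply/eqP; rewrite -(conjg_eq1 _ h) conjMg hw -cpermM ww cperm1.
  have pp : p ^+ 2 = 1.
    apply/permP => i; rewrite perm1; apply: xi.
    by rewrite -(inducesX 2 gp i) expg2 gg (ract1 ra).
  by move/eqP: pp; rewrite -order_dvdn p3.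
have [Aw _ _] := alt_gen hk w1 ew.
have [qq _] := odd_perm_small hk oq.
have jj : j * j = 1 by apply: (induces1 xi); rewrite -qq; exact: inducesM.
have jV : j^-1 = j by exact: mulg1_eq.
(* The product of [p] and [q] is odd, hence has square 1 as well. *)
have gj : g ^ j = g^-1.
  have opq : odd_perm (p * q) by rewrite odd_permM oq; case: (odd_perm p) ep.
  have [pqpq _] := odd_perm_small hk opq.
  rewrite conjgE jV; apply/esym/mulg1_eq/(induces1 xi); rewrite -pqpq !mulgA.
  by do !apply: inducesM.
have nj : alt_norm (j ^ h).
  move=> v; rewrite -Aw => /cycleP[m ->]; exists (w ^- m).
    by rewrite groupV mem_cycle.
  by rewrite cpermV cX conjXg -hw -conjJg gj conjVg expVgn.
have nj' : alt_normaliser (j ^ h) by split=> //; rewrite -conjVg jV.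
have jh2 : (j ^ h) ^+ 2 = 1 by rewrite -conjXg expg2 jj conj1g.
have wA : w \in C3 by rewrite Alt_even.
have [h' [nh' _] [v hv]] := alt_normaliser_torsion wA w1 nj' (isT : 0 < 2) jh2.
have [w' _ hw'] := nh' w wA.
exists (h * h') => g' /(set_stabP xi)[p' gp']; rewrite conjgM.
have [op'|ep'] := boolP (odd_perm p'); last first.
  by have [m ->] := even _ _ gp' ep'; exists (w' ^+ m); rewrite !conjXg hw hw' cX.
have [||m e] := even (g' * j^-1) (p' * q^-1).
- by apply: inducesM => //; exact: inducesV.
- by rewrite odd_permM odd_permV op' oq.
exists (w' ^+ m * v); have -> : g' = g ^+ m * j by rewrite -e mulgVK.
have -> : ((g ^+ m * j) ^ h) ^ h' = ((g ^ h) ^ h') ^+ m * (j ^ h) ^ h'.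
  by rewrite (conjMg (g ^+ m) j h) (conjMg ((g ^+ m) ^ h)) (conjXg g) (conjXg (g ^ h)).
by rewrite hw hw' hv cpermM cX.
Qed.

End Stabiliser.
End Group.

(** * Finite parts of an action *)

Section Finite.
Variables (k : nat) (D : {set {group 'S_k}}).
Variable T : {W : {group 'S_k} | W \in D} -> finType.
Variable U : choiceType.
Notation A := (letter T).
Notation G := (completion T).
Notation word := (word T).
Notation partial := (partial T U).
Implicit Types (P Q : partial) (W : word) (a c : A) (u v : U) (w : 'S_k).
Hypothesis hk : k = 2 \/ k = 3.
Hypothesis brit : forall W L w, reduced W L -> 0 < L -> weval W L <> cperm T w.
Variables (x0 : U -> 'S_k -> U) (e : 'I_k -> U).
Hypothesis hb : base x0 e.
Notation valid := (valid x0).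
Notation good := (good x0).
Notation total := (total_action (T := T) x0).

Definition restrict (s : U -> G -> U) (F : seq U) : partial := fun a u v =>
  [/\ u \in F, v \in F & s u (clet a) = v].

Definition orbit_closed (F : seq U) :=
  (forall u w, u \in F -> x0 u w \in F) /\ forall i, e i \in F.

(** The natural points are included because [validN] demands loops there. *)
Definition orbit_closure (F : seq U) : seq U :=
  [seq x0 u w | u <- F, w <- enum 'S_k] ++ codom e.

Lemma orbit_closureP F : orbit_closed (orbit_closure F).
Proof.
split=> [u w|i]; rewrite !mem_cat; last by rewrite codom_f orbT.
case/orP=> [/allpairsP[[v w'] /= [vF _ ->]]|/codomP[i ->]].
  rewrite -(baseM hb); apply/orP; left; apply/allpairsP.
  by exists (v, w' * w); rewrite /= mem_enum inE.
by rewrite -(base_eq hb) codom_f orbT.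
Qed.

Lemma sub_orbit_closure F u : u \in F -> u \in orbit_closure F.
Proof.
move=> uF; rewrite mem_cat; apply/orP; left; apply/allpairsP.
by exists (u, 1); rewrite /= mem_enum inE (base1 hb).
Qed.

Lemma clet_perm s a u w : total s -> w \in lgrp a ->
  s (x0 u w) (clet a) = x0 (s u (clet a)) w.
Proof.
by move=> [ra sw _] aw; rewrite -!sw -!(ractM ra) clet_comm.
Qed.

(** The letter commutes with a non-trivial permutation whose only fixed point is [u]. *)
Lemma nonfree_fixed s a u : total s -> nonfree x0 a u -> s u (clet a) = u.
Proof.
move=> ts [w [aw w1 uw]]; apply: (fix_unique hb hk w1) => //.
by rewrite -clet_perm // uw.
Qed.

Lemma nonfree_base a u : nonfree x0 a u -> exists i, u = e i.
Proof.
move=> [w [_ w1 uw]]; apply: contrapT => nu; apply: w1.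
by apply: (base_reg hb _ uw) => i ui; apply: nu; exists i.
Qed.

Lemma valid_restrict s F : total s -> orbit_closed F -> valid (restrict s F).
Proof.
move=> ts [Fw Fe]; have [ra _ _] := ts; split.
- by move=> a u v [uF vF uv]; split=> //; rewrite clet_inv -uv (ractK ra).
- by move=> a u v v' [_ _ <-] [_ _ <-].
- by move=> a u v w aw [uF vF uv]; split; rewrite ?(clet_perm _ ts) ?uv //; exact: Fw.
- move=> a u nu; have uF : u \in F by have [i ->] := nonfree_base nu.
  by split=> //; exact: nonfree_fixed.
- by exists F => a u v [].
Qed.

(* If a reduced word could be read for too long from a tuple of distinct points
   of [F], the tuple would return, and sharpness would make a nonempty reduced
   word trivial. *)
Lemma good_restrict s F : total s -> orbit_closed F -> good (restrict s F).
Proof.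
move=> ts cF; have vP := valid_restrict ts cF; have [ra sw ss] := ts.
(* The bound is the number of possible positions of the tuple in [F]; beyond it some position
   repeats. *)
exists #|{ffun 'I_k -> 'I_(size F)}| => W L p pi rW rp.
have pF i l : l < L -> index (p i l.+1) F < size F.
  by move=> lL; rewrite index_mem; have [] := rp i l lL.
pose f (l : 'I_L) := [ffun i => Ordinal (pF i l (ltn_ord l))].
suff fi : injective f by rewrite -[X in X <= _]card_ord; exact: leq_card fi.
have key (l1 l2 : 'I_L) : f l1 = f l2 -> l1 < l2 -> False.
  move=> /ffunP f12 l12.
  have p12 i : p i l1.+1 = p i l2.+1.
    have := f12 i; rewrite !ffunE => /(congr1 val) /= ii.
    have pF1 : p i l1.+1 \in F by rewrite -index_mem pF.
    have pF2 : p i l2.+1 \in F by rewrite -index_mem pF.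
    by rewrite -(nth_index (p i 0) pF1) ii nth_index.
  pose V := shift l1.+1 W; pose n := l2 - l1.
  have l2L := ltn_ord l2.
  have V1 : weval V n = 1.
    apply: (ss _ (fun i => p i l1.+1)).
      by apply: (reads_inj hb vP _ pi rp); exact: ltn_ord.
    move=> i; have E := @act_eval _ _ _ _ x0 s V n (fun l => p i (l1.+1 + l)) ra sw.
    transitivity (p i (l1.+1 + n)); last by rewrite p12; congr p; lia.
    rewrite -E ?addn0 // => l ln.
    have lL : l1.+1 + l < L by lia.
    by rewrite addnS; have [_ _ ->] := rp i _ lL.
  apply: (@brit V n 1); rewrite ?cperm1 ?subn_gt0 // => l ln.
  by rewrite /V /shift addnS; apply: rW; lia.
move=> l1 l2 f12; apply/val_inj; case: (ltngtP l1 l2) => // l12.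
  by case: (key _ _ f12 l12).
by case: (key _ _ (esym f12) l12).
Qed.

Lemma restrict_det s u g : total s -> exists F : seq U,
  forall F' s', {subset F <= F'} -> right_action s' ->
  (forall u w, s' u (cperm T w) = x0 u w) ->
  extends (restrict s F') s' -> s' u g = s u g.
Proof.
move=> ts; have [ra sw _] := ts.
elim/completion_ind: g => [|g w [F IH]|g a [F IH]].
- by exists [::] => F' s' _ ra' _ _; rewrite !ract1.
- exists F => F' s' FF' ra' sw' es'.
  by rewrite !ractM // (IH F' s') // sw sw'.
- exists [:: s u g, s u (g * clet a) & F] => F' s' FF' ra' sw' es'.
  rewrite !ractM // (IH F' s') //; last by move=> x xF; apply: FF'; rewrite !inE xF !orbT.
  by apply: es'; split=> //; apply: FF'; rewrite !inE ?(ractM ra) ?eqxx ?orbT.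
Qed.

Lemma finite_part s P (S : seq (U * G)) : total s -> valid P -> extends P s ->
  exists Q, [/\ valid Q, good Q, sub_partial P Q, extends Q s &
  forall s', right_action s' -> (forall u w, s' u (cperm T w) = x0 u w) ->
    extends Q s' -> forall x, x \in S -> s' x.1 x.2 = s x.1 x.2].
Proof.
move=> ts vP es; have [FP FPP] := validS vP.
have [F FS] : exists F : seq U, forall F' s', {subset F <= F'} -> right_action s' ->
    (forall u w, s' u (cperm T w) = x0 u w) -> extends (restrict s F') s' ->
    forall x, x \in S -> s' x.1 x.2 = s x.1 x.2.
  elim: S => [|[u g] S [F IH]]; first by exists [::].
  have [F1 F1P] := restrict_det u g ts.
  exists (F1 ++ F) => F' s' FF' ra' sw' es' x.
  rewrite inE => /orP[/eqP->|xS] /=.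
    by apply: (F1P F') => // y yF; apply: FF'; rewrite mem_cat yF.
  by apply: (IH F') => // y yF; apply: FF'; rewrite mem_cat yF orbT.
have cF := orbit_closureP (FP ++ F).
exists (restrict s (orbit_closure (FP ++ F))); split.
- exact: valid_restrict.
- exact: good_restrict.
- move=> a u v uv; split; last exact: es.
    by apply: sub_orbit_closure; rewrite mem_cat (FPP _ _ _ uv).
  by apply: sub_orbit_closure; rewrite mem_cat (FPP _ _ _ (validV vP uv)).
- by move=> a u v [].
- move=> s' ra' sw' es'; apply: FS es' => // y yF.
  by apply: sub_orbit_closure; rewrite mem_cat yF orbT.
Qed.

End Finite.

(** * Unreadable words and fresh tails *)

Section Tails.
Variables (k : nat) (D : {set {group 'S_k}}).
Variable T : {W : {group 'S_k} | W \in D} -> finType.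
Variable U : choiceType.
Notation A := (letter T).
Notation word := (word T).
Notation partial := (partial T U).
Implicit Types (P Q : partial) (W : word) (a c : A) (u v : U) (w : 'S_k).
Hypothesis hk : k = 2 \/ k = 3.
Hypothesis hD : forall W : {group 'S_k}, W \in D -> docile W.
Variables (x0 : U -> 'S_k -> U) (e : 'I_k -> U).
Hypothesis hb : base x0 e.
Notation valid := (valid x0).
Notation good := (good x0).

Lemma nonfree_val P a u v : valid P -> nonfree x0 a u -> P a u v -> v = u.
Proof. by move=> vP /(validN vP) uu uv; exact: (validF vP uv uu). Qed.

Lemma nonfree_lgrp (a c : A) u : lgrp a = lgrp c -> nonfree x0 a u -> nonfree x0 c u.
Proof. by move=> ac [w [aw w1 uw]]; exists w; rewrite -ac. Qed.

Lemma free_val P a u v : valid P -> ~ nonfree x0 a u -> P a u v -> ~ nonfree x0 a v.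
Proof.
move=> vP fu uv nv; apply: fu; have nv' : nonfree x0 (linv a) v by [].
by rewrite (nonfree_val vP nv' (validV vP uv)).
Qed.

(** The free orbit of [i0] is mapped onto the orbit of [b], and an index outside it, which [W]
    fixes, to its natural point, the only point it can go to. *)
Lemma equivariant_tuple (W : {group 'S_k}) i0 b : free_index W i0 ->
  (forall w, w \in W -> x0 b w = b -> w = 1) -> (exists2 w, w \in W & w <> 1) ->
  exists X : 'I_k -> U, [/\ injective X,
    forall w i, w \in W -> X (w i) = x0 (X i) w &
    forall i, (exists2 w, w \in W & X i = x0 b w) \/
      (X i = e i /\ exists w, [/\ w \in W, w <> 1 & w i = i])].
Proof.
move=> fi fb [w0 Ww0 w01].
have /choice[X XP] (i : 'I_k) : exists y, (forall w, w \in W -> w i0 = i -> y = x0 b w) /\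
    ((forall w, w \in W -> w i0 <> i) -> y = e i).
  have [[w [Ww wi]]|nw] := pselect (exists w, w \in W /\ w i0 = i).
    exists (x0 b w); split=> [v Wv vi|/(_ w Ww)//].
    suff -> : v = w by [].
    apply/eqP; rewrite -divg_eq1; apply/eqP; apply: fi; first by rewrite groupM ?groupV.
    by rewrite permM vi -wi permK.
  exists (e i); split=> // w Ww wi; case: nw; by exists w.
have cases i : (exists2 w, w \in W & w i0 = i) \/ (forall w, w \in W -> w i = i) /\
    (forall w, w \in W -> w i0 <> i).
  have [[w Ww wi]|nw] := pselect (exists2 w, w \in W & w i0 = i).
    by left; exists w.
  have nw' w : w \in W -> w i0 <> i by move=> Ww wi; apply: nw; exists w.
  by right; split=> // w; exact: (free_index_fix hk fi nw').
exists X; split.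
- move=> i j Xij.
  have [[v Wv vi]|[iW ni]] := cases i; have [[w Ww wj]|[jW nj]] := cases j.
  + rewrite -vi -wj; suff -> : v = w by [].
    apply/eqP; rewrite -divg_eq1; apply/eqP; apply: fb; first by rewrite groupM ?groupV.
    by rewrite (baseM hb) -((XP i).1 v) // Xij ((XP j).1 w) // (x0K hb).
  + case: w01; apply: fb => //; apply: (x0_inj hb (w := v)) => /=.
    rewrite -!(baseM hb).
    have -> : w0 * v = v * (w0 ^ v) by rewrite -conjgC.
    rewrite (baseM hb) -((XP i).1 v) // Xij ((XP j).2 nj) -(base_eq hb).
    by rewrite jW // groupJ.
  + case: w01; apply: fb => //; apply: (x0_inj hb (w := w)) => /=.
    rewrite -!(baseM hb).
    have -> : w0 * w = w * (w0 ^ w) by rewrite -conjgC.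
    rewrite (baseM hb) -((XP j).1 w) // -Xij ((XP i).2 ni) -(base_eq hb).
    by rewrite iW // groupJ.
  + by apply: (base_inj hb); rewrite -(XP i).2 // -(XP j).2.
- move=> w i Ww; have [[v Wv vi]|[iW ni]] := cases i.
    rewrite ((XP i).1 v) // -(baseM hb); apply: (XP (w i)).1; first exact: groupM.
    by rewrite permM vi.
  by rewrite iW // ((XP i).2 ni) -(base_eq hb) iW.
- move=> i; have [[v Wv vi]|[iW ni]] := cases i; [left|right].
    by exists v; rewrite // ((XP i).1 v).
  by split; [exact: (XP i).2|exists w0; rewrite iW].
Qed.

Definition trivial_lgrp c := forall w, w \in lgrp c -> w = 1.

(** Permutations that may stand before the letter [c] without destroying the equivariance of a tuple
    under [lgrp c]. *)
Definition central_for c w := w = 1 \/ trivial_lgrp c.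

Lemma central_comm c w (v : 'S_k) : central_for c w -> v \in lgrp c -> w * v = v * w.
Proof. by case=> [->|h /h ->]; rewrite ?mulg1 ?mul1g. Qed.

Lemma nonfree_central c w u : central_for c w -> nonfree x0 c (x0 u w) -> nonfree x0 c u.
Proof. by case=> [->|h [v [/h v1]]//]; rewrite (base1 hb). Qed.

Definition readable P c (phi : nat -> 'S_k) m b := exists q : nat -> U,
  q 0 = b /\ forall j, j < m -> P c (x0 (q j) (phi j)) (q j.+1).

(* [k] distinct points from which a long power of [c] is readable contradict
   goodness: the translates of [b] when the group of [c] is trivial, and
   otherwise its orbit under that group together with the fixed points. *)
Lemma kill_one P c b : valid P -> good P -> ~ nonfree x0 c b ->
  exists phi m, (forall j, central_for c (phi j)) /\ ~ readable P c phi m b.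
Proof.
move=> vP [M bM] fb; apply: contrapT => nk.
(* If no word killed [b], then for every admissible [w] a power of [c] longer than the bound could
   be read after [w]. *)
pose Phi w := fun j : nat => if j == 0 then w else 1 : 'S_k.
have rd w : central_for c w -> readable P c (Phi w) M.+1 b.
  move=> cw; apply: contrapT => nr; apply: nk; exists (Phi w), M.+1; split=> // j.
  by rewrite /Phi; case: ifP => _; [|left].
suff [X [Xi rX]] : exists X : 'I_k -> U, injective X /\
    forall i, exists p : nat -> U, p 0 = X i /\ forall j, j < M.+1 -> P c (p j) (p j.+1).
  have [p pP] := choice rX.
  suff : M.+1 <= M by rewrite ltnn.
  apply: (bM (fun _ => (1, c)) M.+1 p).
  - by move=> i j; rewrite !(pP _).1; exact: Xi.
  - by move=> l _ /= /esym/linv_neq.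
  - by move=> i l lM /=; rewrite (base1 hb); exact: (pP i).2.
have [tc|ntc] := pselect (trivial_lgrp c).
  have [X [f [Xi XE]]] : exists (X : 'I_k -> U) (f : 'I_k -> 'S_k),
      injective X /\ forall i, X i = x0 b (f i).
    have [[j0 ->]|nb] := pselect (exists j, b = e j).
      exists e, (tperm j0); split; first exact: (base_inj hb).
      by move=> i; rewrite -(base_eq hb) tpermL.
    have [i0 _] := ord_pair hk.
    exists (fun i => x0 b (tperm i0 i)), (tperm i0); split=> // i j bij.
    rewrite -(tpermL i0 i) -(tpermL i0 j); congr (fun w : 'S_k => w i0).
    apply/eqP; rewrite -divg_eq1; apply/eqP; apply: (base_reg hb (u := b)).
      by move=> l bl; apply: nb; exists l.
    by rewrite (baseM hb) bij (x0K hb).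
  exists X; split=> // i; have [q [q0 qP]] := rd (f i) (or_intror tc).
  exists (fun j => if j is 0 then X i else q j); split=> // -[|j] jM.
    by rewrite XE -q0; exact: (qP 0).
  by have := qP j.+1 jM; rewrite /Phi /= (base1 hb).
have [i0 fi0] := lgrp_docile hD c.
have ex : exists2 w, w \in lgrp c & w <> 1.
  apply: contrapT => nx; apply: ntc => w cw; apply: contrapT => w1.
  by apply: nx; exists w.
have fb' w : w \in lgrp c -> x0 b w = b -> w = 1.
  by move=> cw bw; apply: contrapT => w1; apply: fb; exists w.
have [X [Xi _ XP]] := equivariant_tuple fi0 fb' ex.
exists X; split=> // i; have [[w cw ->]|[-> [w [cw w1 wi]]]] := XP i.
  have [q [q0 qP]] := rd 1 (or_introl erefl).
  exists (fun j => x0 (q j) w); split; first by rewrite q0.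
  move=> j jM; apply: (validE vP) => //.
  by have := qP j jM; rewrite /Phi; case: ifP; rewrite (base1 hb).
exists (fun _ => e i); split=> // j _; apply: (validN vP); exists w; split=> //.
by rewrite -(base_eq hb) wi.
Qed.

(** The points are killed one after the other: if the word found so far can be read from [b], it is
    prolonged by a word that kills the point reached. *)
Lemma kill_list P c (S : seq U) : valid P -> good P ->
  exists phi m, (forall j, central_for c (phi j)) /\
    forall b, b \in S -> ~ nonfree x0 c b -> ~ readable P c phi m b.
Proof.
move=> vP gP; elim: S => [|b S [phi [m [cphi rS]]]].
  by exists (fun _ => 1), 0; split=> // j; left.
have [[fb [q [q0 qP]]]|nr] :=
    pselect (~ nonfree x0 c b /\ readable P c phi m b); last first.
  exists phi, m; split=> // b'; rewrite inE => /orP[/eqP->|]; last exact: rS.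
  by move=> fb rb; apply: nr.
have fq j : j <= m -> ~ nonfree x0 c (q j).
  elim: j => [_|j IH jm]; first by rewrite q0.
  apply: free_val vP _ (qP j jm) => /(nonfree_central (cphi j)).
  by apply: IH; exact: ltnW.
have [psi [n [cpsi rn]]] := kill_one vP gP (fq m (leqnn m)).
exists (fun j => if j < m then phi j else psi (j - m)), (m + n); split.
  by move=> j; case: ifP.
move=> b'; rewrite inE => /orP[/eqP-> _|b'S fb'] [r [r0 rP]].
  have rq j : j <= m -> r j = q j.
    elim: j => [_|j IH jm]; first by rewrite r0 q0.
    have := rP j; rewrite jm IH ?(ltnW jm) // => h.
    apply: (validF vP (h _) (qP j jm)); lia.
  apply: rn; exists (fun j => r (m + j)); split; first by rewrite addn0 rq.
  move=> j jn; have := rP (m + j); have -> : (m + j < m) = false by lia.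
  rewrite addKn addnS.
  by apply; lia.
apply: (rS b') => //; exists r; split=> // j jm.
by have := rP j; rewrite jm; apply; lia.
Qed.

Lemma kill P c : valid P -> good P ->
  exists phi m, [/\ 0 < m, forall j, central_for c (phi j) &
    forall b, ~ nonfree x0 c b -> ~ readable P c phi m b].
Proof.
move=> vP gP; have [F FP] := validS vP.
have [phi [m [cphi rS]]] := kill_list c [seq x0 u w | u <- F, w <- enum 'S_k] vP gP.
(* The extra letter makes the length positive and forces a first edge to be read, so that [b]
   belongs to the finite list treated. *)
exists phi, m.+1; split=> // b fb [q [q0 qP]].
apply: (rS b) => //; last by exists q; split=> // j jm; apply: qP; lia.
apply/allpairsP; exists (x0 b (phi 0), (phi 0)^-1).
rewrite /= mem_enum inE (x0K hb); split=> //.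
by rewrite -q0; apply: FP (qP 0 _).
Qed.

(** [N] is the set of points entered by the new edges. *)
Record extension c P Q (N : U -> Prop) : Prop := Extension {
  ext_sub : sub_partial P Q;
  ext_orbit : forall v w, N v -> N (x0 v w) -> w \in lgrp c;
  ext_fresh : forall v w d u, N v -> ~ P d (x0 v w) u;
  ext_new : forall d u v, Q d u v ->
    [\/ P d u v, d = c /\ N v | d = linv c /\ N u];
  ext_edge : forall v, N v -> exists u, Q (linv c) v u }.

Lemma ext_refl c P : extension c P P (fun _ => False).
Proof. by split=> // d u v uv; constructor 1. Qed.

Lemma ext_trans c P Q R N N' : extension c P Q N -> extension c Q R N' ->
  extension c P R (fun v => N v \/ N' v).
Proof.
move=> [s1 o1 f1 n1 e1] [s2 o2 f2 n2 e2]; split.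
- by move=> d u v /s1/s2.
- move=> v w [Nv|Nv] [Nw|Nw]; [exact: o1 Nv Nw| | |exact: o2 Nv Nw].
    have [u vu] := e1 _ Nv.
    by case: (f2 _ w^-1 (linv c) u Nw); rewrite (x0K hb).
  have [u vu] := e1 _ Nw.
  by case: (f2 _ w (linv c) u Nv).
- by move=> v w d u [/f1|/f2] h; [exact: h|move=> /s1; exact: h].
- move=> d u v /n2[/n1[uv|[-> Nv]|[-> Nu]]|[-> Nv]|[-> Nu]].
  + by constructor 1.
  + by constructor 2; split=> //; left.
  + by constructor 3; split=> //; left.
  + by constructor 2; split=> //; right.
  + by constructor 3; split=> //; right.
- by move=> v [/e1[u /s2]|/e2[u]]; exists u.
Qed.

Lemma push_list P c (S : seq U) : valid P -> good P -> exists Q N,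
  [/\ valid Q, good Q, extension c P Q N,
      forall u, u \in S -> exists v, Q c u v &
      forall u v, Q c u v -> P c u v \/
        exists s w, [/\ s \in S, w \in lgrp c & u = x0 s w]].
Proof.
move=> vP gP; elim: S => [|b S [Q [N [vQ gQ PQ QS QP]]]].
  exists P, (fun _ => False); split=> //; first exact: ext_refl.
  by move=> u v; left.
have QP' u v : Q c u v -> P c u v \/
    exists s w, [/\ s \in b :: S, w \in lgrp c & u = x0 s w].
  move=> /QP[|[s [w [sS cw us]]]]; first by left.
  by right; exists s, w; rewrite inE sS orbT.
have [[v bv]|nb] := pselect (exists v, Q c b v).
  exists Q, N; split=> // u; rewrite inE => /orP[/eqP->|/QS//].
  by exists v.
have nb' v : ~ Q c b v by move=> bv; apply: nb; exists v.
have [v [vR gR bv _ [_ [fv [_ lv]]]]] := single_step hb [::] vQ gQ nb'.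
set R := add_edges _ _ _ in vR gR bv lv.
have ext : extension c Q R (fun v' => exists2 w, w \in lgrp c & v' = x0 v w).
  split.
  - by move=> d u y; left.
  - move=> _ w [w1 cw1 ->] [w2 cw2 vw].
    have := validV vR (validE vR cw2 bv).
    by rewrite -vw -(baseM hb) => /lv[_]; rewrite groupMl.
  - by move=> _ w d u [w1 _ ->]; rewrite -(baseM hb); exact: fv.
  - move=> d u y [uy|[[-> [w cw [-> ->]]]|[-> [w cw [-> ->]]]]].
    + by constructor 1.
    + by constructor 2; split=> //; exists w.
    + by constructor 3; split=> //; exists w.
  - by move=> _ [w cw ->]; exists (x0 b w); exact: (validV vR (validE vR cw bv)).
exists R, (fun v' => N v' \/ exists2 w, w \in lgrp c & v' = x0 v w); split=> //.
- exact: ext_trans PQ ext.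
- move=> u; rewrite inE => /orP[/eqP->|/QS[y uy]]; first by exists v.
  by exists y; left.
- move=> u y [/QP'//|[[_ [w cw [-> _]]]|[/esym/linv_neq//]]].
  by right; exists b, w; rewrite inE eqxx.
Qed.

Lemma push P c (phi : nat -> 'S_k) m (y : 'I_k -> U) : valid P -> good P ->
  exists Q N (r : nat -> 'I_k -> U), [/\ valid Q, good Q, extension c P Q N, r 0 = y &
    forall j i, j < m -> Q c (x0 (r j i) (phi j)) (r j.+1 i)].
Proof.
move=> vP gP; elim: m => [|m [Q [N [r [vQ gQ PQ r0 rP]]]]].
  exists P, (fun _ => False), (fun _ => y); split=> //; exact: ext_refl.
have [R [N' [vR gR QR RS _]]] := push_list c [seq x0 (r m i) (phi m) | i <- enum 'I_k] vQ gQ.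
have /choice[z zP] (i : 'I_k) : exists v, R c (x0 (r m i) (phi m)) v.
  by apply: RS; apply: map_f; rewrite mem_enum.
exists R, (fun v => N v \/ N' v), (fun j => if j <= m then r j else z); split=> //.
- exact: ext_trans PQ QR.
- move=> j i jm; have [->|lt_jm] : j = m \/ j < m by lia.
    by rewrite leqnn ltnn.
  by rewrite lt_jm (ltnW lt_jm); apply: (ext_sub QR); exact: rP.
Qed.

(** As the word is unreadable in [P], some step uses a new edge. It enters a fresh point, where no
    old edge starts, so every later step uses a new edge too. *)
Lemma push_enters c P Q N (phi : nat -> 'S_k) m (r : nat -> U) :
  extension c P Q N -> ~ readable P c phi m (r 0) ->
  (forall j, j < m -> Q c (x0 (r j) (phi j)) (r j.+1)) -> N (r m).
Proof.
move=> PQ nr rP.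
have [j jm nPj] : exists2 j, j < m & ~ P c (x0 (r j) (phi j)) (r j.+1).
  apply: contrapT => nj; apply: nr; exists r; split=> // j jm.
  by apply: contrapT => nP; apply: nj; exists j.
have step l : l < m -> ~ P c (x0 (r l) (phi l)) (r l.+1) -> N (r l.+1).
  by move=> lm nP; case: (ext_new PQ (rP l lm)) => // -[] // /esym/linv_neq.
suff H n : j.+1 + n <= m -> N (r (j.+1 + n)) by have := H (m - j.+1); rewrite subnKC //; apply.
elim: n => [|n IH] nm; first by rewrite addn0; exact: step.
rewrite addnS; apply: step; first by lia.
by apply: (ext_fresh PQ); apply: IH; lia.
Qed.

End Tails.

(** * Tails of fresh points attached to a tuple *)

Section Tail.
Variables (k : nat) (D : {set {group 'S_k}}).
Variable T : {W : {group 'S_k} | W \in D} -> finType.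
Variable U : choiceType.
Notation A := (letter T).
Notation word := (word T).
Notation partial := (partial T U).
Implicit Types (P Q : partial) (W : word) (a c : A) (u v : U) (w : 'S_k).
Hypothesis hk : k = 2 \/ k = 3.
Variables (x0 : U -> 'S_k -> U) (e : 'I_k -> U).
Hypothesis hb : base x0 e.
Notation valid := (valid x0).
Notation good := (good x0).

Definition equivariant (c : A) (y : 'I_k -> U) :=
  forall w i, w \in lgrp c -> y (w i) = x0 (y i) w.

Lemma equivariant_step P c w (y z : 'I_k -> U) : valid P -> central_for c w -> equivariant c y ->
  (forall i, P c (x0 (y i) w) (z i)) -> equivariant c z.
Proof.
move=> vP cw ey yz v i cv; apply: (validF vP (yz (v i))).
by rewrite ey // -(baseM hb) -(central_comm cw cv) (baseM hb); exact: (validE vP).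
Qed.

Lemma injective_step P c w (y z : 'I_k -> U) : valid P -> injective y ->
  (forall i, P c (x0 (y i) w) (z i)) -> injective z.
Proof.
move=> vP yi yz i j zij; apply/yi/(x0_inj hb (w := w)).
have := validV vP (yz i); rewrite zij => h.
exact: (validF vP h (validV vP (yz j))).
Qed.

(** [tail_edges] is the central field: from a tail vertex one can only go back or on to the next
    vertex. The freshness conditions concern free indices, because at a non-free index [c] is a loop
    and the tail stands still. *)
Record tail c P (phi : nat -> 'S_k) m Q (q : nat -> 'I_k -> U) : Prop := Tail {
  tail_sub : sub_partial P Q;
  tail_read : forall j i, j < m -> Q c (x0 (q j i) (phi j)) (q j.+1 i);
  tail_edges : forall j i d w v, j < m -> ~ nonfree x0 c (q 0 i) ->
    Q d (x0 (q j.+1 i) w) v ->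
    (d = linv c /\ w \in lgrp c) \/
    [/\ j.+1 < m, d = c & (phi j.+1)^-1 * w \in lgrp c];
  tail_old_c : forall u v, Q c u v -> P c u v \/
    exists j i, [/\ j < m, ~ nonfree x0 c (q 0 i) & v = q j.+1 i];
  tail_old : forall d u v, d <> c -> d <> linv c -> Q d u v -> P d u v;
  tail_fresh : forall j i d w v, j < m -> ~ nonfree x0 c (q 0 i) ->
    ~ P d (x0 (q j.+1 i) w) v;
  tail_sep : forall j i i' w, j <= m -> ~ nonfree x0 c (q 0 i) ->
    ~ nonfree x0 c (q 0 i') -> q j i' = x0 (q j i) w -> w \in lgrp c;
  tail_last : forall j i i' w, j < m -> ~ nonfree x0 c (q 0 i') ->
    q m i' <> x0 (q j i) w;
  tail_edge : forall j i, j <= m -> exists d v, Q d (q j i) v }.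

Lemma tail_exists c P phi m (q0 : 'I_k -> U) : valid P -> good P ->
  (forall j, central_for c (phi j)) -> equivariant c q0 ->
  (forall i w v, ~ nonfree x0 c (q0 i) -> ~ P c (x0 (q0 i) w) v) ->
  (forall i i' w, ~ nonfree x0 c (q0 i) -> ~ nonfree x0 c (q0 i') ->
    q0 i' = x0 (q0 i) w -> w \in lgrp c) ->
  (forall i, exists d v, P d (q0 i) v) ->
  exists Q q, [/\ valid Q, good Q, q 0 = q0, tail c P phi m Q q &
    forall j, j <= m -> equivariant c (q j)].
Proof.
move=> vP gP cphi eq0 q0c q0s q0e.
elim: m => [|m [Q [q [vQ gQ qq0 tQ eq]]]].
  exists P, (fun _ => q0); split=> //; split=> //.
  - by move=> u v; left.
  - by move=> j i i' w _; exact: q0s.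
have srcF i v : ~ nonfree x0 c (q 0 i) -> ~ Q c (x0 (q m i) (phi m)) v.
  move=> fi; case: (posnP m) => [m0|m0].
    move=> /(tail_old_c tQ)[|[j [i' []]]]; last by rewrite m0.
    by rewrite m0 qq0 in fi *; exact: q0c.
  rewrite -(prednK m0) => h.
  have [|[/esym/linv_neq//]|[]] := tail_edges tQ _ fi h; first by lia.
  by lia.
have [R [N [vR gR QR RS RP]]] := push_list hb c [seq x0 (q m i) (phi m) | i <- enum 'I_k] vQ gQ.
have /choice[n nP] (i : 'I_k) : exists v, R c (x0 (q m i) (phi m)) v.
  by apply: RS; apply: map_f; rewrite mem_enum.
have Nn i : ~ nonfree x0 c (q 0 i) -> N (n i).
  move=> fi; case: (ext_new QR (nP i)) => [/(srcF _ _ fi)//|[_ //]|[/esym/linv_neq//]].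
(* New edges start at free indices only: at a non-free one the path has remained at a fixed point,
   where the loop [c] was already present. *)
have RP' u v : R c u v -> Q c u v \/
    exists i w, [/\ ~ nonfree x0 c (q 0 i), w \in lgrp c & u = x0 (x0 (q m i) (phi m)) w].
  move=> uv; case: (RP u v uv) => [|[s [w [/mapP[i _ ->] cw us]]]]; first by left.
  have [ni|fi] := pselect (nonfree x0 c (q 0 i)); last by right; exists i, w.
  left.
  have nm : nonfree x0 c (q m i).
    apply: contrapT => fm; have key j : j <= m -> ~ nonfree x0 c (q (m - j) i).
      elim: j => [|j IH] jm; first by rewrite subn0.
      have jm' : m - j.+1 < m by lia.
      have := tail_read tQ i jm'; have -> : (m - j.+1).+1 = m - j by lia.
      move=> h nj; apply: IH; first by lia.
      have nj' : nonfree x0 c (x0 (q (m - j.+1) i) (phi (m - j.+1))).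
        case: (cphi (m - j.+1)) => [->|tc]; first by rewrite (base1 hb).
        by case: nj => x [/tc].
      by rewrite (nonfree_val vQ nj' h).
    by apply: (key m (leqnn m)); rewrite subnn.
  have nu : nonfree x0 c u.
    rewrite us; apply: (nonfreeE hb cw).
    case: (cphi m) => [->|tc]; first by rewrite (base1 hb).
    by case: nm => x [/tc].
  by rewrite (nonfree_val vR nu uv); exact: (validN vQ).
pose q' j := if j <= m then q j else n.
have q'E j : j <= m -> q' j = q j by rewrite /q' => ->.
have q'n : q' m.+1 = n by rewrite /q' ltnn.
have q'0 : q' 0 = q 0 by rewrite q'E.
exists R, q'; split=> //.
- split; rewrite ?q'0.
  + by move=> a u v /(tail_sub tQ)/(ext_sub QR).
  + move=> j i jm; have [->|lt_jm] : j = m \/ j < m by lia.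
      by rewrite q'n q'E.
    by rewrite !q'E ?(ltnW lt_jm) //; apply: (ext_sub QR); exact: (tail_read tQ).
  + move=> j i d w v jm fi; have [->|lt_jm] : j = m \/ j < m by lia.
      rewrite q'n => h; left; case: (ext_new QR h) => [/(ext_fresh QR (Nn i fi))//|[dc _]|[dc Nw]].
        subst d; case: (RP' _ _ h) => [/(ext_fresh QR (Nn i fi))//|[i' [w' [fi' cw']]]].
        move=> /(congr1 (fun u => x0 u (phi m * w')^-1)).
        rewrite -!(baseM hb) mulgA mulgV (base1 hb) => nq.
        have [d [v' dv]] := tail_edge tQ i' (leqnn m).
        by case: (ext_fresh QR (Nn i fi) (w := w * (phi m * w')^-1) (d := d) (u := v')); rewrite nq.
      by split=> //; exact: (ext_orbit QR (Nn i fi) Nw).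
    rewrite q'E // => h.
    have [d' [v' dv']] := tail_edge tQ i lt_jm.
    have nN w' : ~ N (x0 (q j.+1 i) w').
      by move=> Nw; apply: (ext_fresh QR Nw (w := w'^-1) (d := d') (u := v')); rewrite (x0K hb).
    case: (ext_new QR h) => [/(tail_edges tQ lt_jm fi)[|[lt dc cw]]|[dc _]|[_ /nN//]].
    * by left.
    * by right; split=> //; exact: ltnW.
    subst d; case: (RP' _ _ h) => [/(tail_edges tQ lt_jm fi)[|[lt dc cw]]|].
    * by left.
    * by right; split=> //; exact: ltnW.
    move=> [i' [w' [fi' cw' /esym E]]]; right.
    have E' : q m i' = x0 (q j.+1 i) (w * (phi m * w')^-1).
      by rewrite (baseM hb) -E -!(baseM hb) mulgA mulgV (base1 hb).
    have [jm1|jm1] : j.+1 = m \/ j.+1 < m by lia.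
      split=> //; rewrite jm1 // in E' *.
      have := tail_sep tQ (leqnn m) fi fi' E'.
      rewrite invgM; case: (cphi m) => [->|tc].
        by rewrite invg1 mul1g mulg1 groupMr ?groupV.
      by move=> /tc; rewrite (tc _ cw') invg1 mul1g => /eqP; rewrite divg_eq1 => /eqP->; rewrite mulVg group1.
    by case: (tail_last tQ jm1 fi' E').
  + move=> u v uv; case: (ext_new QR uv) => [/(tail_old_c tQ)[|[j [i [jm fi ->]]]]|[_ Nv]|[/esym/linv_neq//]].
    * by left.
    * by right; exists j, i; rewrite q'E //; split=> //; exact: ltnW.
    case: (RP' _ _ uv) => [/(tail_old_c tQ)[|[j [i [jm fi ->]]]]|[i [w [fi cw us]]]].
    * by left.
    * by right; exists j, i; rewrite q'E //; split=> //; exact: ltnW.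
    right; exists m, (w i); split=> //.
      rewrite eq // => nf; apply: fi; rewrite -(x0K hb (q 0 i) w); apply: (nonfreeE hb) => //.
      by rewrite groupV.
    rewrite q'n; apply: (validF vR uv).
    have -> : u = x0 (q m (w i)) (phi m).
      by rewrite us (eq m) // -!(baseM hb) (central_comm (cphi m) cw).
    exact: nP.
  + move=> d u v dc dc' uv; case: (ext_new QR uv) => [|[//]|[//]].
    exact: (tail_old tQ).
  + move=> j i d w v jm fi; have [->|lt_jm] : j = m \/ j < m by lia.
      by rewrite q'n => /(tail_sub tQ); exact: (ext_fresh QR (Nn i fi)).
    by rewrite q'E //; exact: (tail_fresh tQ).
  + move=> j i i' w jm fi fi'; have [->|lt_jm] : j = m.+1 \/ j <= m by lia.
      rewrite q'n => nn.
      by apply: (ext_orbit QR (Nn i fi)); rewrite -nn; exact: Nn.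
    by rewrite q'E //; exact: (tail_sep tQ).
  + move=> j i i' w jm fi'; rewrite q'n (q'E j) // => nn.
    have [d [v dv]] := tail_edge tQ i jm.
    apply: (ext_fresh QR (Nn _ fi') (w := w^-1) (d := d) (u := v)).
    by rewrite nn (x0K hb).
  + move=> j i jm; have [->|lt_jm] : j = m.+1 \/ j <= m by lia.
      by rewrite q'n; exists (linv c), (x0 (q m i) (phi m)); exact: (validV vR (nP i)).
    rewrite q'E //; have [d [v dv]] := tail_edge tQ i lt_jm.
    by exists d, v; exact: (ext_sub QR).
- move=> j jm; have [->|lt_jm] : j = m.+1 \/ j <= m by lia.
    by rewrite q'n; exact: (equivariant_step vR (cphi m) (eq m (leqnn m)) nP).
  by rewrite q'E //; exact: eq.
Qed.
End Tail.

(** * Connecting two tuples *)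

Section Glue.
Variables (k : nat) (D : {set {group 'S_k}}).
Variable T : {W : {group 'S_k} | W \in D} -> finType.
Variable U : choiceType.
Notation A := (letter T).
Notation word := (word T).
Notation partial := (partial T U).
Implicit Types (P Q : partial) (W : word) (a c : A) (u v : U) (w : 'S_k).
Hypothesis hk : k = 2 \/ k = 3.
Variables (x0 : U -> 'S_k -> U) (e : 'I_k -> U).
Hypothesis hb : base x0 e.
Notation valid := (valid x0).
Notation good := (good x0).

Lemma reduced_rev W L w : reduced W L -> reduced (rev_word W L w) L.
Proof.
move=> rW i iL; rewrite /rev_word /= linvK groupV => al wl.
have e1 : L - i.+1 = (L - i.+2).+1 by lia.
apply: (rW (L - i.+2)); first by lia.
  by rewrite -e1 -al.
by rewrite -e1; move: wl; rewrite /lgrp /= -al.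
Qed.

(** Points of a path are recorded before the permutation of the next syllable; reading backwards,
    they are met after it. *)
Definition rev_path W L (p : nat -> U) t :=
  if t == 0 then p L else x0 (p (L - t)) (W (L - t)).1.

Lemma reads_rev P W L p : valid P -> reads x0 P W L p ->
  reads x0 P (rev_word W L 1) L (rev_path W L p).
Proof.
move=> vP rp t tL; have h := validV vP (rp (L - t.+1) ltac:(lia)).
rewrite /rev_path /rev_word /=.
case: eqP => [t0|t0].
  by rewrite (base1 hb) t0; move: h; rewrite t0; have -> // : (L - 1).+1 = L by lia.
by rewrite (x0K hb); move: h; have -> // : (L - t.+1).+1 = L - t by lia.
Qed.

Variables (P0 P : partial) (a c : A) (phi : nat -> 'S_k) (m : nat).
Variables (q : nat -> 'I_k -> U) (z : 'I_k -> U).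
Hypothesis vP : valid P.
Hypothesis gP : good P.
Hypothesis ac : lgrp a = lgrp c.
Hypothesis nac : a <> c.
Hypothesis nac' : a <> linv c.
Hypothesis m0 : 0 < m.
Hypothesis cphi : forall j, central_for c (phi j).
Hypothesis tP : tail x0 c P0 phi m P q.
Hypothesis eq : forall j, j <= m -> equivariant x0 c (q j).
Hypothesis qi : injective (q m).
Hypothesis ez : equivariant x0 c z.
Hypothesis zi : injective z.
Notation fr i := (~ nonfree x0 c (q 0 i)).
Hypothesis frP : forall i, nonfree x0 c (q 0 i) <->
  exists w, [/\ w \in lgrp c, w <> 1 & w i = i].
Hypothesis zfree : forall i, fr i -> forall v, ~ P (linv a) (z i) v.
Hypothesis yfree : forall i, fr i -> forall v, ~ P a (q m i) v.
Hypothesis zq : forall i j i' w, fr i -> fr i' -> j < m -> z i <> x0 (q j.+1 i') w.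
Hypothesis unread : forall b v, ~ nonfree x0 c b -> P a b v ->
  ~ exists r : nat -> U, r m = b /\
    forall j, j < m -> P c (x0 (r j) (phi j)) (r j.+1).

Let y := q m.

Let E u v := exists i, [/\ fr i, u = y i & v = z i].
Notation P' := (add_edges P a E).

Lemma nonfree_index (x : 'I_k -> U) i : equivariant x0 c x ->
  nonfree x0 c (q 0 i) -> exists w, [/\ w \in lgrp c, w <> 1 & x0 (x i) w = x i].
Proof.
move=> ex /frP[w [cw w1 wi]]; exists w; split=> //.
by rewrite -ex // wi.
Qed.

Lemma fr_perm i w : w \in lgrp c -> fr i -> fr (w i).
Proof.
move=> cw fi; rewrite eq // => nf; apply: fi; rewrite -(x0K hb (q 0 i) w).
by apply: (nonfreeE hb) => //; rewrite groupV.
Qed.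

(** Both points are fixed by the same non-trivial permutation. This is why [E] joins free indices
    only: elsewhere the loop [a] is already the required edge. *)
Lemma yz_nonfree i : nonfree x0 c (q 0 i) -> y i = z i.
Proof.
move=> nf; have [w [cw w1 wi]] := (frP i).1 nf.
apply: (fix_unique hb hk w1); first by rewrite /y -eq // wi.
by rewrite -ez // wi.
Qed.

Lemma valid_glue : valid P'.
Proof.
apply: (valid_add vP) => //.
- by move=> u v v' [i [_ -> ->]] [j [_ /qi -> ->]].
- by move=> u u' v [i [_ -> ->]] [j [_ -> /zi ->]].
- move=> u v w; rewrite ac => cw [i [fi -> ->]]; exists (w i); split.
  + exact: fr_perm.
  + by rewrite /y eq.
  + by rewrite ez.
- exists (codom y ++ codom z) => u v [i [_ -> ->]]; rewrite !mem_cat.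
  by rewrite !codom_f orbT.
- by move=> u v v' [i [fi -> _]]; exact: yfree.
- by move=> u v u' [i [fi _ ->]]; exact: zfree.
Qed.

Lemma glue_other d u v : d <> a -> d <> linv a -> P' d u v -> P d u v.
Proof. by move=> da da' [//|[[/da]|[/da']]]. Qed.

Lemma glue_c u v : P' c u v -> P c u v.
Proof. by apply: glue_other => // ca; [exact: nac|apply: nac'; rewrite ca linvK]. Qed.

Lemma glue_edges n i w d v : n < m -> fr i -> P' d (x0 (q n.+1 i) w) v ->
  [\/ d = linv c /\ w \in lgrp c,
    [/\ n.+1 < m, d = c & (phi n.+1)^-1 * w \in lgrp c] |
    [/\ n.+1 = m, d = a & w \in lgrp c]].
Proof.
move=> nm fi [/(tail_edges tP nm fi)[h|h]|[[da [i' [fi' E1 _]]]|[_ [i' [fi' _ E1]]]]].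
- by constructor 1.
- by constructor 2.
- constructor 3; have [n1|n1] : n.+1 = m \/ n.+1 < m by lia.
    by split=> //; apply: (tail_sep tP (j := n.+1) _ fi fi') => //; rewrite E1 n1.
  by case: (tail_last tP n1 fi' (esym E1)).
- by case: (zq fi' fi nm (esym E1)).
Qed.

(* A reduced path arriving at [y] has come along the whole tail, so that every
   other path along the same word has just read the unreadable word [phi];
   hence it cannot cross an old edge either. *)
Lemma glue_sync W L (p : 'I_k -> nat -> U) l i i0 : reduced W L ->
  (forall i, reads x0 P' W L (p i)) -> l < L -> m <= l -> (W l).2 = a -> fr i0 ->
  x0 (p i l) (W l).1 = y i0 -> forall i', exists j, x0 (p i' l) (W l).1 = y j.
Proof.
move=> rW rp lL ml Wa fi0 pi0 i'.
(* The permutation with which the tail is left at its vertex [m - j]; at the end the new edge is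
   crossed without one. *)
pose psi j := if j == 0 then 1 else phi (m - j).
(* Going back [j] steps, path [i] is at vertex [m - j] of the tail, and path [i'] has just read the
   last [j] syllables of [phi], up to a factor in [lgrp c]. *)
have H j : j <= m -> [/\ j = 0 \/ (W (l - j)).2 = c,
    exists2 i1, fr i1 & x0 (p i (l - j)) (W (l - j)).1 = x0 (q (m - j) i1) (psi j) &
    exists r : nat -> U, [/\ forall t, m - j <= t < m -> P c (x0 (r t) (phi t)) (r t.+1),
      exists2 w, w \in lgrp c & r m = x0 (x0 (p i' l) (W l).1) w &
      exists2 w, w \in lgrp c &
        x0 (r (m - j)) (psi j) = x0 (p i' (l - j)) ((W (l - j)).1 * w)]].
  elim: j => [_|j IH jm].
    rewrite !subn0; split; first by left.
      by exists i0 => //; rewrite pi0 (base1 hb).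
    exists (fun _ => x0 (p i' l) (W l).1); split; first by lia.
      by exists 1; rewrite ?group1 // (base1 hb).
    by exists 1; rewrite ?group1 // (base1 hb) mulg1.
  have [Wc [i1 fi1 pi1] [r [rP rl [w cw rw]]]] := IH (ltnW jm).
  have en : m - j = (m - j.+1).+1 by lia.
  have el : l - j = (l - j.+1).+1 by lia.
  set th := (W (l - j)).1 in pi1 rw.
  have pE : p i (l - j) = x0 (q (m - j) i1) (psi j * th^-1).
    by rewrite (baseM hb) -pi1 (x0K hb).
  have ljL : l - j.+1 < L by lia.
  have ljL' : (l - j.+1).+1 < L by lia.
  have back := validV valid_glue (rp i _ ljL).
  rewrite -el pE en in back.
  have nm : m - j.+1 < m by lia.
  have [dc thc] : (W (l - j.+1)).2 = c /\ psi j * th^-1 \in lgrp c.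
    (* Arriving from the next tail vertex, or through the new edge at the end, would be an immediate
       return in a reduced word. *)
    case: (glue_edges nm fi1 back) => [[dc cw']|[jm1 dc cw']|[jm1 da cw']].
    - by split=> //; exact: (can_inj (@linvK _ _ _) dc).
    - exfalso; have j0 : j <> 0 by lia.
      case: Wc => [//|Wc].
      apply: (rW _ ljL'); rewrite -el; first by rewrite Wc -dc.
      have -> : lgrp (W (l - j.+1)).2 = lgrp c by rewrite -dc.
      move: cw'; rewrite /psi -en; case: eqP => // _.
      by rewrite mulgA mulVg mul1g groupV.
    - exfalso; have j0 : j = 0 by lia.
      move: cw'; rewrite /psi j0 /= mul1g groupV => cw'.
      apply: (rW _ ljL'); rewrite -el; first by rewrite da j0 subn0.
      have -> : lgrp (W (l - j.+1)).2 = lgrp c by rewrite -ac -da.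
      exact: cw'.
  set w1 := psi j * th^-1 in thc.
  have pE1 : p i (l - j) = q (m - j) (w1 i1) by rewrite eq ?pE //; lia.
  have thE : th = w1^-1 * psi j by rewrite /w1 invgM invgK mulgVK.
  have fwd x : P c (x0 (p x (l - j.+1)) (W (l - j.+1)).1) (p x (l - j)).
    by apply: glue_c; have := rp x _ ljL; rewrite dc -el.
  have fi1' : fr (w1 i1) by exact: fr_perm.
  split; first by right.
    exists (w1 i1) => //; rewrite /psi /=.
    have h1 := validV vP (fwd i); have h2 := validV vP (tail_read tP (w1 i1) nm).
    rewrite -en -pE1 in h2; exact: (validF vP h1 h2).
  pose w2 := w1^-1 * w.
  have cw2 : w2 \in lgrp c by rewrite groupM ?groupV.
  have rE : r (m - j) = x0 (p i' (l - j)) w2.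
    apply: (x0_inj hb (w := psi j)); rewrite rw -(baseM hb) thE.
    have cpsi : central_for c (psi j) by rewrite /psi; case: ifP => _; [left|exact: cphi].
    by rewrite /w2 -!mulgA (central_comm cpsi cw).
  pose r0 := x0 (p i' (l - j.+1)) ((W (l - j.+1)).1 * w2 * (phi (m - j.+1))^-1).
  exists (fun t => if t == m - j.+1 then r0 else r t); split.
  - move=> t tm; have [->|tj] : t = m - j.+1 \/ m - j <= t by lia.
      rewrite eqxx; have -> : ((m - j.+1).+1 == m - j.+1) = false by lia.
      rewrite -en rE /r0 (baseM hb) (x0KV hb) (baseM hb).
      exact: (validE vP cw2 (fwd i')).
    have -> : (t == m - j.+1) = false by lia.
    have -> : (t.+1 == m - j.+1) = false by lia.
    by apply: rP; lia.
  - by have -> : (m == m - j.+1) = false by lia.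
  - exists w2 => //; rewrite eqxx /psi /= /r0 -(baseM hb).
    by rewrite mulgVK.
have [_ _ [r [rP [w cw rm] _]]] := H m (leqnn m).
set b := x0 (p i' l) (W l).1 in rm *.
case: (rp i' l lL); rewrite -/b; last first.
  case=> [[_ [j [_ -> _]]]|[al]]; first by exists j.
  by move: al; rewrite Wa => /esym/linv_neq.
rewrite Wa => Pb.
(* An old [a]-edge at [b]: if [b] is free, [phi] followed by [a] has been read, against [unread]; if
   not, [b] is a fixed point and therefore one of the [y j]. *)
have [nb|fb] := pselect (nonfree x0 c b); last first.
  exfalso; have fb' : ~ nonfree x0 c (x0 b w).
    move=> nb; apply: fb; rewrite -(x0K hb b w); apply: (nonfreeE hb) => //.
    by rewrite groupV.
  have cw' : w \in lgrp a by rewrite ac.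
  apply: (unread fb' (validE vP cw' Pb)); exists r; split=> // j jm.
  by apply: rP; lia.
have [i1 bi1] := nonfree_base hb nb; have [v [cv v1 bv]] := nb.
exists i1; apply: (fix_unique hb hk v1 bv); rewrite /y -eq //.
congr (q m _); apply: (base_inj hb); by rewrite (base_eq hb) -bi1.
Qed.


(** This is [glue_sync] for the reversed word, so the [m] syllables of room are now required after
    position [l]. *)
Lemma glue_sync_inv W L (p : 'I_k -> nat -> U) l i i0 : reduced W L ->
  (forall i, reads x0 P' W L (p i)) -> l + m < L -> (W l).2 = linv a -> fr i0 ->
  x0 (p i l) (W l).1 = z i0 -> forall i', exists j, p i' l.+1 = y j.
Proof.
move=> rW rp lL Wa fi0 pi0 i'.
pose t := L - l.+1.
have rr := reduced_rev (w := 1) rW.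
have rpr x : reads x0 P' (rev_word W L 1) L (rev_path W L (p x)).
  exact: reads_rev valid_glue (rp x).
have tW x : x0 (rev_path W L (p x) t) (rev_word W L 1 t).1 = p x l.+1.
  rewrite /rev_path /rev_word /= /t; case: eqP => [t0|t0].
    by rewrite (base1 hb); congr p; lia.
  by rewrite (x0K hb); congr p; lia.
have pl : p i l.+1 = y i0.
  have lL' : l < L by lia.
  have := rp i l lL'; rewrite Wa pi0 => h; apply: (validF valid_glue h).
  by right; right; split=> //; exists i0.
have [||||j] := @glue_sync (rev_word W L 1) L _ t i i0 rr rpr _ _ _ fi0 _ i'.
- by rewrite /t; lia.
- by rewrite /t; lia.
- rewrite /rev_word /= /t; have -> : L - (L - l.+1).+1 = l by lia.
  by rewrite Wa linvK.
- by rewrite tW.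
by rewrite tW => ->; exists j.
Qed.

Hypothesis noconn : forall W L (p : 'I_k -> nat -> U) w,
  (forall i, reads x0 P W L (p i)) -> injective (fun i => p i 0) ->
  (forall i, exists j, p i 0 = z j) -> (forall i, exists j, x0 (p i L) w = y j) -> False.
Hypothesis noconn' : forall W L (p : 'I_k -> nat -> U) w,
  (forall i, reads x0 P W L (p i)) -> injective (fun i => p i 0) ->
  (forall i, exists j, p i 0 = y j) -> (forall i, exists j, x0 (p i L) w = z j) -> False.
Hypothesis stab : forall W L (p : 'I_k -> nat -> U) w, reduced W L ->
  (forall i, reads x0 P W L (p i)) -> injective (fun i => p i 0) ->
  (forall i, exists j, p i 0 = y j) -> (forall i, exists j, x0 (p i L) w = y j) ->
  L = 0 /\ w \in lgrp c.

(* Among the crossings of the new edges in the middle of a long reduced word,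
   two consecutive ones are opposite, and a backward one is not followed by a
   forward one; so there are at most two of them. *)
Lemma good_glue : good P'.
Proof.
(* Three crossings, each found within [M] steps, must lie at least [m] syllables away from both
   ends; 9 leaves some slack. *)
have [M bM] := gP; exists (2 * m + 3 * M + 9) => W L p pi rW rp.
rewrite leqNgt; apply/negP => bigL.
pose fwd l := (W l).2 = a /\ forall i, exists j, x0 (p i l) (W l).1 = y j.
pose bwd l := (W l).2 = linv a /\ forall i, exists j, x0 (p i l) (W l).1 = z j.
pose marked l := exists i i0, fr i0 /\ (((W l).2 = a /\ x0 (p i l) (W l).1 = y i0) \/
  ((W l).2 = linv a /\ x0 (p i l) (W l).1 = z i0)).
have pinj l : l <= L -> injective (fun i => p i l).
  by move=> lL; exact: (reads_inj hb valid_glue lL pi rp).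
have old l i : l < L -> ~ marked l -> P (W l).2 (x0 (p i l) (W l).1) (p i l.+1).
  move=> lL nm; case: (rp i l lL) => [//|[[al [j [fj pj _]]]|[al [j [fj _ pj]]]]]; case: nm.
    by exists i, j; split=> //; left.
  by exists i, j; split=> //; right.
have P'yz i : P' a (y i) (z i).
  have [ni|fi] := pselect (nonfree x0 c (q 0 i)); last by right; left; split=> //; exists i.
  left; rewrite -yz_nonfree //; apply: (validN vP).
  have [w [cw w1 qw]] := nonfree_index (eq (leqnn m)) ni.
  by exists w; rewrite ac.
have fwd_next l : l < L -> fwd l -> forall i, exists j, p i l.+1 = z j.
  move=> lL [al yl] i; have [j pj] := yl i; exists j.
  have := rp i l lL; rewrite al pj => h; exact: (validF valid_glue h).
have bwd_next l : l < L -> bwd l -> forall i, exists j, p i l.+1 = y j.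
  move=> lL [al zl] i; have [j pj] := zl i; exists j.
  have := rp i l lL; rewrite al pj => h.
  exact: (validF valid_glue h (validV valid_glue (P'yz j))).
(* In the middle of the word, one path crossing a new edge brings all [k] paths to the joined
   tuple. *)
have types l : m <= l -> l + m < L -> marked l -> fwd l \/ bwd l.
  move=> ml lm [i [i0 [fi0 [[al pl]|[al pl]]]]]; [left|right]; split=> // i'.
    by apply: (glue_sync rW rp _ ml al fi0 pl); lia.
  have lL : l < L by lia.
  have [j pj] := glue_sync_inv rW rp lm al fi0 pl i'; exists j.
  have h := validV valid_glue (rp i' l lL); rewrite al linvK pj in h.
  exact: (validF valid_glue h (P'yz j)).
(* Without a crossing, [M.+1] consecutive syllables would be readable along old edges. *)
have next s : s + M < L -> exists l, [/\ s <= l <= s + M, marked l &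
    forall l', s <= l' < l -> ~ marked l'].
  move=> sM.
  have ex : exists l, (s <= l <= s + M) && `[< marked l >].
    apply: contrapT => nl; suff : M.+1 <= M by rewrite ltnn.
    apply: (bM (shift s W) M.+1 (fun i l => p i (s + l))).
    - by rewrite addn0; apply: pinj; lia.
    - by move=> l lM; rewrite /shift addnS; apply: rW; lia.
    - move=> i l lM; rewrite /shift addnS; apply: old; first by lia.
      move=> ml; apply: nl; exists (s + l); apply/andP; split; first by lia.
      exact/asboolP.
  case: (ex_minnP ex) => l /andP[sl /asboolP ml] lmin; exists l; split=> // l' l'l ml'.
  have /lmin : (s <= l' <= s + M) && `[< marked l' >].
    by apply/andP; split; [lia|exact/asboolP].
  by lia.
have seg l l' : l < l' -> l' < L -> (forall x, l.+1 <= x < l' -> ~ marked x) ->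
    [/\ reduced (shift l.+1 W) (l' - l.+1),
       forall i, reads x0 P (shift l.+1 W) (l' - l.+1) (fun x => p i (l.+1 + x)),
       injective (fun i => p i (l.+1 + 0)) & l.+1 + (l' - l.+1) = l'].
  move=> ll' l'L nm; split; last by lia.
  - by move=> x xl; rewrite /shift addnS; apply: rW; lia.
  - by move=> i x xl; rewrite /shift addnS; apply: old; [lia|apply: nm; lia].
  - by rewrite addn0; apply: pinj; lia.
have noFF l l' : l < l' -> l' < L -> (forall x, l.+1 <= x < l' -> ~ marked x) ->
    fwd l -> fwd l' -> False.
  move=> ll' l'L nm fl [_ yl']; have [_ rs ij e1] := seg l l' ll' l'L nm.
  apply: (noconn rs ij (w := (W l').1)); rewrite ?e1 // => i; rewrite addn0.
  by apply: fwd_next; [lia|].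
have noBB l l' : l < l' -> l' < L -> (forall x, l.+1 <= x < l' -> ~ marked x) ->
    bwd l -> bwd l' -> False.
  move=> ll' l'L nm fl [_ yl']; have [_ rs ij e1] := seg l l' ll' l'L nm.
  apply: (noconn' rs ij (w := (W l').1)); rewrite ?e1 // => i; rewrite addn0.
  by apply: bwd_next; [lia|].
have noBF l l' : l < l' -> l' < L -> (forall x, l.+1 <= x < l' -> ~ marked x) ->
    bwd l -> fwd l' -> False.
  move=> ll' l'L nm fl [al' yl']; have [ds rs ij e1] := seg l l' ll' l'L nm.
  have [||L0 cw] := stab ds rs ij (w := (W l').1); rewrite ?e1 //.
    by move=> i; rewrite addn0; apply: bwd_next; [lia|].
  have el : l' = l.+1 by lia.
  have [al _] := fl.
  apply: (rW l); rewrite -el // ?al' ?al ?linvK //.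
  by have -> : lgrp (linv a) = lgrp c by [].
have [|l1 [l1m m1 _]] := next m; first by lia.
have [|l2 [l2m m2 n2]] := next l1.+1; first by lia.
have [|l3 [l3m m3 n3]] := next l2.+1; first by lia.
have [||f1|b1] := types l1 _ _ m1; [lia|lia| |].
- have [||f2|b2] := types l2 _ _ m2; [lia|lia| |].
    by apply: noFF n2 f1 f2; lia.
  have [||f3|b3] := types l3 _ _ m3; [lia|lia| |].
    by apply: noBF n3 b2 f3; lia.
  by apply: noBB n3 b2 b3; lia.
- have [||f2|b2] := types l2 _ _ m2; [lia|lia| |].
    by apply: noBF n2 b1 f2; lia.
  by apply: noBB n2 b1 b2; lia.
Qed.

End Glue.

Section Maps.
Variables (k : nat) (G : groupType) (U : Type) (s : U -> G -> U).
Hypothesis ra : right_action s.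
Implicit Types x y z : 'I_k -> U.

Definition maps x (g : G) y := forall i, exists j, s (x i) g = y j.

Lemma maps_comp x y z g h : maps x g y -> maps y h z -> maps x (g * h) z.
Proof.
move=> xy yz i; have [j e] := xy i; have [l e'] := yz j.
by exists l; rewrite (ractM ra) e e'.
Qed.

Lemma onto_of_injective (f : 'I_k -> 'I_k) : injective f -> forall j, exists i, f i = j.
Proof.
move=> fi j; have /codomP[i ->] : j \in codom f by exact: (injF_onto fi).
by exists i.
Qed.

Lemma maps_inv x y g : injective x -> maps x g y -> maps y g^-1 x.
Proof.
move=> xi /choice[f fP] j.
have [i ij] : exists i, f i = j.
  apply: onto_of_injective => i i' ii'; apply/xi/(ract_inj ra (g := g)).
  by rewrite /= !fP ii'.
by exists i; rewrite -ij -fP (ractK ra).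
Qed.

End Maps.

Lemma image_onto k (U : Type) (x y : 'I_k -> U) : injective x ->
  (forall i, exists j, x i = y j) -> forall j, exists i, y j = x i.
Proof.
move=> xi /choice[f fP] j.
have [i ij] : exists i, f i = j.
  by apply: onto_of_injective => i i' ii'; apply: xi; rewrite !fP ii'.
by exists i; rewrite fP ij.
Qed.

(** * Moving a tuple onto the natural orbit *)

Section Connect.
Variables (k : nat) (D : {set {group 'S_k}}).
Variable T : {W : {group 'S_k} | W \in D} -> finType.
Hypothesis hT : forall W, (2 <= #|T W|)%N.
Hypothesis hD : docile_representatives D.
Variable U : choiceType.
Notation A := (letter T).
Notation G := (completion T).
Notation word := (word T).
Notation partial := (partial T U).
Implicit Types (P Q : partial) (W : word) (a c : A) (u v : U) (w : 'S_k).
Hypothesis hk : k = 2 \/ k = 3.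
Variable en : nat -> U.
Hypothesis enP : forall u, exists n, en n = u.

Lemma representatives_docile (W : {group 'S_k}) : W \in D -> docile W.
Proof.
move=> WD; case/and3P: hD => _ DD _.
by move/fintype.subsetP: DD => /(_ _ WD); rewrite inE.
Qed.

Lemma representative (W : {group 'S_k}) : docile W ->
  exists r : 'S_k, (W :^ r)%G \in D.
Proof.
move=> dW; case/and3P: hD => _ _ /forall_inP h.
pose B := orbit 'JG [set: 'S_k]%SET W.
have /h/cards1P[V eV] : B \in orbit 'JG [set: 'S_k]%SET @: docile_groups k.
  by apply: imset_f; rewrite inE.
have : V \in D :&: B by rewrite eV inE.
by rewrite inE => /andP[VD /orbitP[r _ e]]; exists r; move: VD; rewrite -e.
Qed.

Lemma two_letters (V : {group 'S_k}) : V \in D -> exists a c : A,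
  [/\ lgrp a = V, lgrp c = V, a <> c & a <> linv c].
Proof.
move=> VD; pose W : {W : {group 'S_k} | W \in D} := exist _ V VD.
have /card_gt1P[t [t' [_ _ tt']]] : 1 < #|T W| by exact: hT.
exists (Tagged T t, false), (Tagged T t', false); split=> //.
move=> /(congr1 fst) /= /eqP; rewrite eq_Tagged /= => /eqP e.
by rewrite e eqxx in tt'.
Qed.

Lemma some_letter : A.
Proof.
have d1 : docile (1%G : {group 'S_k}).
  have [i _] := ord_pair hk; apply/docileP; exists i => w /set1P -> //.
have [r rD] := constructive_indefinite_description (representative d1).
have [a _] := constructive_indefinite_description (two_letters rD).
exact: a.
Qed.


Hypothesis brit : forall W L w, reduced W L -> 0 < L -> weval W L <> cperm T w.
Variables (x0 : U -> 'S_k -> U) (e : 'I_k -> U).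
Hypothesis hb : base x0 e.
Notation valid := (valid x0).
Notation good := (good x0).
Notation total := (total_action (T := T) x0).

Definition meets_base (s : U -> G -> U) (x : 'I_k -> U) := exists g, maps s x g e.

Lemma fixed_square (w : 'S_k) i : w <> 1 -> w i = i -> k = 3 /\ w * w = 1.
Proof.
move=> w1 wi.
have mv j : j <> i -> w j <> j by move=> ji wj; apply: ji; exact: (perm_fix2 hk w1).
have [j ji] : exists j, j <> i.
  by have [a [b ab]] := ord_pair hk; have [ai|ai] := pselect (a = i);
    [exists b; rewrite -ai; exact: nesym|exists a].
have wji : w j <> i by rewrite -wi => /perm_inj.
split.
  case: hk => // k2; exfalso.
  have : #|[set i; j; w j]%SET| <= 2.
    by rewrite -[X in _ <= X]k2 -[X in _ <= X]card_ord; exact: max_card.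
  rewrite -finset.setUA cardsU1 cards2 !inE.
  have /eqP/negbTE -> := nesym ji; have /eqP/negbTE -> := nesym wji.
  by have /eqP -> := nesym (mv j ji).
apply/permP => l; rewrite permM perm1.
have [->|li] := pselect (l = i); first by rewrite !wi.
have wli : w l <> i by rewrite -wi => /perm_inj.
have [||] := ord3_cases hk (w (w l)) (nesym li) (nesym wli) (nesym (mv l li)) => //.
  by rewrite -wi => /perm_inj.
by move=> /perm_inj/(mv l li).
Qed.

Lemma square_odd (w : 'S_k) : w <> 1 -> w * w = 1 -> odd_perm w.
Proof.
move=> w1 ww; apply/negPn/negP => ew; have [_ w3 _] := alt_gen hk w1 ew.
have : w ^+ 2 == 1 by rewrite expg2 ww.
by rewrite -order_dvdn w3.
Qed.

(** Here [k = 3] and [w] is a transposition, so [p] is odd and fixes some index [l]; then [x l] is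
    the unique fixed point of [w], namely [e i]. *)
Lemma stab_fix (s : U -> G -> U) x w p i : total s -> injective x ->
  induces s x (cperm T w) p -> w <> 1 -> w i = i -> exists l, x l = e i.
Proof.
move=> [ra sw ss] xi ip w1 wi; have [k3 ww] := fixed_square w1 wi.
have pE l : x (p l) = x0 (x l) w by rewrite -sw ip.
have pp : p * p = 1.
  apply/permP => l; rewrite permM perm1; apply: xi.
  by rewrite !pE -(baseM hb) ww (base1 hb).
have p1 : p <> 1.
  move=> p1; apply: w1; apply: (base_faithful hk hb xi) => l.
  by rewrite -pE p1 perm1.
have [l pl] := odd_perm_fix hk k3 (square_odd p1 pp).
exists l; apply: (fix_unique hb hk w1); first by rewrite -pE pl.
by rewrite -(base_eq hb) wi.
Qed.

Lemma base_nonfree c x : injective x -> equivariant x0 c x -> forall i,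
  nonfree x0 c (x i) <-> exists w, [/\ w \in lgrp c, w <> 1 & w i = i].
Proof.
move=> xi ex i; split=> -[w [cw w1 wi]]; exists w; split=> //.
  by apply: xi; rewrite ex.
by rewrite -ex // wi.
Qed.

Lemma weval_central c (phi : nat -> 'S_k) m w : (forall j, central_for c (phi j)) ->
  w \in lgrp c ->
  weval (fun j => (phi j, c)) m * cperm T w = cperm T w * weval (fun j => (phi j, c)) m.
Proof.
move=> cphi cw; elim: m => [|m IH] /=; first by rewrite mul1g mulg1.
rewrite /lval /= -!mulgA -(clet_comm cw) (mulgA (cperm T (phi m))) -cpermM.
by rewrite (central_comm (cphi m) cw) cpermM !mulgA IH.
Qed.

Lemma push_eval s P c (phi : nat -> 'S_k) m (r : nat -> 'I_k -> U) : total s ->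
  extends P s -> (forall j i, j < m -> P c (x0 (r j i) (phi j)) (r j.+1 i)) ->
  forall i, s (r 0 i) (weval (fun j => (phi j, c)) m) = r m i.
Proof.
move=> [ra sw _] es rP i.
apply: (@act_eval _ _ _ _ x0 s (fun j => (phi j, c)) m (fun j => r j i) ra sw) => l lm; apply: es; exact: rP.
Qed.

Section Step.
Variables (P : partial) (x : 'I_k -> U).
Hypothesis vP : valid P.
Hypothesis gP : good P.
Hypothesis xi : injective x.
Hypothesis H : forall s, total s -> extends P s -> ~ meets_base s x.

Definition image_perms (s : U -> G -> U) : {set 'S_k} :=
  [set p | `[< exists g, induces s x g p >]]%SET.

Lemma maximal_stabiliser : exists2 s, total s /\ extends P s &
  forall s', total s' -> extends P s' -> #|image_perms s'| <= #|image_perms s|.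
Proof.
pose Q n := `[< exists s, [/\ total s, extends P s & #|image_perms s| = n] >].
have ex : exists n, Q n.
  have [s [ts es]] := extend_total some_letter hk enP hb vP gP.
  by exists #|image_perms s|; apply/asboolP; exists s.
have bd n : Q n -> n <= #|'S_k| by move=> /asboolP[s [_ _ <-]]; exact: max_card.
case: (ex_maxnP ex bd) => n /asboolP[s [ts es sn]] nmax; exists s => // s' ts' es'.
by rewrite sn; apply: nmax; apply/asboolP; exists s'.
Qed.

(** The tuple is first translated so that its stabiliser is a group [W] of permutations. If [W] were
    not docile, each index would be fixed by a non-trivial element and [stab_fix] would place every
    natural point in the tuple, against [H]. A permutation then turns [W] into its representative
    [V], and the points are reordered so that [V] permutes them as it permutes the indices. *)
Lemma standard_tuple : exists (V : {group 'S_k}) h (y : 'I_k -> U) s,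
  [/\ V \in D, total s /\ extends P s,
   forall s', total s' -> extends P s' -> #|image_perms s'| <= #|image_perms s|,
   injective y & 
   [/\ forall w i, w \in V -> y (w i) = x0 (y i) w,
     forall i, exists j, y i = s (x j) h &
     forall g, set_stab s y g -> exists2 w, w \in V & g = cperm T w]].
Proof.
have [s [ts es] smax] := maximal_stabiliser; have [ra sw ss] := ts.
have [h1 h1P] := finite_conj some_letter hk brit ra ss xi.
pose x1 i := s (x i) h1; have x1i : injective x1 by move=> i j /(ract_inj ra)/xi.
pose W0 := [set w | `[< set_stab s x1 (cperm T w) >]]%SET.
have WP0 w : w \in W0 <-> set_stab s x1 (cperm T w).
  by rewrite inE; split=> [/asboolP|?] //; exact/asboolP.
have gW0 : group_set W0.
  apply/group_setP; split.
    by apply/WP0 => i; exists i; rewrite cperm1 (ract1 ra).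
  move=> v w /WP0 vs /WP0 ws; apply/WP0; rewrite cpermM.
  exact: (maps_comp ra (vs : maps s x1 _ x1) (ws : maps s x1 _ x1)).
pose W : {group 'S_k} := Group gW0.
have WP w : w \in W <-> set_stab s x1 (cperm T w) by exact: WP0.
have dW : docile W.
  apply: contrapT => nd.
  have hit i : exists l, x1 l = e i.
    have [w [Ww wi w1]] : exists w, [/\ w \in W, w i = i & w <> 1].
      apply: contrapT => nw; apply: nd; apply/docileP; exists i => w Ww wi.
      by apply: contrapT => w1; apply: nw; exists w.
    have [p ip] := set_stabP ra x1i ((WP w).1 Ww).
    exact: (stab_fix ts x1i ip w1 wi).
  have /choice[f fP] := hit; apply: (H ts es); exists h1 => l.
  have [i il] : exists i, f i = l.
    apply: onto_of_injective => i i' ii'; apply: (base_inj hb).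
    by rewrite -!fP ii'.
  by exists i; rewrite -fP il.
have [r rD] := representative dW.
pose V := (W :^ r)%G; pose x2 i := x0 (x1 i) r.
have x2i : injective x2 by move=> i j /(x0_inj hb)/x1i.
have x2E : x2 = (fun i => s (x1 i) (cperm T r)) by apply/funext => i; rewrite sw.
have VP g : set_stab s x2 g -> exists2 w, w \in V & g = cperm T w.
  rewrite x2E => /(set_stabJ ra) gs; have [w ew] := h1P _ gs.
  exists (w ^ r); first by rewrite memJ_conjg; apply/WP; rewrite -ew.
  by rewrite conjgE !cpermM cpermV -conjgE -ew -conjgM mulVg conjg1.
have PV w : w \in V -> set_stab s x2 (cperm T w).
  rewrite x2E => /imsetP[v Wv ->]; apply/(set_stabJ ra).
  rewrite conjgE !cpermM cpermV -conjgE -conjgM mulgV conjg1.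
  exact/WP.
have x2x i : exists j, x2 i = s (x j) (h1 * cperm T r).
  by exists i; rewrite (ractM ra) sw.
suff [y [yi yV yx]] : exists y : 'I_k -> U, [/\ injective y,
    forall w i, w \in V -> y (w i) = x0 (y i) w & forall i, exists j, y i = x2 j].
  exists V, (h1 * cperm T r), y, s; split=> //; split=> //.
    by move=> i; have [j ->] := yx i; exact: x2x.
  move=> g gy; apply: VP => i.
  have [j ej] := image_onto yi yx i; have [l el] := gy j.
  by have [l' el'] := yx l; exists l'; rewrite ej el el'.
have [tV|ntV] := pselect (forall w, w \in V -> w = 1).
  exists x2; split=> // [w i /tV ->|i]; last by exists i.
  by rewrite perm1 (base1 hb).
have [a [_ [aV _ _ _]]] := two_letters rD.
have [l fl] := some_free hb representatives_docile a x2i.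
have [i0 fi0] : exists i, free_index V i by apply/docileP; exact: representatives_docile.
have fb w : w \in V -> x0 (x2 l) w = x2 l -> w = 1.
  by move=> Vw xw; apply: contrapT => w1; apply: fl; exists w; rewrite aV.
have ex : exists2 w, w \in V & w <> 1.
  apply: contrapT => nx; apply: ntV => w Vw; apply: contrapT => w1.
  by apply: nx; exists w.
have [y [yi yV yP]] := equivariant_tuple hk hb fi0 fb ex.
exists y; split=> // i; have [[w Vw ->]|[-> [w [Vw w1 wi]]]] := yP i.
  by have [j ej] := PV w Vw l; exists j; rewrite -ej sw.
have [p ip] := set_stabP ra x2i (PV w Vw).
by have [j ej] := stab_fix ts x2i ip w1 wi; exists j.
Qed.


(** [Q] remembers one element [gf p] for each permutation [p] induced on the tuple. All of these
    survive in an extension; by maximality no permutation is added, and by sharpness no other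
    element induces the same one. *)
Lemma stable_part s : total s -> extends P s ->
  (forall s', total s' -> extends P s' -> #|image_perms s'| <= #|image_perms s|) ->
  forall h, exists Q, [/\ valid Q, good Q, sub_partial P Q &
    forall s', total s' -> extends Q s' ->
      (forall i, s' (x i) h = s (x i) h) /\
      forall g, set_stab s' x g -> set_stab s x g].
Proof.
move=> ts es smax h; have [ra sw ss] := ts.
have /choice[gf gfP] (p : 'S_k) : exists g, p \in image_perms s -> induces s x g p.
  have [ps|np] := boolP (p \in image_perms s); last by exists 1.
  by move: (ps); rewrite inE => /asboolP[g gp]; exists g.
pose S := [seq (x i, h) | i <- enum 'I_k] ++
  [seq (x i, gf p) | i <- enum 'I_k, p <- enum 'S_k].
have [Q [vQ gQ PQ Qs QS]] := finite_part hk brit hb S ts vP es.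
exists Q; split=> // s' ts' es'; have [ra' sw' ss'] := ts'.
have es'' : extends P s' by move=> a u v /PQ; exact: es'.
have Sx i : s' (x i) h = s (x i) h.
  apply: (QS s' ra' sw' es' (x i, h)); rewrite mem_cat; apply/orP; left.
  by apply: map_f; rewrite mem_enum.
have Sg i p : s' (x i) (gf p) = s (x i) (gf p).
  apply: (QS s' ra' sw' es' (x i, gf p)); rewrite mem_cat; apply/orP; right.
  by apply: allpairs_f; rewrite mem_enum.
split=> // g gs.
have ind p : p \in image_perms s -> induces s' x (gf p) p.
  by move=> ps i; rewrite Sg (gfP p ps).
have eK : image_perms s = image_perms s'.
  apply/eqP; rewrite eqEcard (smax s') // andbT; apply/fintype.subsetP => p ps.
  by rewrite inE; apply/asboolP; exists (gf p); exact: ind.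
have [p gp] := set_stabP ra' xi gs.
have ps : p \in image_perms s by rewrite eK inE; apply/asboolP; exists g.
rewrite (induces_eq ra' ss' xi gp (ind p ps)).
exact: induces_stab (gfP p ps).
Qed.

(** The tuple is led through [x], [y0], [y1], [q m3], [z] and [e]. At free indices a fresh point
    carries only the edge that entered it: [y1] is entered by [a], so the tail in [c] can start
    there, while the end of the tail and [z] are entered by [c], so the final edge [a] can leave the
    one and reach the other. From [y0] on, the connecting words commute with [V], which keeps the
    tuples equivariant. *)
Lemma connect_absurd : False.
Proof.
have [V [h [y0 [s [VD [ts es] smax y0i [y0V y0x y0s]]]]]] := standard_tuple.
have [ra sw ss] := ts.
have [P1 [vP1 gP1 PP1 P1s]] := stable_part ts es smax h.
have [a [c [aV cV nac nac']]] := two_letters VD.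
have ac : lgrp a = lgrp c by rewrite aV cV.
have a_central w : central_for a w -> central_for c w.
  by case=> [->|t]; [left|right; move=> v; rewrite -ac; exact: t].
have dm := representatives_docile.
have ee : equivariant x0 c e by move=> w i _; exact: (base_eq hb).
have ey0 : equivariant x0 c y0 by move=> w i; rewrite cV; exact: y0V.
(* the target tuple [e] is moved by the letter [c] to fresh points [z] *)
have [phi1 [m1 [_ cphi1 kill1]]] := kill hk dm hb c vP1 gP1.
have [P2 [N2 [r2 [vP2 gP2 ext2 r20 rd2]]]] := push hk hb c phi1 m1 e vP1 gP1.
pose z := r2 m1.
have fre i : (exists w, [/\ w \in lgrp c, w <> 1 & w i = i]) <-> nonfree x0 c (e i).
  by split=> [/(base_nonfree (base_inj hb) ee)|/(base_nonfree (base_inj hb) ee)].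
have zN i : ~ nonfree x0 c (e i) -> N2 (z i).
  move=> fi; apply: (push_enters hk (r := fun j => r2 j i) ext2) => [|j jm]; last exact: rd2.
  by rewrite r20; exact: kill1.
(* the tuple [y0] is moved by the letter [a] to fresh points [y1] *)
have [phi2 [m2 [_ cphi2 kill2]]] := kill hk dm hb a vP2 gP2.
have [P3 [N3 [r3 [vP3 gP3 ext3 r30 rd3]]]] := push hk hb a phi2 m2 y0 vP2 gP2.
pose y1 := r3 m2.
have ez j : j <= m1 -> equivariant x0 c (r2 j) /\ injective (r2 j).
  elim: j => [_|j IH jm]; first by rewrite r20; split=> //; exact: (base_inj hb).
  have [eq1 i1] := IH (ltnW jm); have rj i := rd2 j i jm; split.
    exact: (equivariant_step hb vP2 (cphi1 j) eq1 rj).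
  exact: (injective_step hb vP2 i1 rj).
have ey j : j <= m2 -> equivariant x0 a (r3 j) /\ injective (r3 j).
  elim: j => [_|j IH jm].
    by rewrite r30; split=> // w i; rewrite aV; exact: y0V.
  have [eq1 i1] := IH (ltnW jm); have rj i := rd3 j i jm; split.
    exact: (equivariant_step hb vP3 (cphi2 j) eq1 rj).
  exact: (injective_step hb vP3 i1 rj).
have [eza zi] := ez m1 (leqnn _); have [eya y1i] := ey m2 (leqnn _).
have ey1 : equivariant x0 c y1 by move=> w i; rewrite -ac; exact: eya.
have frE t : injective t -> equivariant x0 c t -> forall i,
    nonfree x0 c (t i) <-> nonfree x0 c (e i).
  move=> ti et i; split.
    by move=> /(base_nonfree ti et)/fre.
  by move=> /fre/(base_nonfree ti et).
have y1N i : ~ nonfree x0 c (y1 i) -> N3 (y1 i).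
  move=> fi; apply: (push_enters hk (r := fun j => r3 j i) ext3) => [|j jm]; last exact: rd3.
  rewrite r30; apply: kill2 => /(nonfree_lgrp ac) nf; apply: fi.
  by apply/(frE _ y1i ey1)/(frE _ y0i ey0).
(* a tail spelling an unreadable word in the letter [c] is attached to [y1] *)
have [phi3 [m3 [m30 cphi3 kill3]]] := kill hk dm hb c vP3 gP3.
have y1c i w v : ~ nonfree x0 c (y1 i) -> ~ P3 c (x0 (y1 i) w) v.
  move=> fi /(ext_new ext3)[/(ext_fresh ext3 (y1N i fi))//|[/esym ca _]|[ca _]] //.
  by apply: nac'; rewrite ca linvK.
have y1s i i' w : ~ nonfree x0 c (y1 i) -> ~ nonfree x0 c (y1 i') ->
    y1 i' = x0 (y1 i) w -> w \in lgrp c.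
  move=> fi fi' E; rewrite -ac; apply: (ext_orbit ext3 (y1N i fi)).
  by rewrite -E; exact: y1N.
have y1e i : exists d v, P3 d (y1 i) v.
  have [ni|fi] := pselect (nonfree x0 c (y1 i)).
    by exists c, (y1 i); exact: (validN vP3).
  by have [v yv] := ext_edge ext3 (y1N i fi); exists (linv a), v.
have [P4 [q [vP4 gP4 q0 tl eq]]] :=
  tail_exists hk hb m3 vP3 gP3 cphi3 ey1 y1c y1s y1e.
have frq i : nonfree x0 c (q 0 i) <-> nonfree x0 c (e i) by rewrite q0; exact: frE.
have qi j : j <= m3 -> injective (q j).
  elim: j => [_|j IH jm]; first by rewrite q0.
  exact: (injective_step hb vP4 (IH (ltnW jm)) (fun i => tail_read tl i jm)).
have P14 : sub_partial P1 P4.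
  by move=> d u v /(ext_sub ext2)/(ext_sub ext3)/(tail_sub tl).
have zE i : ~ nonfree x0 c (q 0 i) -> N2 (z i) by move=> fi; apply: zN => /frq.
have zedge i : ~ nonfree x0 c (q 0 i) -> exists v, P2 (linv c) (z i) v.
  by move=> /zE/(ext_edge ext2).
have zfree i : ~ nonfree x0 c (q 0 i) -> forall v, ~ P4 (linv a) (z i) v.
  have na1 : linv a <> c by move=> E; apply: nac'; rewrite -E linvK.
  have na2 : linv a <> linv c by move=> /(can_inj (@linvK _ _ _)).
  move=> fi v /(tail_old tl na1 na2) h3.
  have [h2|[/linv_neq//]|[_ N3z]] := ext_new ext3 h3.
  - have [h1|[E _]|[E _]] := ext_new ext2 h2.
    + by apply: (ext_fresh ext2 (zE i fi) (w := 1)); rewrite (base1 hb); exact: h1.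
    + exact: na1.
    + exact: na2.
  - have [u zu] := zedge i fi.
    by apply: (ext_fresh ext3 N3z (w := 1)); rewrite (base1 hb); exact: zu.
have yfree i : ~ nonfree x0 c (q 0 i) -> forall v, ~ P4 a (q m3 i) v.
  move=> fi v /(tail_old tl nac nac') Pq.
  have m3m : m3.-1 < m3 by lia.
  apply: (tail_fresh tl (w := 1) m3m fi); rewrite (base1 hb) prednK //; exact: Pq.
have zq i j i' w : ~ nonfree x0 c (q 0 i) -> ~ nonfree x0 c (q 0 i') -> j < m3 ->
    z i <> x0 (q j.+1 i') w.
  move=> fi fi' jm E; have [v /(ext_sub ext3)] := zedge i fi.
  by rewrite E; exact: (tail_fresh tl jm fi').
(* Tail vertices carry no edge of [P3]. Going backwards from an [a]-edge, which is old, the whole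
   word [phi3] must have been read in [P3], where it is unreadable. *)
have unread b v : ~ nonfree x0 c b -> P4 a b v ->
    ~ exists r : nat -> U, r m3 = b /\
      forall j, j < m3 -> P4 c (x0 (r j) (phi3 j)) (r j.+1).
  move=> fb /(tail_old tl nac nac') Pb [r [rm rP]].
  have C j : j <= m3 -> (exists d v w, P3 d (x0 (r (m3 - j)) w) v) /\
      forall l, m3 - j <= l < m3 -> P3 c (x0 (r l) (phi3 l)) (r l.+1).
    elim: j => [_|j IH jm].
      split; last by lia.
      by exists a, v, 1; rewrite subn0 rm (base1 hb).
    have [[d [u [w du]]] rl] := IH (ltnW jm).
    have ej : m3 - j = (m3 - j.+1).+1 by lia.
    have Pj : P3 c (x0 (r (m3 - j.+1)) (phi3 (m3 - j.+1))) (r (m3 - j)).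
      have mj : m3 - j.+1 < m3 by lia.
      rewrite ej; have [//|[j' [i [j'm fi E]]]] := tail_old_c tl (rP _ mj).
      by case: (tail_fresh tl j'm fi (d := d) (w := w) (v := u)); rewrite -E -ej.
    split; first by exists c, (r (m3 - j)), (phi3 (m3 - j.+1)).
    move=> l lm; have [->|lm'] : l = m3 - j.+1 \/ m3 - j <= l by lia.
      by rewrite -ej.
    by apply: rl; lia.
  have [_ rP3] := C m3 (leqnn _); rewrite subnn in rP3.
  have fr j : j <= m3 -> nonfree x0 c (r 0) -> nonfree x0 c (r j).
    elim: j => [//|j IH] jm n0; have nj := IH (ltnW jm) n0.
    have nj' : nonfree x0 c (x0 (r j) (phi3 j)).
      case: (cphi3 j) => [->|tc]; first by rewrite (base1 hb).
      by case: nj => t [/tc].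
    by rewrite (nonfree_val vP4 nj' (rP j jm)).
  apply: (kill3 (r 0)); first by move=> n0; apply: fb; rewrite -rm; exact: fr.
  by exists r.
have frP i : nonfree x0 c (q 0 i) <-> exists w, [/\ w \in lgrp c, w <> 1 & w i = i].
  by split=> [/frq/fre|/fre/frq].
have moves s' : total s' -> extends P4 s' ->
    [/\ extends P s', maps s' x h y0,
      maps s' y0 (weval (fun j => (phi2 j, a)) m2 * weval (fun j => (phi3 j, c)) m3) (q m3),
      maps s' z (weval (fun j => (phi1 j, c)) m1)^-1 e &
      forall g, set_stab s' y0 g -> exists2 w, w \in V & g = cperm T w].
  move=> ts' es'; have [ra' sw' ss'] := ts'.
  have e1 : extends P1 s' by move=> d u v /P14; exact: es'.
  have e2 : extends P2 s'.
    by move=> d u v /(ext_sub ext3)/(tail_sub tl); exact: es'.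
  have e3 : extends P3 s' by move=> d u v /(tail_sub tl); exact: es'.
  have [Sx stx] := P1s s' ts' e1.
  have xy0 : maps s' x h y0.
    have y0x' i : exists j, y0 i = s (x j) h by exact: y0x.
    have sxi : injective (fun j => s (x j) h) by move=> i j /(ract_inj ra)/xi.
    by move=> i; have [j ej] := image_onto y0i y0x' i; exists j; rewrite Sx.
  split=> //.
  - by move=> d u v /PP1; exact: e1.
  - move=> i; exists i; rewrite (ractM ra') -r30.
    rewrite (push_eval (r := r3) ts' e3 rd3) -/y1 -q0.
    by rewrite (push_eval (r := q) ts' es' (fun j i => tail_read tl i)).
  - move=> i; exists i; rewrite /z -(push_eval (r := r2) ts' e2 rd2) (ractK ra') r20 //.
  - move=> g gs; apply: y0s.
    have gx : set_stab s' x (h * g * h^-1).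
      have xi' := maps_inv ra' xi xy0.
      exact: (maps_comp ra' (maps_comp ra' xy0 gs) xi').
    have /stx gsx := gx.
    move=> i; have [j ej] := y0x i; have [l el] := gsx j.
    have [l' el'] : exists l', s (x l) h = y0 l'.
      by have [l' el'] := xy0 l; exists l'; rewrite -Sx.
    by exists l'; rewrite ej -el' -el !(ractM ra) (ractKV ra).
have reads_total s' W L (p : 'I_k -> nat -> U) w : total s' -> extends P4 s' ->
    (forall i, reads x0 P4 W L (p i)) -> forall i,
    s' (p i 0) (weval W L * cperm T w) = x0 (p i L) w.
  move=> [ra' sw' _] es' rp i; rewrite (ractM ra') sw'; congr (x0 _ w).
  by apply: (@act_eval _ _ _ _ x0 s' W L (p i) ra' sw') => l lL; apply: es'; exact: rp.
have reads_maps s' W L (p : 'I_k -> nat -> U) w (t t' : 'I_k -> U) :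
    total s' -> extends P4 s' ->
    (forall i, reads x0 P4 W L (p i)) -> injective (fun i => p i 0) ->
    (forall i, exists j, p i 0 = t j) -> (forall i, exists j, x0 (p i L) w = t' j) ->
    maps s' t (weval W L * cperm T w) t'.
  move=> ts' es' rp pi pt pt' j; have [i ij] := image_onto pi pt j.
  by have [l el] := pt' i; exists l; rewrite ij (reads_total s' W L p w).
(* An auxiliary action turns hypothetical paths in [P4] into elements of [G]; it verifies the last
   three hypotheses of [good_glue]. *)
have [s4 [ts4 es4]] := extend_total some_letter hk enP hb vP4 gP4.
have [ra4 sw4 ss4] := ts4.
have [es4P xy0 y0y ze y0st] := moves s4 ts4 es4.
have noyz g : ~ maps s4 (q m3) g z.
  move=> yz; apply: (H ts4 es4P).
  exists (h * (weval (fun j => (phi2 j, a)) m2 * weval (fun j => (phi3 j, c)) m3) *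
    g * (weval (fun j => (phi1 j, c)) m1)^-1).
  exact: (maps_comp ra4 (maps_comp ra4 (maps_comp ra4 xy0 y0y) yz) ze).
have fri : exists i0, free_index V i0 by apply/docileP; exact: dm.
pose P5 := add_edges P4 a (fun u v => exists i,
  [/\ ~ nonfree x0 c (q 0 i), u = q m3 i & v = z i]).
have eqq j : j <= m3 -> equivariant x0 c (q j) by exact: eq.
have qim := qi m3 (leqnn _).
have vP5 : valid P5 := valid_glue hb vP4 ac eqq qim eza zi zfree yfree.
have gP5 : good P5.
  apply: (good_glue hk hb vP4 gP4 ac nac nac' m30 cphi3 tl eqq qim eza zi frP
    zfree yfree zq unread).
  - move=> W L p w rp pi pz py; apply: (noyz (weval W L * cperm T w)^-1).
    by apply: (maps_inv ra4 zi); exact: reads_maps py.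
  - move=> W L p w rp pi py pz; apply: (noyz (weval W L * cperm T w)).
    exact: reads_maps pz.
  (* Conjugation by [g1] carries the stabiliser of [q m3] to that of [y0], and [g1] commutes with
     [V]; a word returning to [q m3] thus equals a permutation in [V], and Britton's lemma makes it
     empty. *)
  - move=> W L p w rW rp pi py py'.
    have gst : maps s4 (q m3) (weval W L * cperm T w) (q m3) by exact: reads_maps py'.
    set g1 := _ * _ in y0y.
    have g1st : set_stab s4 y0 (g1 * (weval W L * cperm T w) * g1^-1).
      exact: (maps_comp ra4 (maps_comp ra4 y0y gst) (maps_inv ra4 y0i y0y)).
    have [v vV E] := y0st _ g1st.
    have g1v : g1 * cperm T v = cperm T v * g1.
      have va : v \in lgrp a by rewrite aV.
      have vc : v \in lgrp c by rewrite cV.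
      by rewrite /g1 -mulgA (weval_central _ cphi3 vc) mulgA (weval_central _ cphi2 va) mulgA.
    have E' : weval W L * cperm T w = cperm T v.
      apply: (mulgI g1); rewrite g1v -E mulgVK //.
    have L0 : L = 0.
      apply: contrapT => L0; apply: (brit (w := v * w^-1) rW); first by lia.
      by rewrite cpermM cpermV -E' mulgK.
    split=> //; move: E'; rewrite L0 /= mul1g => /(@cperm_inj _ _ T) ->.
    by rewrite cV.
have [s5 [ts5 es5]] := extend_total some_letter hk enP hb vP5 gP5.
have [ra5 sw5 _] := ts5.
have es54 : extends P4 s5 by move=> d u v uv; apply: es5; left.
have [es5P xy05 y0y5 ze5 _] := moves s5 ts5 es54.
apply: (H ts5 es5P).
have yz5 : maps s5 (q m3) (clet a) z.
  move=> i; exists i; apply: es5.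
  have [ni|fi] := pselect (nonfree x0 c (q 0 i)); last first.
    by right; left; split=> //; exists i.
  left; rewrite (yz_nonfree hk hb eqq eza frP ni).
  have [w [cw w1 wi]] := (frP i).1 ni.
  apply: (validN vP4); exists w; rewrite ac; split=> //.
  by rewrite -(eza w i cw) wi.
exists (h * (weval (fun j => (phi2 j, a)) m2 * weval (fun j => (phi3 j, c)) m3) *
    clet a * (weval (fun j => (phi1 j, c)) m1)^-1).
exact: (maps_comp ra5 (maps_comp ra5 (maps_comp ra5 xy05 y0y5) yz5) ze5).
Qed.

End Step.

Lemma meet_base P (x : 'I_k -> U) : valid P -> good P -> injective x ->
  exists s, [/\ total s, extends P s & meets_base s x].
Proof.
move=> vP gP xi; apply: contrapT => ns; apply: (connect_absurd vP gP xi) => s ts es cs.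
by apply: ns; exists s.
Qed.

End Connect.

Local Open Scope card_scope.
Local Open Scope group_scope.

(** * Actions in the space *)

Lemma card_nat_bij (X : Type) : [set: X] #= [set: nat] ->
  exists f : X -> nat, bijective f.
Proof. by move=> /card_set_bijP[f]; rewrite setTT_bijective; exists f. Qed.

Lemma infinite_avoid (X : choiceType) (F : seq X) : [set: X] #= [set: nat] ->
  exists x, x \notin F.
Proof.
move=> /card_nat_bij[f [g fK gK]]; apply: contrapT => nx.
have inF n : g n \in F by apply/negPn/negP => gF; apply: nx; exists (g n).
suff : size [seq g n | n <- iota 0 (size F).+1] <= size F.
  by rewrite size_map size_iota ltnn.
apply: uniq_leq_size; last by move=> y /mapP[n _ ->].
by rewrite map_inj_uniq ?iota_uniq //; exact: can_inj gK.
Qed.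

Section StandardBase.
Variables (k : nat) (U : choiceType).
Hypothesis hU : [set: U] #= [set: nat].

Let V : countType := ('I_k + nat * 'S_k)%type.

Let actV (v : V) (w : 'S_k) : V :=
  match v with inl i => inl (w i) | inr (n, x) => inr (n, x * w) end.

Lemma standard_base : exists (x0 : U -> 'S_k -> U) e, base x0 e.
Proof.
have cV : [set: V] #= [set: nat].
  apply: eq_card_nat => [|/finite_seqP[s sV]]; first exact: countableP.
  pose h n : V := inr (n, 1).
  suff : size [seq h n | n <- iota 0 (size s).+1] <= size s.
    by rewrite size_map size_iota ltnn.
  apply: uniq_leq_size.
    by rewrite map_inj_uniq ?iota_uniq // => m n [].
  by move=> y _; have : [set` s] y by rewrite -sV.
have [f [f' fK f'K]] := card_nat_bij hU.
have [g [g' gK g'K]] := card_nat_bij cV.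
pose phi u := g' (f u); pose psi v := f' (g v).
have phiK : cancel phi psi by move=> u; rewrite /psi /phi g'K fK.
have psiK : cancel psi phi by move=> v; rewrite /psi /phi f'K gK.
exists (fun u w => psi (actV (phi u) w)), (fun i => psi (inl i)); split.
- move=> u; rewrite -[RHS]phiK; congr psi; case: (phi u) => [i|[n x]] /=.
    by rewrite perm1.
  by rewrite mulg1.
- move=> u v w; congr psi; rewrite psiK; case: (phi u) => [i|[n x]] /=.
    by rewrite permM.
  by rewrite mulgA.
- by move=> i j /(can_inj psiK)[].
- by move=> w i; rewrite psiK.
- move=> u w; rewrite -(phiK u); case: (phi u) => [i|[n x]] nu.
    by case: (nu i).
  rewrite psiK /= => /(can_inj psiK)[] /= /eqP; rewrite -{2}(mulg1 x) => /eqP.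
  by apply: mulgI.
- move=> F; pose ns := [seq (match phi u with inl _ => 0 | inr (n, _) => n end) | u <- F].
  exists (psi (inr ((\max_(n <- ns) n).+1, 1))); split=> [i /(can_inj psiK)//|w].
  rewrite psiK /= mul1g; apply/negP => uF.
  have : (\max_(n <- ns) n).+1 \in ns.
    by apply/mapP; exists (psi (inr ((\max_(n <- ns) n).+1, w))); rewrite // psiK.
  move=> nin; have := @leq_bigmax_seq _ _ xpredT id _ nin isT.
  by rewrite ltnn.
Qed.

End StandardBase.

Section Space.
Variables (k : nat) (D : {set {group 'S_k}}).
Variable T : {W : {group 'S_k} | W \in D} -> finType.
Hypothesis hk : k = 2 \/ k = 3.
Hypothesis hD : docile_representatives D.
Hypothesis hT : forall W, (2 <= #|T W|)%N.
Variable U : choiceType.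
Hypothesis hU : [set: U] #= [set: nat].
Notation A := (letter T).
Notation G := (completion T).
Notation word := (word T).
Notation partial := (partial T U).
Implicit Types (P Q : partial) (W : word) (a c : A) (u v : U) (w : 'S_k).

Let a0 : A := some_letter hT hD hk.
Let dm := representatives_docile hD.

Lemma enumerate : exists en : nat -> U, forall u, exists n, en n = u.
Proof. by have [f [g fK gK]] := card_nat_bij hU; exists g => u; exists (f u). Qed.

Lemma completion_britton W L w : reduced W L -> 0 < L -> weval W L <> cperm T w.
Proof.
have [x0 [e hb]] := standard_base k hU; have [en enP] := enumerate.
exact: (britton a0 hk enP hb dm).
Qed.

Lemma completion_torsion (g : G) n : 0 < n -> g ^+ n = 1 ->
  exists h w, g ^ h = cperm T w.
Proof. exact: (torsion a0 completion_britton). Qed.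

Section Dense.
Variables (x0 : U -> 'S_k -> U) (e : 'I_k -> U).
Hypothesis hb : base x0 e.
Notation total := (total_action (T := T) x0).
Notation valid := (valid x0).
Notation good := (good x0).

Lemma connected_transitive (s : U -> G -> U) : total s ->
  (forall x, injective x -> meets_base e s x) -> sharply_transitive k s.
Proof.
move=> [ra sw ss] cs.
have norm (x : 'I_k -> U) : injective x -> exists g, forall i, s (x i) g = e i.
  move=> xi; have [g /choice[f fP]] := cs x xi.
  have fi : injective f.
    by move=> i j fij; apply/xi/(ract_inj ra (g := g)); rewrite /= !fP fij.
  exists (g * cperm T (perm fi)^-1) => i.
  rewrite (ractM ra) fP sw -(base_eq hb); congr e.
  by rewrite -[f i](permE fi) permK.
move=> x y xi yi; have [g gP] := norm x xi; have [h hP] := norm y yi.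
exists (g * h^-1); split=> [i|g' g'P].
  by rewrite (ractM ra) gP -hP (ractK ra).
have : g * h^-1 * g'^-1 = 1.
  apply: (ss _ x xi) => i.
  by rewrite !(ractM ra) gP -hP (ractK ra) -g'P (ractK ra).
by move=> /eqP; rewrite divg_eq1 => /eqP.
Qed.

Lemma transitive_extension P : valid P -> good P ->
  exists s, [/\ total s, extends P s & sharply_transitive k s].
Proof.
move=> vP gP; have [en enP] := enumerate.
pose tup n : option ('I_k -> U) :=
  omap (fun t : {ffun 'I_k -> nat} => fun i => en (t i)) (unpickle n).
(* Quantifying over all actions that extend [Q] makes the requirement persist through later
   stages. *)
pose task n Q := forall x, tup n = Some x -> injective x -> exists g,
  forall s, right_action s -> (forall u w, s u (cperm T w) = x0 u w) ->
  extends Q s -> maps s x g e.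
have step n Q : valid Q -> good Q ->
    exists R, [/\ valid R, good R, sub_partial Q R & task n R].
  move=> vQ gQ; case en': (tup n) => [x|]; last first.
    by exists Q; split=> // x; rewrite /task en'.
  have [xi|nxi] := pselect (injective x); last first.
    by exists Q; split=> // y; rewrite en' => -[<-].
  have [s [ts es [g gx]]] := meet_base hT hD hk enP completion_britton hb vQ gQ xi.
  have [R [vR gR QR Rs RS]] :=
    finite_part hk completion_britton hb [seq (x i, g) | i <- enum 'I_k] ts vQ es.
  exists R; split=> // y; rewrite en' => -[<-] _; exists g => s' ra' sw' es' i.
  have [j ej] := gx i; exists j; rewrite -ej.
  by apply: (RS s' ra' sw' es' (x i, g)); apply: map_f; rewrite mem_enum.
have [s [ts es sQ]] := chain a0 hk enP hb step vP gP.
exists s; split=> //; apply: connected_transitive => // x xi.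
have /choice[f fP] (i : 'I_k) : exists n, en n = x i by exact: enP.
have [Q [_ _ eQ Qt]] := sQ (pickle [ffun i => f i]).
have [ra sw _] := ts.
have [||g gP'] := Qt x; last by exists g; exact: gP'.
- by rewrite /tup pickleK /=; congr Some; apply/funext => i; rewrite ffunE fP.
- exact: xi.
Qed.

Lemma conjugate_fixed (s : U -> G -> U) g n : total s -> 0 < n -> g <> 1 ->
  g ^+ n = 1 -> exists h w, [/\ w <> 1, w ^+ n = 1, g ^ h = cperm T w &
    forall u, s u g = u <-> x0 (s u h) w = s u h].
Proof.
move=> [ra sw ss] n0 g1 gn; have [h [w hw]] := completion_torsion n0 gn.
exists h, w; split=> //.
- by move=> w1; apply: g1; apply/eqP; rewrite -(conjg_eq1 _ h) hw w1 cperm1.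
- have cX m : cperm T (w ^+ m) = cperm T w ^+ m.
    by elim: m => [|m IH]; rewrite ?cperm1 // !expgS cpermM IH.
  apply: (@cperm_inj _ _ T); rewrite cX -hw -conjXg gn conj1g cperm1 //.
- move=> u; rewrite -sw -hw; split=> [ug|]; first exact: ractJ.
  by rewrite conjgE !(ractM ra) (ractK ra) => /(ract_inj ra).
Qed.

(** Torsion is conjugate into S_k, so fixed points are counted in [x0]: only natural points can be
    fixed, and only by a permutation fixing their index, which occurs exactly for transpositions
    when [k = 3]. *)
Lemma total_in_space (s : U -> G -> U) : total s ->
  [/\ right_action s, sharp k s,
     k = 2 -> forall g, has_order 2 g -> forall u, s u g <> u
   & k = 3 -> (forall g, has_order 2 g -> exists! u, s u g = u) /\
     (forall g, has_order 3 g -> forall u, s u g <> u)].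
Proof.
move=> ts; have [ra sw ss] := ts.
have base_fixed w u : w <> 1 -> x0 u w = u -> exists2 i, u = e i & w i = i.
  move=> w1 uw; have [[i ui]|nu] := pselect (exists i, u = e i); last first.
    by case: w1; apply: (base_reg hb _ uw) => i ui; apply: nu; exists i.
  by exists i => //; apply: (base_inj hb); rewrite (base_eq hb) -ui.
split=> //.
- move=> k2 g [_ g2 gm] u ug.
  have [h [w [w1 _ _ /(_ u)[/(_ ug) uw _]]]] :=
    conjugate_fixed ts (isT : 0 < 2) (gm 1%N isT) g2.
  have [i _ wi] := base_fixed _ _ w1 uw.
  by have [k3 _] := fixed_square hk w1 wi; move: k3; rewrite k2.
- move=> k3; split=> g [_ gn gm].
    have [h [w [w1 w2 _ wu]]] := conjugate_fixed ts (isT : 0 < 2) (gm 1%N isT) gn.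
    have [i wi] := odd_perm_fix hk k3 (square_odd hk w1 w2).
    exists (s (e i) h^-1); split.
      by apply/wu; rewrite (ractKV ra) -(base_eq hb) wi.
    move=> u /wu uw; rewrite (fix_unique hb hk w1 (u := e i) (v := s u h)) ?(ractK ra) //.
    by rewrite -(base_eq hb) wi.
  move=> u ug; have [h [w [w1 w3 _ /(_ u)[/(_ ug) uw _]]]] :=
    conjugate_fixed ts (isT : 0 < 3) (gm 1%N isT) gn.
  have [i _ wi] := base_fixed _ _ w1 uw; have [_ ww] := fixed_square hk w1 wi.
  by apply: w1; rewrite -w3 !expgS expg0 mulg1 ww mulg1.
Qed.

End Dense.

Lemma perm_fix_unique (v w : 'S_k) i : v <> 1 -> w <> 1 -> v i = i -> w i = i -> v = w.
Proof.
move=> v1 w1 vi wi; apply/permP => j.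
have [->|ji] := pselect (j = i); first by rewrite vi wi.
have mv (x : 'S_k) : x <> 1 -> x i = i -> x j <> i /\ x j <> j.
  move=> x1 xi; split; first by rewrite -xi => /perm_inj.
  by move=> xj; apply: ji; exact: (perm_fix2 hk x1).
have [vji vjj] := mv v v1 vi; have [wji wjj] := mv w w1 wi.
by case: (ord3_cases hk (w j) (nesym ji) (nesym vji) (nesym vjj)) => // ->.
Qed.

Lemma fixing_perm i : k = 3 -> exists2 w : 'S_k, w <> 1 & w i = i.
Proof.
move=> k3; have [j [l [ji li jl]]] : exists j l : 'I_k, [/\ j <> i, l <> i & j <> l].
  move: i; rewrite k3 => i.
  exists (ordS i), (ordS (ordS i)); case: i => [[|[|[|//]]] i3]; split=> // /(congr1 val) /=.
exists (tperm j l); last by rewrite tpermD //; apply/eqP.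
by move=> /permP/(_ j); rewrite tpermL perm1 => /nesym.
Qed.

Lemma has_order_cperm n (w : 'S_k) : (0 < n)%N -> w ^+ n = 1 ->
  (forall m, (0 < m < n)%N -> w ^+ m <> 1) -> has_order n (cperm T w).
Proof.
move=> n0 wn wm.
have cX m : cperm T w ^+ m = cperm T (w ^+ m).
  by elim: m => [|m IH]; rewrite ?cperm1 // !expgS IH cpermM.
split=> //; first by rewrite cX wn cperm1.
by move=> m /wm h; rewrite cX -(cperm1 T) => /(@cperm_inj _ _ T).
Qed.

(** For [k = 2] all orbits of S_2 are regular, and any of them serves as the natural one. For
    [k = 3], [e i] is the fixed point of the transposition fixing [i]; these points differ because
    the product of two distinct transpositions has order 3 and fixes nothing. *)
Lemma space_base (s : U -> G -> U) : right_action s -> sharp k s ->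
  (k = 2 -> forall g, has_order 2 g -> forall u, s u g <> u) ->
  (k = 3 -> (forall g, has_order 2 g -> exists! u, s u g = u) /\
     (forall g, has_order 3 g -> forall u, s u g <> u)) ->
  exists e, base (fun u w => s u (cperm T w)) e /\
    total_action (fun u w => s u (cperm T w)) s.
Proof.
move=> ra ss s2 s3; pose x0 u w := s u (cperm T w).
have ts : total_action x0 s by [].
have x01 u : x0 u 1 = u by rewrite /x0 cperm1 (ract1 ra).
have x0M u (v w : 'S_k) : x0 u (v * w) = x0 (x0 u v) w.
  by rewrite /x0 cpermM (ractM ra).
have inv_order (w : 'S_k) : w <> 1 -> w * w = 1 -> has_order 2 (cperm T w).
  move=> w1 ww; apply: has_order_cperm => // m; rewrite ?expg2 //.
  by case: m => [|[|m]] //; rewrite expg1.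
have infin e (F : seq U) : exists u, (forall i : 'I_k, u <> e i) /\ forall w, x0 u w \notin F.
  have [u uF] := infinite_avoid (codom e ++ [seq x0 v w | v <- F, w <- enum 'S_k]) hU.
  exists u; split=> [i ui|w]; first by move: uF; rewrite mem_cat ui codom_f.
  apply/negP => wF; move: uF; rewrite mem_cat negb_or => /andP[_ /negP]; apply.
  apply/allpairsP; exists (x0 u w, w^-1); split=> //; first by rewrite mem_enum inE.
  by rewrite /= -x0M mulgV x01.
suff [e [ei ee er]] : exists e : 'I_k -> U, [/\ injective e,
    forall w i, e (w i) = x0 (e i) w &
    forall u w, (forall i, u <> e i) -> x0 u w = u -> w = 1].
  by exists e; split=> //; split.
case: (hk) => [k2|k3].
  have nofix (w : 'S_k) i : w i = i -> w = 1.
    move=> wi; apply: contrapT => w1; have [k3 _] := fixed_square hk w1 wi.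
    by move: k3; rewrite k2.
  have free u (w : 'S_k) : x0 u w = u -> w = 1.
    move=> uw; apply: contrapT => w1; apply: (s2 k2 (cperm T w) _ u uw).
    apply: inv_order => //.
    have [i wi] : exists i, w i <> i.
      apply: contrapT => nw; apply: w1; apply/permP => i; rewrite perm1.
      by apply: contrapT => wi; apply: nw; exists i.
    have /nofix ww : (w * w) i = i.
      apply: contrapT; rewrite permM => wwi.
      have : (2 < #|'I_k|)%N.
        apply/card_gt2P; exists i, (w i), (w (w i)); split; split=> //; apply/eqP.
        + exact: nesym.
        + by move=> /esym/perm_inj.
        + by [].
      by rewrite card_ord k2.
    exact: ww.
  have [i0 _] := ord_pair hk; have [en _] := enumerate; have p := en 0.
  exists (fun i => x0 p (tperm i0 i)); split.
  - move=> i j pij; rewrite -(tpermL i0 i) -(tpermL i0 j).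
    congr (fun w : 'S_k => w i0); apply/eqP; rewrite -divg_eq1; apply/eqP.
    by apply: (free p); rewrite x0M pij -x0M mulgV x01.
  - move=> w i; rewrite -x0M; congr (x0 p _).
    apply/eqP; rewrite -divg_eq1; apply/eqP; apply: (nofix _ i0).
    by rewrite permM tpermL -[RHS](permK (tperm i0 i * w) i0) [(_ * w) i0]permM tpermL.
  - by move=> u w _; exact: free.
have [inv ord3] := s3 k3.
have /choice[sg sgP] (i : 'I_k) : exists w : 'S_k, w <> 1 /\ w i = i.
  by have [w w1 wi] := fixing_perm i k3; exists w.
have sgo i : has_order 2 (cperm T (sg i)).
  have [w1 wi] := sgP i; apply: inv_order => //.
  by have [] := fixed_square hk w1 wi.
have /choice[e eP] i : exists u, x0 u (sg i) = u /\ forall v, x0 v (sg i) = v -> u = v.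
  by have [u [uf uu]] := inv _ (sgo i); exists u.
have no3 (w : 'S_k) u : w <> 1 -> ~~ odd_perm w -> x0 u w <> u.
  move=> w1 ew; have [_ w3 _] := alt_gen hk w1 ew; apply: ord3.
  apply: has_order_cperm => //; first by rewrite -w3 expg_order.
  move=> m /andP[m0 m3] /eqP; rewrite -order_dvdn w3 => /(dvdn_leq m0).
  by rewrite leqNgt m3.
have sg_odd i : odd_perm (sg i).
  have [w1 wi] := sgP i; apply: (square_odd hk) => //.
  by have [] := fixed_square hk w1 wi.
exists e; split.
- move=> i j eij; apply: contrapT => ij.
  apply: (no3 (sg i * sg j) (e i)).
  + move=> /(congr1 (fun w => w * (sg j)^-1)); rewrite mulgK mul1g => e1.
    have [w1 wi] := sgP i; have [v1 vj] := sgP j.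
    apply: ij; apply: (perm_fix2 hk w1 wi); rewrite e1.
    by rewrite -[RHS](permK (sg j) j) vj.
  + by rewrite odd_permM !sg_odd.
  + by rewrite x0M (eP i).1 eij (eP j).1.
- move=> w i; apply: (eP (w i)).2.
  have -> : sg (w i) = sg i ^ w.
    have [w1 wi] := sgP i; have [v1 vi] := sgP (w i).
    apply: (perm_fix_unique v1 _ vi).
      by move=> /eqP; rewrite conjg_eq1 => /eqP.
    by rewrite conjgE !permM permK wi.
  by rewrite -x0M conjgE mulVKg x0M (eP i).1.
- move=> u w nu uw; apply: contrapT => w1.
  have [ow|ew] := boolP (odd_perm w); last exact: no3 uw.
  have [i wi] := odd_perm_fix hk k3 ow; apply: (nu i).
  have [v1 vi] := sgP i; apply/esym/(eP i).2.
  by rewrite -(perm_fix_unique w1 v1 wi vi).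
Qed.

End Space.

(** * Abelian normal subgroups *)

Section SharplyTwoTransitive.
Variables (G : groupType) (V : Type) (s : V -> G -> V) (H N : set G) (X : set V).
Hypothesis ra : right_action s.
Hypothesis sH : subgroup H.
Hypothesis HX : forall p h, X p -> H h -> X (s p h).
Hypothesis trH : forall p q p' q', X p -> X q -> p <> q -> X p' -> X q' -> p' <> q' ->
  exists2 h, H h & s p h = p' /\ s q h = q'.
Hypothesis shH : forall h p q, H h -> X p -> X q -> p <> q ->
  s p h = p -> s q h = q -> h = 1.
Variables p1 p2 : V.
Hypothesis (Xp1 : X p1) (Xp2 : X p2) (p12 : p1 <> p2).
Hypothesis nN : normal_in N H.
Hypothesis aN : abelian_set N.
Variable n0 : G.
Hypothesis (Nn0 : N n0) (n01 : n0 <> 1).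

Let sN : subgroup N. Proof. by case: nN. Qed.
Let N1 : N 1. Proof. by case: sN. Qed.
Let NM x y : N x -> N y -> N (x * y). Proof. by case: sN => _ NM _; exact: NM. Qed.
Let NV x : N x -> N x^-1. Proof. by case: sN => _ _; exact. Qed.
Let NH x : N x -> H x. Proof. by case: nN => _ NH _; exact: NH. Qed.
Let NJ x h : N x -> H h -> N (x ^ h). Proof. by case: nN => _ _; exact. Qed.
Let HM x y : H x -> H y -> H (x * y). Proof. by case: sH => _ HM _; exact: HM. Qed.

(** [n0] moves some [p0]; a conjugating element carries the pair of [p0] and its image to [p] and
    [q]. *)
Lemma normal_transitive p q : X p -> X q -> exists2 n, N n & s p n = q.
Proof.
move=> Xp Xq; have [<-|pq] := pselect (p = q); first by exists 1; rewrite ?(ract1 ra).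
have [p0 Xp0 mp0] : exists2 p0, X p0 & p0 <> s p0 n0.
  apply: contrapT => nm; apply: n01.
  have fixn p' : X p' -> s p' n0 = p'.
    by move=> Xp'; apply: contrapT => ne; apply: nm; exists p' => // /esym.
  by apply: (shH (NH Nn0) Xp1 Xp2 p12); exact: fixn.
have [h Hh [hp hq]] := trH Xp0 (HX Xp0 (NH Nn0)) mp0 Xp Xq pq.
exists (n0 ^ h); first exact: NJ.
by rewrite conjgE !(ractM ra) -hp (ractK ra).
Qed.

Lemma normal_regular n p : N n -> X p -> s p n = p -> n = 1.
Proof.
move=> Nn Xp pn.
have fixall q : X q -> s q n = q.
  move=> Xq; have [m Nm <-] := normal_transitive Xp Xq.
  by rewrite -(ractM ra) (aN Nm Nn) (ractM ra) pn.
by apply: (shH (NH Nn) Xp1 Xp2 p12); exact: fixall.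
Qed.

Lemma normal_moves n p : N n -> n <> 1 -> X p -> p <> s p n.
Proof. by move=> Nn n1 Xp /esym/(normal_regular Nn Xp). Qed.

Lemma normal_eq n m p : N n -> N m -> X p -> s p n = s p m -> n = m.
Proof.
move=> Nn Nm Xp e; apply/eqP; rewrite -divg_eq1; apply/eqP.
apply: (@normal_regular _ p) => //; first by apply: NM => //; exact: NV.
by rewrite (ractM ra) e (ractK ra).
Qed.

Lemma normal_conjugate n m : N n -> N m -> n <> 1 -> m <> 1 ->
  exists2 h, H h & n ^ h = m.
Proof.
move=> Nn Nm n1 m1.
have [h Hh [h1 h2]] := trH Xp1 (HX Xp1 (NH Nn)) (normal_moves Nn n1 Xp1)
  Xp1 (HX Xp1 (NH Nm)) (normal_moves Nm m1 Xp1).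
exists h => //; apply: (normal_eq (p := p1)) => //; first exact: NJ.
by rewrite conjgE !(ractM ra) -{1}h1 (ractK ra).
Qed.

(** Let [n] in [N] agree with [i] at [p1]; then [i] inverts [n]. If [n * n] were non-trivial it
    would be conjugate to [n], giving a square root [b] of [n] that [i] also inverts, and [i] would
    fix the image of [p1] under [b]. So [n] has square 1, agrees with [i] at two points, and equals
    it. *)
Lemma free_involution (i : G) : H i -> i * i = 1 -> (forall p, X p -> s p i <> p) ->
  N i /\ forall n, N n -> n * n = 1.
Proof.
move=> Hi ii fi; have iV : i^-1 = i by exact: mulg1_eq.
have Xi := HX Xp1 Hi; have [n Nn pn] := normal_transitive Xp1 Xi.
have n1 : n <> 1 by move=> n1; apply: (fi p1 Xp1); rewrite -pn n1 (ract1 ra).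
have ni : n ^ i = n^-1.
  apply: (normal_eq (p := s p1 i)) => //; [exact: NJ|exact: NV|].
  by rewrite conjgE !(ractM ra) (ractK ra) pn -(ractM ra) ii (ract1 ra) -pn (ractK ra).
have nn : n * n = 1.
  apply: contrapT => nn1.
  have [g Hg gn] := normal_conjugate (NM Nn Nn) Nn nn1 n1.
  pose b := n ^ g; have Nb : N b by exact: NJ.
  have bb : b * b = n by rewrite -gn conjMg.
  have bi : b ^ i = b^-1.
    have Nbi : N (b ^ i) by exact: NJ.
    pose c := b ^ i * b; have Nc : N c by exact: NM.
    (* Hence [c] is trivial or conjugate to [n], and the latter would give [n * n = 1]. *)
    have cc : c * c = 1.
      have -> : c * c = (b ^ i * b ^ i) * (b * b).
        have E (y z : G) : z * y = y * z -> y * z * (y * z) = y * y * (z * z).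
          by move=> zy; rewrite -!mulgA; congr (_ * _); rewrite mulgA zy -mulgA.
        by apply: E; exact: aN.
      by rewrite -conjMg bb ni mulVg.
    have [c1|c1] := pselect (c = 1).
      by apply/esym/mulg1_eq; rewrite (aN Nb Nbi).
    have [h _ ch] := normal_conjugate Nc Nn c1 n1.
    by case: nn1; rewrite -ch -conjMg cc conj1g.
  apply: (fi (s p1 b)); first exact: HX (NH Nb).
  have -> : s (s p1 b) i = s (s p1 i) (b ^ i).
    by rewrite conjgE !(ractM ra) (ractK ra).
  by rewrite bi -pn -bb (ractM ra) (ractK ra).
have ein : i = n.
  have : i * n^-1 = 1.
    have Hm : H (i * n^-1) by apply: HM => //; apply: NH; exact: NV.
    apply: (shH Hm Xp1 Xi); first by move=> /esym; exact: fi.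
      by rewrite (ractM ra) -pn (ractK ra).
    have nV : n^-1 = n by exact: mulg1_eq.
    by rewrite nV (ractM ra) -(ractM ra p1) ii (ract1 ra).
  by move=> /eqP; rewrite divg_eq1 => /eqP.
split; first by rewrite ein.
move=> m Nm; have [->|m1] := pselect (m = 1); first by rewrite mulg1.
by have [h _ <-] := normal_conjugate Nn Nm n1 m1; rewrite -conjMg nn conj1g.
Qed.

(** The element of [N] that agrees with [t] at [p1] commutes with [i] too, so both agree at the
    image of [p1] under [i] and are equal. *)
Lemma free_involution_centre (i t : G) : H i -> i * i = 1 ->
  (forall p, X p -> s p i <> p) -> H t -> i * t = t * i -> t * t = 1.
Proof.
move=> Hi ii fi Ht it; have [Ni N2] := free_involution Hi ii fi.
have [n Nn pn] := normal_transitive Xp1 (HX Xp1 Ht).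
suff -> : t = n by exact: N2.
have : t * n^-1 = 1.
  have Hm : H (t * n^-1) by apply: HM => //; apply: NH; exact: NV.
  have f1 : s p1 (t * n^-1) = p1 by rewrite (ractM ra) -pn (ractK ra).
  apply: (shH Hm Xp1 (HX Xp1 Hi)) => //; first by move=> /esym; exact: fi.
  rewrite -(ractM ra) mulgA it -mulgA (aN Ni (NV Nn)) mulgA (ractM ra) f1 //.
by move=> /eqP; rewrite divg_eq1 => /eqP.
Qed.

(** An involution fixing [p] inverts [N]. The product [i * j] then centralises [N] and fixes [p],
    hence fixes every translate of [p] by [N]. *)
Lemma fixing_involution_unique (i j : G) p : X p -> H i -> H j -> i <> 1 -> j <> 1 ->
  i * i = 1 -> j * j = 1 -> s p i = p -> s p j = p -> i = j.
Proof.
move=> Xp Hi Hj i1 j1 ii jj pi pj.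
have E u n g : s (s u n) g = s (s u g) (n ^ g) by rewrite conjgE !(ractM ra) (ractK ra).
have inverts x n : H x -> x <> 1 -> x * x = 1 -> s p x = p -> N n -> n ^ x = n^-1.
  move=> Hx x1 xx px Nn; have xV : x^-1 = x by exact: mulg1_eq.
  have Nnx : N (n ^ x) by exact: NJ.
  pose m := n * n ^ x; have Nm : N m by exact: NM.
  have mx : m ^ x = m by rewrite conjMg -conjgM xx conjg1 (aN Nnx Nn).
  suff m1 : m = 1 by apply/esym/mulg1_eq.
  apply: (normal_regular Nm Xp); apply: contrapT => mp; apply: x1.
  apply: (shH Hx Xp (HX Xp (NH Nm)) (nesym mp) px).
  by rewrite E mx px.
have cent n : N n -> n ^ (i * j) = n.
  move=> Nn; rewrite conjgM (inverts i) // (inverts j) ?invgK //; exact: NV.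
have : i * j = 1.
  have fp : s p (i * j) = p by rewrite (ractM ra) pi pj.
  apply: (shH (HM Hi Hj) Xp (HX Xp (NH Nn0)) (normal_moves Nn0 n01 Xp) fp).
  by rewrite E cent // fp.
by move=> /mulg1_eq ij; apply: invg_inj; rewrite ij (mulg1_eq jj).
Qed.

End SharplyTwoTransitive.

Lemma index2 k : k = 2 -> exists i j : 'I_k, i <> j /\ forall l, l = i \/ l = j.
Proof.
move=> ->; exists ord0, ord_max; split=> // -[[|[|//]] l2]; [left|right]; exact: val_inj.
Qed.

Lemma index3 k : k = 3 -> exists i j l : 'I_k, [/\ i <> j, i <> l, j <> l &
  forall m, [\/ m = i, m = j | m = l]].
Proof.
move=> ->; exists ord0, (Ordinal (isT : 1 < 3)), ord_max; split=> // -[[|[|[|//]]] m3].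
- by constructor 1; exact: val_inj.
- by constructor 2; exact: val_inj.
- by constructor 3; exact: val_inj.
Qed.

Section Tuples.
Variables (k : nat) (G : groupType) (V : Type) (s : V -> G -> V).
Hypothesis tr : sharply_transitive k s.
Hypothesis ra : right_action s.

Lemma transitive_pair p q p' q' : k = 2 -> p <> q -> p' <> q' ->
  exists! g, s p g = p' /\ s q g = q'.
Proof.
move=> k2 pq pq'; have [i [j [ij ijP]]] := index2 k2.
pose x (p q : V) l := if l == i then p else q.
have xi a b : a <> b -> injective (x a b).
  move=> ab l m; rewrite /x; case: (ijP l) => ->; case: (ijP m) => -> //;
    rewrite ?eqxx; case: eqP => // _ /esym //; by [].
have [g [gP gu]] := tr (xi _ _ pq) (xi _ _ pq').
have ji : (j == i) = false by apply/eqP; exact: nesym.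
exists g; split=> [|h [h1 h2]].
  by have := gP i; have := gP j; rewrite /x eqxx ji.
by apply: gu => l; rewrite /x; case: (ijP l) => ->; rewrite ?eqxx ?ji.
Qed.

Lemma transitive_triple p q r p' q' r' : k = 3 -> p <> q -> p <> r -> q <> r ->
  p' <> q' -> p' <> r' -> q' <> r' ->
  exists! g, [/\ s p g = p', s q g = q' & s r g = r'].
Proof.
move=> k3 pq pr qr pq' pr' qr'; have [i [j [l [ij il jl ijl]]]] := index3 k3.
pose x (p q r : V) m := if m == i then p else if m == j then q else r.
have ji : (j == i) = false by apply/eqP; exact: nesym.
have li : (l == i) = false by apply/eqP; exact: nesym.
have lj : (l == j) = false by apply/eqP; exact: nesym.
have xi a b c : a <> b -> a <> c -> b <> c -> injective (x a b c).
  move=> ab ac bc m n; rewrite /x; case: (ijl m) => ->; case: (ijl n) => ->;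
    rewrite ?eqxx ?ji ?li ?lj //; by move=> /esym.
have [g [gP gu]] := tr (xi _ _ _ pq pr qr) (xi _ _ _ pq' pr' qr').
exists g; split=> [|h [h1 h2 h3]].
  by have := gP i; have := gP j; have := gP l; rewrite /x ?eqxx ?ji ?li ?lj.
by apply: gu => m; rewrite /x; case: (ijl m) => ->; rewrite ?eqxx ?ji ?li ?lj.
Qed.

Lemma fix_triple p q r g : k = 3 -> p <> q -> p <> r -> q <> r ->
  s p g = p -> s q g = q -> s r g = r -> g = 1.
Proof.
move=> k3 pq pr qr pg qg rg.
have [h [_ hu]] := transitive_triple k3 pq pr qr pq pr qr.
by rewrite -(hu g) // (hu 1) // !(ract1 ra).
Qed.

Lemma fix_pair p q g : k = 2 -> p <> q -> s p g = p -> s q g = q -> g = 1.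
Proof.
move=> k2 pq pg qg; have [h [_ hu]] := transitive_pair k2 pq pq.
by rewrite -(hu g) // (hu 1) // !(ract1 ra).
Qed.

End Tuples.

(** * The completion is non-split *)

Section NonSplit.
Variables (k : nat) (D : {set {group 'S_k}}).
Variable T : {W : {group 'S_k} | W \in D} -> finType.
Hypothesis hk : k = 2 \/ k = 3.
Hypothesis hD : docile_representatives D.
Hypothesis hT : forall W, (2 <= #|T W|)%N.
Variable U : choiceType.
Hypothesis hU : [set: U] #= [set: nat].
Notation A := (letter T).
Notation G := (completion T).

Lemma has_order2 (g : G) : has_order 2 g <-> g <> 1 /\ g * g = 1.
Proof.
split=> [[_ gg /(_ 1%N isT)]|[g1 gg]] //.
by split=> // -[|[|m]].
Qed.

Lemma involution_conj (g : G) : g <> 1 -> g * g = 1 ->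
  exists h w, [/\ g ^ h = cperm T w, w <> 1 & w * w = 1].
Proof.
move=> g1 gg; have [h [w hw]] := completion_torsion hk hD hT hU (isT : 0 < 2) gg.
exists h, w; split=> //.
  by move=> w1; apply: g1; apply/eqP; rewrite -(conjg_eq1 _ h) hw w1 cperm1.
by apply: (@cperm_inj _ _ T); rewrite cpermM -hw -conjMg gg conj1g cperm1.
Qed.

(** An involution generates a docile group, so up to conjugacy it commutes with some stable letter;
    the square of a letter is a reduced word. *)
Lemma involution_centraliser (g : G) : g <> 1 -> g * g = 1 ->
  exists2 t, g * t = t * g & t * t <> 1.
Proof.
move=> g1 gg; have [h [w [hw w1 ww]]] := involution_conj g1 gg.
have dw : docile <[w]>.
  have [i wi] : exists i, w i <> i.
    apply: contrapT => nw; apply: w1; apply/permP => i; rewrite perm1.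
    by apply: contrapT => wi; apply: nw; exists i.
  apply/docileP; exists i => x /cycleP[n ->].
  have ww2 : w ^+ 2 = 1 by rewrite expg2.
  rewrite -(odd_double_half n) expgnDr -mul2n expgnA ww2 expg1n mulg1.
  by case: (odd n) => //; rewrite expg1.
have [r rD] := representative hD dw.
have [a [_ [aV _ _ _]]] := two_letters hT rD.
pose t := clet a ^ (h * cperm T r)^-1; exists t.
  have cwt : cperm T (w ^ r) * clet a = clet a * cperm T (w ^ r).
    by apply: clet_comm; rewrite aV memJ_conjg cycle_id.
  have gE : g = cperm T (w ^ r) ^ (h * cperm T r)^-1.
    rewrite -[LHS](conjgK (h * cperm T r)); congr (_ ^ _).
    by rewrite conjgM hw !conjgE !cpermM cpermV.
  by rewrite {1 2}gE /t -!conjMg cwt.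
rewrite -conjMg => /eqP; rewrite conjg_eq1 => /eqP aa.
apply: (@completion_britton _ _ T hk hD hT U hU (fun _ => (1, a)) 2 1) => //.
  by move=> l _ /esym/linv_neq.
by rewrite /= /lval /= !cperm1 !mul1g.
Qed.

Lemma commuting_involutions (g h : G) : g <> 1 -> h <> 1 -> g * g = 1 -> h * h = 1 ->
  g * h = h * g -> g = h.
Proof.
move=> g1 h1 gg hh gh; apply: contrapT => ngh.
have idM : {morph (id : 'S_k -> 'S_k) : x y / x * y} by [].
have c (t : stable_letter T) w : w \in lgrp (t, false) -> id w * 1 = 1 * id w.
  by rewrite mulg1 mul1g.
have [F FM [Fw _]] := completion_lift idM c.
have oddF x : x <> 1 -> x * x = 1 -> odd_perm (F x).
  move=> x1 xx; have [y [w [xw w1 ww]]] := involution_conj x1 xx.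
  apply: (square_odd hk); last by rewrite -FM xx (morph_one FM).
  move=> Fx; apply: w1; rewrite -[w]Fw -xw conjgE !FM Fx mul1g -FM mulVg.
  exact: morph_one.
have gh1 : g * h <> 1.
  by move=> /mulg1_eq; rewrite (mulg1_eq gg).
have ghgh : g * h * (g * h) = 1 by rewrite {2}gh mulgA -(mulgA g) hh mulg1.
by have := oddF _ gh1 ghgh; rewrite FM odd_permM !oddF.
Qed.

Lemma no_abelian2 : k = 2 -> no_nontrivial_abelian_normal [set: G].
Proof.
move=> k2 N nN aN; apply/seteqP; split=> [n Nn|_ ->]; last by case: nN => -[].
apply: contrapT => n1.
have [x0 [e hb]] := standard_base k hU.
have dm := representatives_docile hD.
have [s [ts _ trs]] := transitive_extension hk hD hT hU hb
  (valid_trivial T hb) (good_trivial T hb dm).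
have [ra sw ss] := ts; have [_ _ /(_ k2) s2 _] := total_in_space hk hD hT hU hb ts.
have [i [j [ij _]]] := index2 k2.
have w1 : tperm i j <> 1 by move=> /permP/(_ i); rewrite tpermL perm1 => /esym.
have g1 : cperm T (tperm i j) <> 1 by rewrite -(cperm1 T) => /(@cperm_inj _ _ T).
have gg : cperm T (tperm i j) * cperm T (tperm i j) = 1.
  by rewrite -cpermM tperm2 cperm1.
have [t gt tt] := involution_centraliser g1 gg.
apply: tt; apply: (@free_involution_centre _ _ s setT N setT ra _ _ _ _
  (e i) (e j) I I _ nN aN n Nn n1 (cperm T (tperm i j))) => //.
- move=> p q p' q' _ _ pq _ _ pq'.
  by have [g [gP _]] := transitive_pair trs k2 pq pq'; exists g.
- by move=> h p q _ _ _; exact: (fix_pair trs ra k2).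
- by move=> /(base_inj hb).
- by move=> p _; apply: s2; exact/has_order2.
Qed.

(** Let [g] be the involution fixing [v] and exchanging [p] and [q]. If it fixes nothing else, its
    centraliser fixes [v] and [free_involution_centre] applies. If it also fixes [u], let [j]
    exchange [v] and [u]: the conjugate of [g] by [j] fixes both points, hence equals [g], and [g],
    [j] are distinct commuting involutions. *)
Lemma no_abelian3 (V : Type) (s : V -> G -> V) : k = 3 ->
  infinite_set [set: V] -> right_action s -> sharply_transitive 3 s ->
  forall v : V, no_nontrivial_abelian_normal (point_stabiliser s v).
Proof.
move=> k3 iV ra; rewrite -[in sharply_transitive 3 s]k3 => trs v N nN aN.
apply/seteqP; split=> [n Nn|_ ->]; last by case: nN => -[].
apply: contrapT => n1.
have other (F : seq V) : exists x, ~ List.In x F.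
  apply: contrapT => nx; apply: iV.
  have -> : [set: V] = [set x | List.In x F].
    by apply/seteqP; split=> // x _; apply: contrapT => xF; apply: nx; exists x.
  elim: F {nx} => [|a F IH].
    by rewrite (_ : [set x | _] = set0) //; apply/seteqP; split.
  have -> : [set x | List.In x (a :: F)] = [set a] `|` [set x | List.In x F].
    by apply/seteqP; split=> x /= [->|]; [left|right|left|right].
  by rewrite finite_setU; split.
have [p pv] := other [:: v]; have [q qvp] := other [:: v; p].
have vp : v <> p by move=> vp; apply: pv; left.
have vq : v <> q by move=> vq; apply: qvp; left.
have pq : p <> q by move=> pq; apply: qvp; right; left.
pose H := point_stabiliser s v; pose X := [set x | x <> v].
have sH : subgroup H.
  split=> [|x y|x]; rewrite /H /point_stabiliser /=.
  - exact: ract1.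
  - by move=> xv yv; rewrite (ractM ra) xv.
  - by move=> xv; rewrite -{1}xv (ractK ra).
have HX x h : X x -> H h -> X (s x h).
  move=> Xx Hh E; apply: Xx; apply: (ract_inj ra (g := h)) => /=.
  by rewrite E Hh.
have trH x y x' y' : X x -> X y -> x <> y -> X x' -> X y' -> x' <> y' ->
    exists2 h, H h & s x h = x' /\ s y h = y'.
  move=> Xx Xy xy Xx' Xy' xy'.
  have [g [[g1 g2 g3] _]] := transitive_triple trs k3 (nesym Xx) (nesym Xy) xy
    (nesym Xx') (nesym Xy') xy'.
  by exists g.
have shH h x y : H h -> X x -> X y -> x <> y -> s x h = x -> s y h = y -> h = 1.
  move=> Hh Xx Xy xy xh yh.
  exact: (fix_triple trs ra k3 (nesym Xx) (nesym Xy) xy Hh xh yh).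
have swap x y z : x <> y -> x <> z -> y <> z -> exists g,
    [/\ s x g = y, s y g = x, s z g = z, g <> 1 & g * g = 1].
  move=> xy xz yz.
  have [g [[g1 g2 g3] _]] := transitive_triple trs k3 xy xz yz (nesym xy) yz xz.
  exists g; split=> //.
    by move=> ge; apply: xy; rewrite -g1 ge (ract1 ra).
  by apply: (fix_triple trs ra k3 xy xz yz); rewrite (ractM ra) ?g1 ?g2 ?g3.
have [g [_ _ gv g1 gg]] := swap p q v pq (nesym vp) (nesym vq).
have [[u Xu ug]|nf] := pselect (exists2 u, X u & s u g = u); last first.
  have fg x : X x -> s x g <> x by move=> Xx xg; apply: nf; exists x.
  have [t gt tt] := involution_centraliser g1 gg.
  apply: tt; apply: (@free_involution_centre _ _ s H N X ra sH HX trH shH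
    p q (nesym vp) (nesym vq) pq nN aN n Nn n1 g t gv gg fg _ gt).
  rewrite /H /point_stabiliser /=; apply: contrapT => tv; apply: (fg _ tv).
  by rewrite -(ractM ra) -gt (ractM ra) gv.
have [r rvu] := other [:: v; u].
have vr : v <> r by move=> vr; apply: rvu; left.
have ur : u <> r by move=> ur; apply: rvu; right; left.
have [j [vj uj _ j1 jj]] := swap v u r (nesym Xu) vr ur.
have jV : j^-1 = j by exact: mulg1_eq.
have gj : g ^ j = g.
  have gjv : s v (g ^ j) = v by rewrite conjgE jV !(ractM ra) vj ug uj.
  have gju : s u (g ^ j) = u by rewrite conjgE jV !(ractM ra) uj gv vj.
  apply: (@fixing_involution_unique _ _ s H N X ra sH HX trH shH
    p q (nesym vp) (nesym vq) pq nN aN n Nn n1 (g ^ j) g u Xu) => //.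
    by move=> /eqP; rewrite conjg_eq1 => /eqP.
  by rewrite -conjMg gg conj1g.
have : g = j.
  apply: commuting_involutions => //.
  by rewrite conjgC gj.
by move=> gej; apply: Xu; rewrite -ug gej uj.
Qed.

Lemma completion_non_split : non_split k G.
Proof.
split=> [|k3]; first exact: no_abelian2.
split=> [|V s iV ra tr]; last exact: no_abelian3.
have [x0 [e hb]] := standard_base k hU.
have dm := representatives_docile hD.
have [s [[ra _ _] _ trs]] := transitive_extension hk hD hT hU hb
  (valid_trivial T hb) (good_trivial T hb dm).
exists U, s; split=> //; last by rewrite -k3.
by apply/infiniteP; move: hU; rewrite card_eq_le => /andP[].
Qed.

End NonSplit.

(** * Finite presentation *)

Section Presentation.
Variables (k : nat) (D : {set {group 'S_k}}).
Variable T : {W : {group 'S_k} | W \in D} -> finType.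
Notation G := (completion T).

Let X : finType := ('S_k + stable_letter T)%type.
Let gp (w : 'S_k) : free_group X := free_gen (inl w : X).
Let gt (t : stable_letter T) : free_group X := free_gen (inr t : X).

Definition presentation_relators : seq (free_group X) :=
  [seq gp v * gp w * (gp (v * w))^-1 | v <- enum 'S_k, w <- enum 'S_k] ++
  [seq [~ gp x.1, gt x.2] |
    x <- enum [pred x : 'S_k * stable_letter T | x.1 \in lgrp (x.2, false)]].

Let R : set (free_group X) := [set r | r \in presentation_relators].

Lemma completion_finitely_presented : finitely_presented G.
Proof.
pose h (x : X) : G := match x with inl w => cperm T w | inr t => cgen t end.
have [phi phiM phih] := free_lift h.
have phiR r : R r -> phi r = 1.
  rewrite /R /= mem_cat => /orP[/allpairsP[[v w] /= [_ _ ->]]|/mapP[[w t]]].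
    by rewrite !phiM (morph_inv phiM) !phih /= cpermM mulgV.
  rewrite mem_enum => /= tw ->.
  rewrite commgEl conjgE !phiM !(morph_inv phiM) !phih /=.
  by rewrite (clet_comm (a := (t, false))) // mulKg mulVg.
have [f fM fphi] := ncl_lift phiM phiR.
pose cl := ncl_class R; have clM : {morph cl : x y / x * y} := @ncl_classM _ R.
have cl1 r : r \in presentation_relators -> cl r = 1.
  move=> rR; rewrite -(morph_one clM); apply/ncl_classP.
  by rewrite invg1 mulg1 => N _; apply.
have gpM : {morph (fun w => cl (gp w)) : v w / v * w}.
  move=> v w; apply/eqP; rewrite eq_sym -divg_eq1; apply/eqP.
  rewrite -clM -(morph_inv clM) -clM; apply: cl1.
  rewrite mem_cat; apply/orP; left; apply/allpairsP; exists (v, w).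
  by rewrite !mem_enum.
have gpt t w : w \in lgrp (t, false) -> cl (gp w) * cl (gt t) = cl (gt t) * cl (gp w).
  move=> tw; have := @cl1 [~ gp w, gt t].
  rewrite mem_cat; have -> : [~ gp w, gt t] \in
      [seq [~ gp x.1, gt x.2] | x <- enum [pred x : 'S_k * stable_letter T |
        x.1 \in lgrp (x.2, false)]].
    by apply/mapP; exists (w, t); rewrite ?mem_enum.
  rewrite orbT => /(_ isT); rewrite commgEl conjgE !clM !(morph_inv clM).
  move=> E; apply/commgP/eqP; rewrite commgEl conjgE; exact: E.
have [psi psiM [psip psit]] := completion_lift gpM gpt.
have fpsi x : f (psi x) = x.
  elim/completion_ind: x => [|x w IH|x [t b] IH].
  - by rewrite (morph_one psiM) (morph_one fM).
  - by rewrite psiM fM IH psip fphi phih.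
  - rewrite psiM fM IH /clet /=; case: b; last by rewrite psit fphi phih.
    by rewrite (morph_inv psiM) (morph_inv fM) psit fphi phih.
have psif q : psi (f q) = q.
  rewrite -(ncl_reprK q) fphi -/(cl _).
  elim/word_ind: (ncl_repr q) => [|x [y b] IH].
    by rewrite (morph_one phiM) (morph_one psiM) (morph_one clM).
  have -> : word_class _ _ [:: (y, b)] = if b then (free_gen y)^-1 else free_gen y :> free_group X.
    by case: b => //; rewrite free_gen_inv.
  rewrite phiM psiM IH clM; congr (_ * _).
  have E : psi (phi (free_gen y)) = cl (free_gen y).
    by rewrite phih; case: y => [w|t] /=; [exact: psip|exact: psit].
  case: b; last exact: E.
  by rewrite (morph_inv phiM) (morph_inv psiM) (morph_inv clM) E.
pose m := isMultiplicative.Build (ncl_quotient R) G f fM.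
pose F : {multiplicative ncl_quotient R -> G} := HB.pack f m.
by exists X, presentation_relators, F; exists psi.
Qed.

End Presentation.

(** * The topology of the space *)

Lemma cvg_initial (S : choiceType) (T : topologicalType) (f : S -> T)
    (F : set_system S) (x : S) : Filter F ->
  (f @ F --> f x) -> F --> (x : initial_topology f).
Proof.
move=> FF fF A [_ [/= [W oW <-] Wx WA]]; apply: filterS WA _.
by apply: fF; exact: open_nbhs_nbhs.
Qed.

Section Space.
Variables (U : choiceType) (G : groupType) (k : nat).
Notation space := (set_type (sharp_actions U G k)).

Definition space_act (s : space) : U -> G -> U := act_of (set_val s).

Lemma space_act_inj (s s' : space) : (forall u g, space_act s u g = space_act s' u g) -> s = s'.
Proof.
move=> E; apply: val_inj; apply: funext => g; apply: val_inj; apply: funext => u.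
exact: E.
Qed.

Definition in_space (a : U -> G -> U) :=
  [/\ right_action a,
      sharp k a,
      k = 2 -> forall g, has_order 2 g -> forall u, a u g <> u
    & k = 3 ->
      (forall g, has_order 2 g -> exists! u, a u g = u) /\
      (forall g, has_order 3 g -> forall u, a u g <> u)].

Lemma act_in_space s : in_space (space_act s).
Proof. exact: (set_valP s). Qed.

Lemma in_space_act a : in_space a -> exists s : space, space_act s = a.
Proof.
move=> aS; have [[a1 aM] _ _ _] := aS.
have ab g : bijective (a^~ g).
  by exists (a^~ g^-1) => u; rewrite -aM ?mulgV ?mulVg a1.
pose s : {ptws G -> perm_space U} := fun g => SigSub (mem_set (ab g)).
have sS : sharp_actions U G k s by [].
by exists (SigSub (mem_set sS)).
Qed.

Lemma nbhs_space (s : space) (A : set space) :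
  nbhs s A <-> exists F : seq (U * G), forall s',
    (forall x, x \in F -> space_act s' x.1 x.2 = space_act s x.1 x.2) -> A s'.
Proof.
pose B (F : seq (U * G)) : set space :=
  [set s' | forall x, x \in F -> space_act s' x.1 x.2 = space_act s x.1 x.2].
pose Fi := filter_from [set: seq (U * G)] B.
have FF : Filter Fi.
  apply: filter_from_filter; first by exists [::].
  move=> F F' _ _; exists (F ++ F') => // s' s'P.
  by split=> x xF; apply: s'P; rewrite mem_cat xF ?orbT.
(* Four layers are unwound: the subspace of actions, the product over [G], the bijections among all
   maps, and the product over [U]. *)
have Fs : Fi --> s.
  apply: cvg_initial; apply/cvg_sup => g; apply: cvg_initial.
  apply: (@cvg_initial (perm_space U) {ptws U -> discrete_topology U} set_val).
  apply/cvg_sup => u; apply: cvg_initial => C.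
  rewrite nbhs_principalE => /= Cu.
  exists [:: (u, g)]; first by [].
  move=> s' s'P.
  have E := s'P (u, g) (mem_head _ _); rewrite /space_act /act_of /= in E.
  by rewrite /= E; exact: (principal_filterP _ _).1 Cu.
split=> [/Fs[F _ BA]|[F FA]]; first by exists F.
apply: filterS FA _; elim: F => [|[u g] F IH].
  by apply: filterS (@filterT _ _ _) => s' _ x.
have ug : nbhs s [set s' | space_act s' u g = space_act s u g].
  have c1 : set_val @ s --> set_val s by exact: initial_continuous.
  have c2 : (fun s' : space => set_val s' g) @ s --> set_val s g.
    exact: (cvg_comp _ _ c1 (@proj_continuous G (fun=> perm_space U) g _)).
  have c3 : (fun s' : space => set_val (set_val s' g)) @ s --> set_val (set_val s g).
    exact: (cvg_comp _ _ c2 (@initial_continuous _ _ set_val _)).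
  have c4 := cvg_comp _ _ c3 (@proj_continuous U (fun=> discrete_topology U) u _).
  have := c4 [set space_act s u g]; rewrite nbhs_principalE; apply.
  exact/principal_filterP.
apply: filterS (filterI ug IH) => s' [/= E1 E2] x; rewrite inE.
by case/orP => [/eqP ->|/E2].
Qed.

End Space.

(** * Polish spaces given by integer codes *)

Section CodedSpace.
Import Order.TTheory GRing.Theory Num.Theory.
Local Open Scope classical_set_scope.
Local Open Scope ring_scope.
Variables (R : realType) (X : topologicalType) (c : nat -> X -> nat).
Hypothesis c_nbhs : forall x A, nbhs x A <->
  exists n, forall y, (forall i, (i < n)%N -> c i y = c i x) -> A y.
Hypothesis c_inj : forall x y, (forall i, c i x = c i y) -> x = y.
Hypothesis c_complete : forall f : nat -> nat,
  (forall n, exists x, forall i, (i < n)%N -> c i x = f i) ->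
  exists x, forall i, c i x = f i.

Let first (P : pred nat) : R :=
  if pselect (exists i, P i) is left e then (ex_minn e).+1%:R^-1 else 0.

Let diff x y : R := first (fun i => c i x != c i y).

Let diff_lt x y n : diff x y < n.+1%:R^-1 <->
  forall i, (i <= n)%N -> c i x = c i y.
Proof.
rewrite /diff /first; case: pselect => [e|ne].
  case: ex_minnP => m mP mmin; rewrite ltf_pV2 ?posrE // ltr_nat ltnS.
  split=> [nm i ni|E]; last first.
    by rewrite ltnNge; apply/negP => /E /eqP; apply/negP.
  apply/eqP/negPn/negP => /mmin; rewrite leqNgt => /negP; apply.
  exact: leq_ltn_trans nm.
rewrite invr_gt0 ltr0n; split=> // _ i _.
by apply/eqP/negPn/negP => ci; apply: ne; exists i.
Qed.

Let diff_ge0 x y : 0 <= diff x y.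
Proof. by rewrite /diff /first; case: pselect => // e; rewrite invr_ge0. Qed.

Let diff_sym x y : diff x y = diff y x.
Proof.
have E : (fun i => c i x != c i y) = (fun i => c i y != c i x).
  by apply/funext => i; rewrite eq_sym.
by rewrite /diff E.
Qed.

Let small (e : R) : 0 < e -> exists n, n.+1%:R^-1 < e.
Proof.
move=> e0; exists (Num.truncn e^-1); rewrite -[e]invrK ltf_pV2 ?posrE ?invr_gt0 //.
by rewrite invrK truncnS_gt.
Qed.

(** The codes identify [X] with a closed subspace of Baire space, and [diff] is the usual metric
    there, the inverse of one plus the first place of disagreement. *)
Lemma polish_coded : polish R X.
Proof.
split.
  have [[x0]|nX] := pselect (inhabited X); last first.
    by exists set0 => // O [x _]; case: nX; exists; exact: x.
  pose agree (p : seq nat) : set X :=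
    [set x | forall i, (i < size p)%N -> c i x = nth 0 p i].
  (* One point for each finite prefix; [x0] stands in for prefixes that do not occur. *)
  exists (range (fun p => xget x0 (agree p))).
    apply: card_le_trans (card_image_le _ _) _; exact: countableP.
  move=> O [x Ox] oO; have /c_nbhs[n nO] : nbhs x O by exact: open_nbhs_nbhs.
  pose p := mkseq (c^~ x) n.
  have : agree p (xget x0 (agree p)).
    by apply: (@xgetPex _ x0 (agree p)); exists x => i; rewrite size_mkseq => ni; rewrite nth_mkseq.
  exists (xget x0 (agree p)); split; last by exists p.
  by apply: nO => i ni; rewrite H ?size_mkseq // nth_mkseq.
exists diff; split.
- move=> x y; split=> [d0|->].
    by apply: c_inj => i; apply: (iffLR (diff_lt x y i)); rewrite // d0 invr_gt0.
  by rewrite /diff /first; case: pselect => // e; case: (ex_minnP e) => i; rewrite eqxx.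
- exact: diff_sym.
- move=> x y z; rewrite leNgt; apply/negP; rewrite {3}/diff /first.
  case: pselect => [e|_]; last by rewrite ltNge addr_ge0 ?diff_ge0.
  case: ex_minnP => m mP _ h.
  have xy : diff x y < m.+1%:R^-1 by apply: le_lt_trans h; rewrite lerDl.
  have yz : diff y z < m.+1%:R^-1 by apply: le_lt_trans h; rewrite lerDr.
  move/diff_lt/(_ m (leqnn m)): xy => xy; move/diff_lt/(_ m (leqnn m)): yz => yz.
  by move: mP; rewrite xy yz eqxx.
- move=> x A; split=> [/c_nbhs[n nA]|[e /small[n ne] eA]].
    exists n.+1%:R^-1; first by rewrite invr_gt0.
    by move=> y /= /diff_lt E; apply: nA => i ni; rewrite E // ltnW.
  apply/c_nbhs; exists n.+1 => y E; apply: eA => /=; apply: lt_trans ne.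
  by apply/diff_lt => i ni; rewrite E.
- move=> u cu.
  have cu' n : exists N, forall m, (N <= m)%N -> forall i, (i <= n)%N -> c i (u m) = c i (u N).
    have [|N NP] := cu n.+1%:R^-1; first by rewrite invr_gt0.
    by exists N => m Nm; apply/diff_lt; exact: NP.
  have [N NP] := choice cu'.
  have [|l lP] := c_complete (f := fun i => c i (u (N i))).
    move=> n; exists (u (\max_(i < n) N i)%N) => i ni.
    by apply: (NP i) => //; exact: (@leq_bigmax _ (fun j : 'I_n => N j) (Ordinal ni)).
  exists l => A /c_nbhs[n nA]; exists (\max_(i < n) N i)%N => // m /= nm.
  apply: nA => i ni; rewrite lP; apply: (NP i) => //; apply: leq_trans nm.
  exact: (@leq_bigmax _ (fun j : 'I_n => N j) (Ordinal ni)).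
Qed.

End CodedSpace.

Lemma completion_enumerate (k : nat) (D : {set {group 'S_k}})
    (T : {W : {group 'S_k} | W \in D} -> finType) :
  exists p : nat -> completion T, forall g, exists n, p n = g.
Proof.
pose L : finType := ('S_k + letter T)%type.
pose ev (s : seq L) : completion T :=
  foldr (fun l x => x * match l with inl w => cperm T w | inr a => clet a end) 1 s.
exists (fun n => if unpickle n is Some s then ev s else 1) => g.
suff [s <-] : exists s, ev s = g by exists (pickle s); rewrite pickleK.
elim/completion_ind: g => [|x w [s <-]|x a [s <-]].
- by exists [::].
- by exists (inl w :: s).
- by exists (inr a :: s).
Qed.

Lemma entry_enumerate (U : choiceType) (G : groupType) :
  [set: U] #= [set: nat] -> (exists p : nat -> G, forall g, exists n, p n = g) ->
  exists p : nat -> (U * G + G)%type, forall i, exists n, p n = i.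
Proof.
move=> /card_nat_bij[f [f' fK f'K]] [q qP].
exists (fun n => match unpickle n : option (nat * nat + nat) with
  | Some (inl (a, b)) => inl (f' a, q b)
  | Some (inr b) => inr (q b)
  | None => inr 1 end) => -[[u g]|g]; have [b <-] := qP g.
  by exists (pickle (inl (f u, b) : nat * nat + nat)); rewrite pickleK fK.
by exists (pickle (inr b : nat * nat + nat)); rewrite pickleK.
Qed.

(** * Coding actions by integers *)

Section Codes.
Variables (U : choiceType) (G : groupType) (k : nat).
Notation space := (set_type (sharp_actions U G k)).
Notation entry := ((U * G) + G)%type.
Variables (f : U -> nat) (f' : nat -> U) (p : nat -> entry) (idx : entry -> nat).
Hypotheses (fK : cancel f f') (f'K : cancel f' f) (idxK : cancel idx p).
Implicit Types (s : space) (u v : U) (g h : G).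

Definition fixpoint (a : U -> G -> U) g : U := xget (f' 0) [set u | a u g = u].

Lemma fixpointP (a : U -> G -> U) g u : (exists! v, a v g = v) ->
  a u g = u <-> u = fixpoint a g.
Proof.
case=> v [vg vu]; have fg : a (fixpoint a g) g = fixpoint a g.
  by apply: (@xgetPex _ (f' 0) [set w | a w g = w]); exists v.
by split=> [ug|->//]; rewrite -(vu _ ug) (vu _ fg).
Qed.

(* For [k = 3] the fixed points of the involutions are recorded as well:
   otherwise they could escape to infinity along a Cauchy sequence. *)
Definition space_code (i : entry) s : nat :=
  match i with
  | inl (u, g) => f (space_act s u g)
  | inr g => if `[< k = 3 /\ has_order 2 g >] then f (fixpoint (space_act s) g) else 0
  end.

Lemma space_fixpoint s g u : k = 3 -> has_order 2 g ->
  space_act s u g = u <-> u = fixpoint (space_act s) g.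
Proof.
move=> k3 g2; apply: fixpointP; have [_ _ _] := act_in_space s.
by case/(_ k3) => + _; exact.
Qed.

Lemma space_code_nbhs s (A : set space) : nbhs s A <->
  exists n, forall s', (forall i, (i < n)%N -> space_code (p i) s' = space_code (p i) s) -> A s'.
Proof.
rewrite nbhs_space; split=> [[F FA]|[n nA]].
  exists (\max_(x <- F) idx (inl x)).+1 => s' s's; apply: FA => -[u g] xF.
  have := s's (idx (inl (u, g))); rewrite ltnS idxK => E; apply: (can_inj fK).
  by apply: E; apply: (@leq_bigmax_seq _ F xpredT (fun x => idx (inl x))).
pose pt (i : entry) : U * G :=
  match i with inl x => x | inr g => (fixpoint (space_act s) g, g) end.
exists [seq pt (p i) | i <- iota 0 n] => s' s's; apply: nA => i ni.
have : pt (p i) \in [seq pt (p i) | i <- iota 0 n].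
  by apply/mapP; exists i; rewrite // mem_iota.
move/s's; case: (p i) => [[u g]|g] /= E; first by rewrite E.
case: asboolP => // -[k3 g2]; congr f; apply/esym.
apply/(space_fixpoint s' _ k3 g2); rewrite E; exact/(space_fixpoint s _ k3 g2).
Qed.

Lemma space_code_inj s s' : (forall i, space_code (p i) s = space_code (p i) s') -> s = s'.
Proof.
move=> E; apply: space_act_inj => u g; apply: (can_inj fK).
by have := E (idx (inl (u, g))); rewrite idxK.
Qed.

(** Each axiom of the space, once its points and elements are given, involves finitely many entries
    and is inherited from an action with these codes. The existence of fixed points, which is not of
    this kind, comes from the recorded ones. *)
Lemma space_code_complete (c : nat -> nat) :
  (forall n, exists s, forall i, (i < n)%N -> space_code (p i) s = c i) ->
  exists s, forall i, space_code (p i) s = c i.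
Proof.
move=> ap.
have apF (F : seq entry) : exists s, forall i, i \in F -> space_code i s = c (idx i).
  have [s sP] := ap (\max_(i <- F) idx i).+1; exists s => i iF.
  rewrite -(sP (idx i)) ?idxK // ltnS.
  exact: (@leq_bigmax_seq _ F xpredT idx).
pose a u g := f' (c (idx (inl (u, g)))).
have aE (F : seq entry) : exists s, forall i, i \in F -> match i with
  | inl (u, g) => space_act s u g = a u g
  | inr g => k = 3 -> has_order 2 g -> fixpoint (space_act s) g = f' (c (idx (inr g)))
  end.
  have [s sP] := apF F; exists s => i /sP; case: i => [[u g]|g] /= E.
    by rewrite /a -E fK.
  by move=> k3 g2; rewrite -E; case: asboolP => [_|[]//]; rewrite fK.
have av g : k = 3 -> has_order 2 g ->
    a (f' (c (idx (inr g)))) g = f' (c (idx (inr g))).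
  set v := f' _ => k3 g2; have [s sP] := aE [:: inl (v, g); inr g].
  rewrite -(sP (inl (v, g))) ?inE ?eqxx //; apply/(space_fixpoint s _ k3 g2).
  by rewrite (sP (inr g)) // !inE eqxx orbT.
have aS : in_space k a.
  split.
  - split=> [u|u g h].
      have [s sP] := aE [:: inl (u, 1)]; rewrite -(sP (inl (u, 1))) ?inE ?eqxx //.
      by have [[-> ]] := act_in_space s.
    have [s sP] := aE [:: inl (u, g * h); inl (u, g); inl (a u g, h)].
    rewrite -(sP (inl (u, g * h))) ?inE ?eqxx ?orbT //.
    rewrite -(sP (inl (a u g, h))) ?inE ?eqxx ?orbT //.
    rewrite -(sP (inl (u, g))) ?inE ?eqxx ?orbT //.
    by have [[_ -> ]] := act_in_space s.
  - move=> g x xi xg.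
    have [s sP] := aE [seq inl (x i, g) | i <- enum 'I_k].
    have [_ ss _ _] := act_in_space s; apply: (ss g x xi) => i.
    rewrite (sP (inl (x i, g))) //.
    by apply: map_f; rewrite mem_enum.
  - move=> k2 g g2 u.
    have [s sP] := aE [:: inl (u, g)].
    rewrite -(sP (inl (u, g))) ?inE //; have [_ _ + _] := act_in_space s.
    by apply.
  - move=> k3; split=> g gn; last first.
      move=> u; have [s sP] := aE [:: inl (u, g)].
      rewrite -(sP (inl (u, g))) ?inE //; have [_ _ _] := act_in_space s.
      by case/(_ k3) => _; apply.
    exists (f' (c (idx (inr g)))); split=> [|u ug]; first exact: av.
    have [s sP] := aE [:: inl (u, g); inr g].
    have <- : fixpoint (space_act s) g = f' (c (idx (inr g))).
      by rewrite (sP (inr g)) // !inE eqxx orbT.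
    apply/esym/(space_fixpoint s _ k3 gn).
    by rewrite (sP (inl (u, g))) ?inE ?eqxx.
have [s sa] := in_space_act aS; exists s => i.
(* [p] may list an entry several times; an action realising both codes shows that they agree. *)
have -> : c i = c (idx (p i)).
  have [s' s'P] := ap (maxn i (idx (p i))).+1.
  rewrite -(s'P i) ?ltnS ?leq_maxl // -(s'P (idx (p i))) ?ltnS ?leq_maxr //.
  by rewrite idxK.
case: (p i) => [[u g]|g] /=; first by rewrite sa /a f'K.
case: asboolP => [[k3 g2]|ng].
  rewrite -[RHS]f'K; congr f; apply/esym/(space_fixpoint s _ k3 g2).
  by rewrite sa av.
have [s' s'P] := apF [:: inr g]; rewrite -(s'P (inr g)) ?inE //=.
by case: asboolP.
Qed.

End Codes.

(** * Conjugate actions *)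

Lemma injective_card_le (X Y : Type) (f : X -> Y) : injective f ->
  [set: X] #<= [set: Y].
Proof. by move=> fi; apply: (@card_ge_preimage _ _ setT f) => x y _ _; apply: fi. Qed.

(** Exchanges [2n + 1] and [2n + 2] when [b n] holds, and fixes [0]. *)
Definition swap_pairs (b : nat -> bool) (m : nat) : nat :=
  if m is n.+1 then if b n./2 then if odd n then n else n.+2 else m else 0.

Lemma swap_pairsK b : involutive (swap_pairs b).
Proof.
case=> // n; rewrite /swap_pairs; case bn: (b n./2); last by rewrite bn.
have E := odd_double_half n; case on: (odd n) in E *.
  by rewrite -E /= add0n doubleK bn odd_double.
by rewrite -E /= add0n uphalf_double bn odd_double.
Qed.

Lemma swap_pairs_inj b b' : swap_pairs b =1 swap_pairs b' -> b = b'.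
Proof.
move=> E; apply/funext => n; have := E n.*2.+1.
by rewrite /swap_pairs doubleK odd_double; case: (b n); case: (b' n) => // /eqP;
  rewrite ?(gtn_eqF (ltnSn _)) ?(ltn_eqF (ltnSn _)).
Qed.

Lemma in_space_conj (U : choiceType) (G : groupType) (k : nat)
    (a : U -> G -> U) (q : U -> U) :
  involutive q -> in_space k a -> in_space k (fun u g => q (a (q u) g)).
Proof.
move=> qK [[a1 aM] ss s2 s3]; have qi := inv_inj qK; split.
- by split=> [u|u g h]; rewrite ?a1 ?aM ?qK.
- move=> g x xi xg; apply: (ss g (q \o x)) => [i j /= /qi/xi //|i].
  by apply: qi; rewrite /= xg qK.
- by move=> k2 g g2 u /(congr1 q); rewrite qK; apply: s2.
- move=> k3; have [h2 h3] := s3 k3; split=> g gn; last first.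
    by move=> u /(congr1 q); rewrite qK; apply: h3.
  have [v [vg vu]] := h2 g gn; exists (q v); split=> [|u].
    by rewrite qK vg.
  by move/(congr1 q); rewrite qK => /vu ->; rewrite qK.
Qed.

Lemma sharply_transitive_orbit (U : choiceType) (G : groupType) (k : nat)
    (a : U -> G -> U) (x : 'I_k -> U) (i : 'I_k) (u : U) :
  sharply_transitive k a -> injective x -> exists g, a (x i) g = u.
Proof.
move=> st xi.
(* Transposing [x i] and [u] keeps the entries of the tuple distinct. *)
pose tr v := if v == x i then u else if v == u then x i else v.
have trK : involutive tr.
  move=> v; rewrite /tr; case: (eqVneq v (x i)) => [->|vx].
    by rewrite eqxx; case: eqVneq.
  by case: (eqVneq v u) => [->|/negPf ->]; rewrite ?eqxx ?(negPf vx).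
have [g [gP _]] := st x (tr \o x) xi (inj_comp (inv_inj trK) xi); exists g.
by rewrite gP /= /tr eqxx.
Qed.

(** * Polishness, category and cardinality of the space *)

Section Main.
Variables (k : nat) (D : {set {group 'S_k}}).
Variable T : {W : {group 'S_k} | W \in D} -> finType.
Hypothesis hk : k = 2 \/ k = 3.
Hypothesis hD : docile_representatives D.
Hypothesis hT : forall W, (2 <= #|T W|)%N.
Variable U : choiceType.
Hypothesis hU : [set: U] #= [set: nat].
Notation G := (completion T).
Notation space := (set_type (sharp_actions U G k)).

Let dm := representatives_docile hD.

Lemma space_coding : exists f : U -> nat, exists f', exists p, exists idx,
  [/\ cancel f f', cancel f' f & @cancel nat (U * G + G)%type idx p].
Proof.
have [f [f' fK f'K]] := card_nat_bij hU.
have [p pP] := entry_enumerate hU (completion_enumerate T).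
have [idx idxK] := choice pP.
by exists f, f', p, idx.
Qed.

Lemma space_polish (R : realType) : polish R space.
Proof.
have [f [f' [p [idx [fK f'K idxK]]]]] := space_coding.
apply: (@polish_coded R space (fun i s => space_code f f' (p i) s)).
- exact: space_code_nbhs fK idxK.
- exact: space_code_inj fK idxK.
- exact: space_code_complete fK f'K idxK.
Qed.

Lemma transitive_dense (s : space) (F : seq (U * G)) : exists s' : space,
  (forall x, x \in F -> space_act s' x.1 x.2 = space_act s x.1 x.2) /\
  sharply_transitive k (space_act s').
Proof.
have [ra ss s2 s3] := act_in_space s.
have [e [hb ts]] := space_base hk hU ra ss s2 s3.
have vP := valid_trivial T hb.
have eP : extends (trivial_partial (fun u w => space_act s u (cperm T w))) (space_act s).
  by move=> a u v [-> nf]; have := nonfree_fixed hk hb ts nf.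
have [Q [vQ gQ _ eQ QF]] :=
  finite_part hk (@completion_britton _ _ _ hk hD hT _ hU) hb F ts vP eP.
have [a [ta ea st]] := transitive_extension hk hD hT hU hb vQ gQ.
have [s' s'a] := in_space_act (total_in_space hk hD hT hU hb ta).
exists s'; rewrite s'a; split=> // x xF.
by apply: QF xF => //; [exact: total_act ta|exact: total_perm ta].
Qed.

(** There are countably many pairs of tuples. Carrying one given tuple to another is an open
    condition, and it is dense by [transitive_dense]; uniqueness of the element is sharpness. *)
Lemma space_comeagre : comeagre (sharply_transitive_actions U G k).
Proof.
have [en enP] := enumerate hU.
pose tup (b : {ffun 'I_k -> nat}) (i : 'I_k) : U := en (b i).
pose bad (b : {ffun 'I_k -> nat} * {ffun 'I_k -> nat}) : set space :=
  [set s | [/\ injective (tup b.1), injective (tup b.2) &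
    ~ exists g, forall i, space_act s (tup b.1 i) g = tup b.2 i]].
exists (fun n => if unpickle n is Some b then bad b else set0).
  move=> n; case: unpickle => [b|]; last by rewrite /nowhere_dense closure0 interior0.
  apply/eqP; apply/negPn/negP => /set0P[s]; rewrite /interior => /nbhs_space[F sF].
  have [s' [s's st]] := transitive_dense s F.
  have [|s0 [[xi yi _] _]] := sF s' s's setT; first exact: filterT.
  have [g [gP _]] := st _ _ xi yi.
  have : nbhs s' [set s'' | forall x, x \in [seq (tup b.1 i, g) | i <- enum 'I_k] ->
      space_act s'' x.1 x.2 = space_act s' x.1 x.2].
    by apply/nbhs_space; exists [seq (tup b.1 i, g) | i <- enum 'I_k].
  move/(sF s' s's) => [s1 [[_ _ ng] s1P]]; apply: ng; exists g => i.
  by rewrite -gP; apply: (s1P (tup b.1 i, g)); apply: map_f; rewrite mem_enum.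
move=> s nst; apply: contrapT => nb; apply: nst => x y xi yi.
have [_ ss _ _] := act_in_space s; have [ra _ _ _] := act_in_space s.
have [g gP] : exists g, forall i, space_act s (x i) g = y i.
  apply: contrapT => ng; apply: nb.
  have [cx cxP] := choice (fun i => enP (x i)).
  have [cy cyP] := choice (fun i => enP (y i)).
  exists (pickle ([ffun i => cx i], [ffun i => cy i])) => //.
  rewrite pickleK; split => /=.
  - by move=> i j; rewrite /tup !ffunE !cxP => /xi.
  - by move=> i j; rewrite /tup !ffunE !cyP => /yi.
  - case=> g gP; apply: ng; exists g => i.
    by have := gP i; rewrite /tup !ffunE cxP cyP.
exists g; split=> // g' g'P.
have : g * g'^-1 = 1.
  by apply: (ss _ x xi) => i; rewrite (ractM ra) gP -g'P (ractK ra).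
by move=> /eqP; rewrite divg_eq1 => /eqP.
Qed.

Lemma space_card : sharp_actions U G k #= [set: nat -> bool].
Proof.
have [f [f' [p [idx [fK f'K idxK]]]]] := space_coding.
apply: card_eq_trans (card_setT_sym _) _; rewrite card_eq_le; apply/andP; split.
  pose F (s : space) (n : nat) : bool :=
    if unpickle n is Some (i, m) then space_code f f' (p i) s == m else false.
  apply: (@injective_card_le _ _ F) => s s' E; apply: (space_code_inj fK idxK) => i.
  have := congr1 (fun h => h (pickle (i, space_code f f' (p i) s'))) E.
  by rewrite /F pickleK eqxx => /eqP.
have [x0 [e hb]] := standard_base k hU.
have [a [ta _ st]] := transitive_extension hk hD hT hU hb (valid_trivial T hb)
  (good_trivial T hb dm).
have aS := total_in_space hk hD hT hU hb ta.
pose q b u := f' (swap_pairs b (f u)).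
have qK b : involutive (q b) by move=> u; rewrite /q f'K swap_pairsK fK.
have [F FP] := choice (fun b => in_space_act (in_space_conj (qK b) aS)).
apply: (@injective_card_le _ _ F) => b b' E; apply: swap_pairs_inj => n.
have k0 : 0 < k by case: hk => ->.
pose x (i : 'I_k) := f' i.
have xi : injective x by move=> i j /(can_inj f'K) /val_inj.
have [g gP] := sharply_transitive_orbit (Ordinal k0) (f' n) st xi.
(* [g] carries [f' 0] to [f' n], and all the permutations [q b] fix [f' 0]; so the conjugate action
   sends [f' 0] under [g] to the image of [f' n] under [q b]. *)
have := FP b; rewrite E FP => /(congr1 (fun h => h (f' 0) g)).
have q0 c : q c (f' 0) = f' 0 by rewrite /q f'K.
by rewrite !q0 gP /q f'K => /(can_inj f'K).
Qed.

End Main.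

Local Close Scope group_scope.

Theorem corollary6p4 (R : realType) (k : nat) (hk : k = 2 \/ k = 3)
    (D : {set {group 'S_k}}) (hD : docile_representatives D)
    (T : {W : {group 'S_k} | W \in D} -> finType)
    (hT : forall W, (2 <= #|T W|)%N)
    (U : choiceType) (hU : [set: U] #= [set: nat]) :
  (polish R (set_type (sharp_actions U (completion T) k)) /\
   sharp_actions U (completion T) k #= [set: nat -> bool] /\
   comeagre (sharply_transitive_actions U (completion T) k)) /\
  (non_split k (completion T) /\ finitely_presented (completion T)).
Proof.
split; last split.
- split; first exact: space_polish.
  by split; [exact: space_card|exact: space_comeagre].
- exact (completion_non_split hk hD hT hU).
- exact: completion_finitely_presented.
Qed.
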